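(* The set of semiregular functions on a symmetric slice domain $\Omega\subseteq\mathbb{H}$ is a division ring with respect to $+,*$.
   Context: $\mathbb{H}$ denotes the quaternions, $\mathbb{S}=\{q\in\mathbb{H}:q^2=-1\}$, and $x+y\mathbb{S}=\{x+Jy:J\in\mathbb{S}\}$. For $\Omega\subseteq\mathbb{H}$ and $I\in\mathbb{S}$ put $\Omega_I=\Omega\cap(\mathbb{R}+I\mathbb{R})$ and $f_I=f|_{\Omega_I}$. A function $f_I$ is holomorphic if it has continuous partial derivatives and $\frac12\left(\frac{\partial}{\partial x}+I\frac{\partial}{\partial y}\right)f_I(x+Iy)\equiv0$; a function $f:\Omega\to\mathbb{H}$ on an open set is regular if $f_I$ is holomorphic for all $I\in\mathbb{S}$. A set is symmetric if together with each $x+Iy$ it contains $x+y\mathbb{S}$. A domain (connected open set) $\Omega$ is a slice domain if it meets the real axis and every $\Omega_I$ is a domain in $\mathbb{R}+I\mathbb{R}$. On a symmetric slice domain $\Omega$, every holomorphic $\phi:\Omega_I\to\mathbb{H}$ has a unique regular extension $\mathrm{ext}(\phi)$ to $\Omega$. For $f,g$ regular on $\Omega$ and $I\perp J$ in $\mathbb{S}$, write $f_I=F+GJ$, $g_I=H+KJ$ with $F,G,H,K:\Omega_I\to\mathbb{R}+I\mathbb{R}$ holomorphic; then (independently of $I,J$) $$f*g=\mathrm{ext}\left(\left[F(z)H(z)-G(z)\overline{K(\bar z)}\right]+\left[F(z)K(z)+G(z)\overline{H(\bar z)}\right]J\right).$$ For $p\in\mathbb{R}+I\mathbb{R}$ and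 $n\in\mathbb{Z}$, $(q-p)^{*n}$ is the regular function (on $\mathbb{H}$ if $n\ge0$, on $\mathbb{H}$ minus the sphere $x+y\mathbb{S}$ through $p$ if $n<0$) whose restriction to $\mathbb{R}+I\mathbb{R}$ is $(z-p)^n$. Singularities. Put $\sigma(q,p)=\tau(q,p)=|q-p|$ if $p,q$ lie on a common complex line $\mathbb{R}+I\mathbb{R}$, and otherwise $\sigma(q,p)=\sqrt{(\mathrm{Re}\,q-\mathrm{Re}\,p)^2+(|\mathrm{Im}\,q|+|\mathrm{Im}\,p|)^2}$, $\tau(q,p)=\sqrt{(\mathrm{Re}\,q-\mathrm{Re}\,p)^2+(|\mathrm{Im}\,q|-|\mathrm{Im}\,p|)^2}$. Let $\Sigma(p,0,R)=\{q:\tau(q,p)>0,\ \sigma(q,p)<R\}$. If $f$ is regular on a symmetric slice domain $\Omega'$, a point $p\in\mathbb{H}$ is a singularity for $f$ if $\Sigma(p,0,R)\subseteq\Omega'$ for some $R>0$; then $f(q)=\sum_{n\in\mathbb{Z}}(q-p)^{*n}a_n$ in $\Sigma(p,0,R)$, whose restriction to the complex line $\mathbb{R}+I\mathbb{R}$ through $p$ is the Laurent expansion $f_I(z)=\sum_{n\in\mathbb{Z}}(z-p)^na_n$ in $0<|z-p|<R$. The point $p$ is a pole if there is $m\ge0$ with $a_{-k}=0$ for all $k>m$. It is removable if $f$ extends to a neighborhood of $p$ as a regular function. A function is semiregular in a symmetric slice domain $\Omega$ if it is regular in a symmetric slice domain $\Omega'\subseteq\Omega$ such that every point of $\Omega\setminus\Omega'$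 is a pole or a removable singularity for it. Semiregular functions are extended across removable singularities (so two of them are identified if they coincide where both are defined). If $\mathcal{S}_f,\mathcal{S}_g$ are the sets of non removable singularities of $f,g$ in $\Omega$, then $f+g$ and $f*g$ are computed on the symmetric slice domain $\Omega\setminus(\mathcal{S}_f\cup\mathcal{S}_g)$, where both functions are regular. *)

(* Defs.v *)
From HB Require Import structures.
From mathcomp Require Import all_boot all_order all_algebra.
From mathcomp Require Import all_classical all_reals all_analysis.
From mathcomp Require Import ring lra.
Set Implicit Arguments.
Unset Strict Implicit.
Unset Printing Implicit Defensive.
Import Order.TTheory GRing.Theory Num.Theory.
Import numFieldNormedType.Exports.
Local Open Scope classical_set_scope.
Local Open Scope ring_scope.

(** * Quaternions *)

(* The row (a, b, c, d) stands for a + b i + c j + d k.  The topology is that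
   of R^4; the norm `|q| inherited from row vectors is the sup norm, the
   Euclidean modulus is [qabs] below. *)
Definition quat (R : realType) := 'rV[R]_4.

HB.instance Definition _ (R : realType) := NormedModule.copy (quat R) 'rV[R]_4.
HB.instance Definition _ (R : realType) := Complete.copy (quat R) 'rV[R]_4.

Section Quaternions.
Variable R : realType.
Implicit Types p q r : quat R.

Definition mkq (a b c d : R) : quat R := \row_(i < 4) [:: a; b; c; d]`_i.

Definition qre q : R := q 0 (@Ordinal 4 0 isT).
Definition qci q : R := q 0 (@Ordinal 4 1 isT).
Definition qcj q : R := q 0 (@Ordinal 4 2 isT).
Definition qck q : R := q 0 (@Ordinal 4 3 isT).

Lemma quatP p q : qre p = qre q -> qci p = qci q ->
  qcj p = qcj q -> qck p = qck q -> p = q.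
Proof.
move=> h0 h1 h2 h3; apply/rowP => -[[|[|[|[|//]]]] hi].
- by move: h0; rewrite /qre (bool_irrelevance hi isT).
- by move: h1; rewrite /qci (bool_irrelevance hi isT).
- by move: h2; rewrite /qcj (bool_irrelevance hi isT).
- by move: h3; rewrite /qck (bool_irrelevance hi isT).
Qed.

Lemma qre_mk a b c d : qre (mkq a b c d) = a. Proof. by rewrite /qre mxE. Qed.
Lemma qci_mk a b c d : qci (mkq a b c d) = b. Proof. by rewrite /qci mxE. Qed.
Lemma qcj_mk a b c d : qcj (mkq a b c d) = c. Proof. by rewrite /qcj mxE. Qed.
Lemma qck_mk a b c d : qck (mkq a b c d) = d. Proof. by rewrite /qck mxE. Qed.
Definition mkqE := (qre_mk, qci_mk, qcj_mk, qck_mk).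

Lemma qreD p q : qre (p + q) = qre p + qre q. Proof. by rewrite /qre mxE. Qed.
Lemma qciD p q : qci (p + q) = qci p + qci q. Proof. by rewrite /qci mxE. Qed.
Lemma qcjD p q : qcj (p + q) = qcj p + qcj q. Proof. by rewrite /qcj mxE. Qed.
Lemma qckD p q : qck (p + q) = qck p + qck q. Proof. by rewrite /qck mxE. Qed.
Definition qcoordD := (qreD, qciD, qcjD, qckD).

Lemma qreZ (a : R) q : qre (a *: q) = a * qre q. Proof. by rewrite /qre mxE. Qed.
Lemma qciZ (a : R) q : qci (a *: q) = a * qci q. Proof. by rewrite /qci mxE. Qed.
Lemma qcjZ (a : R) q : qcj (a *: q) = a * qcj q. Proof. by rewrite /qcj mxE. Qed.
Lemma qckZ (a : R) q : qck (a *: q) = a * qck q. Proof. by rewrite /qck mxE. Qed.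
Definition qcoordZ := (qreZ, qciZ, qcjZ, qckZ).

Definition qone : quat R := mkq 1 0 0 0.

Definition qmul p q : quat R := mkq
  (qre p * qre q - qci p * qci q - qcj p * qcj q - qck p * qck q)
  (qre p * qci q + qci p * qre q + qcj p * qck q - qck p * qcj q)
  (qre p * qcj q - qci p * qck q + qcj p * qre q + qck p * qci q)
  (qre p * qck q + qci p * qcj q - qcj p * qci q + qck p * qre q).

Definition qconj q : quat R := mkq (qre q) (- qci q) (- qcj q) (- qck q).

Definition qdot p q : R :=
  qre p * qre q + qci p * qci q + qcj p * qcj q + qck p * qck q.

Definition qabs q : R := Num.sqrt (qdot q q).

Definition qim q : quat R := mkq 0 (qci q) (qcj q) (qck q).

Definition qinv q : quat R := (qdot q q)^-1 *: qconj q.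

Ltac quat_solve := apply: quatP; rewrite ?(mkqE, qcoordD, qcoordZ); ring.

Lemma qmulA : associative qmul.
Proof. by move=> p q r; quat_solve. Qed.
Lemma qmul1q : left_id qone qmul.
Proof. by move=> p; quat_solve. Qed.
Lemma qmulq1 : right_id qone qmul.
Proof. by move=> p; quat_solve. Qed.
Lemma qmulDl : left_distributive qmul +%R.
Proof. by move=> p q r; quat_solve. Qed.
Lemma qmulDr : right_distributive qmul +%R.
Proof. by move=> p q r; quat_solve. Qed.
Lemma qone_neq0 : qone != 0 :> quat R.
Proof.
apply/eqP => /(congr1 qre); rewrite mkqE /qre mxE => /eqP.
by rewrite oner_eq0.
Qed.

HB.instance Definition _ := GRing.Zmodule_isNzRing.Build (quat R)
  qmulA qmul1q qmulq1 qmulDl qmulDr qone_neq0.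

Lemma qmulE p q : p * q = qmul p q. Proof. by []. Qed.

Lemma qscalerAl (a : R) p q : a *: (p * q) = (a *: p) * q.
Proof. by rewrite !qmulE; quat_solve. Qed.
HB.instance Definition _ := GRing.Lmodule_isLalgebra.Build R (quat R) qscalerAl.

Lemma qscalerAr (a : R) p q : a *: (p * q) = p * (a *: q).
Proof. by rewrite !qmulE; quat_solve. Qed.
HB.instance Definition _ := GRing.Lalgebra_isAlgebra.Build R (quat R) qscalerAr.

Lemma qdot_neq0 q : q != 0 -> qdot q q != 0.
Proof.
apply: contra_neq => h; rewrite /qdot in h.
apply: quatP; rewrite [RHS]mxE; apply/eqP; rewrite -sqrf_eq0; apply/eqP; nra.
Qed.

Lemma qmulVq : {in [pred q | q != 0], left_inverse 1 qinv *%R}.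
Proof.
move=> q /qdot_neq0 h; rewrite qmulE; apply: quatP;
  rewrite ?(mkqE, qcoordZ); move: h; rewrite /qdot => h; field; exact: h.
Qed.
Lemma qmulqV : {in [pred q | q != 0], right_inverse 1 qinv *%R}.
Proof.
move=> q /qdot_neq0 h; rewrite qmulE; apply: quatP;
  rewrite ?(mkqE, qcoordZ); move: h; rewrite /qdot => h; field; exact: h.
Qed.
Lemma qunitP p q : q * p = 1 /\ p * q = 1 -> p != 0.
Proof.
case=> h _; apply/eqP => p0; move: h.
by rewrite p0 mulr0 => /esym/eqP; rewrite oner_eq0.
Qed.
Lemma qinv_out : {in [predC [pred q : quat R | q != 0]], qinv =1 id}.
Proof.
move=> q; rewrite inE /= negbK => /eqP ->; rewrite /qinv.
suff -> : qconj 0 = 0 by rewrite scaler0.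
by apply: quatP; rewrite mkqE /qre /qci /qcj /qck !mxE ?oppr0.
Qed.

HB.instance Definition _ := GRing.NzRing_hasMulInverse.Build (quat R)
  qmulVq qmulqV qunitP qinv_out.

End Quaternions.

Section Regular.
Variable R : realType.
Local Notation H := (quat R).
Implicit Types (p q z I J : H) (Omega D A U : set H) (f phi : H -> H).

Definition imag_units : set H := [set q | q ^+ 2 = -1].
Local Notation SS := imag_units.

(* x + y I *)
Definition cpoint (x y : R) I : H := x *: 1 + y *: I.

(* R + I R *)
Definition cline I : set H := [set z | exists x y, z = cpoint x y I].

(* x + y S *)
Definition qsphere (x y : R) : set H := [set cpoint x y J | J in SS].

Definition slice A I : set H := A `&` cline I.

(** * Regular functions *)

(* Functions on a subset of H are represented by total functions whose values
   outside the subset are irrelevant.  For z in A, the derivatives of f at z in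
   the directions 1 and I are the partial derivatives of (x, y) |-> f (x + I y);
   they only involve the values of f on the line R + I R. *)
Definition holomorphic I A f : Prop :=
  [/\ forall z, A z -> derivable f z 1 /\ derivable f z I,
      {within A, continuous (fun z => 'D_1 f z)},
      {within A, continuous (fun z => 'D_I f z)}
    & forall z, A z -> 2^-1 *: ('D_1 f z + I * 'D_I f z) = 0].

Definition regular Omega f : Prop :=
  forall I, SS I -> holomorphic I (slice Omega I) f.

Definition symmetric_set A : Prop :=
  forall x y I, SS I -> A (cpoint x y I) -> qsphere x y `<=` A.

(* The slices are relatively open because Omega is open. *)
Definition slice_domain Omega : Prop :=
  [/\ open Omega, connected Omega,
      exists x : R, Omega (x *: 1)
    & forall I, SS I -> connected (slice Omega I)].

Definition symmetric_slice_domain Omega : Prop :=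
  symmetric_set Omega /\ slice_domain Omega.

(** * Regular product *)

Definition is_ext Omega I phi (h : H -> H) : Prop :=
  regular Omega h /\ {in slice Omega I, h =1 phi}.

(* F + G J is the splitting of f on the slice of Omega by R + I R. *)
Definition splitting Omega I J f (F G : H -> H) : Prop :=
  [/\ holomorphic I (slice Omega I) F, holomorphic I (slice Omega I) G
    & forall z, slice Omega I z ->
        [/\ cline I (F z), cline I (G z) & f z = F z + G z * J]].

(* h = f * g on Omega *)
Definition is_star_product Omega (f g h : H -> H) : Prop :=
  forall I J, SS I -> SS J -> qdot I J = 0 ->
  exists F G K L : H -> H,
    [/\ splitting Omega I J f F G, splitting Omega I J g K L
      & is_ext Omega I
          (fun z => (F z * K z - G z * qconj (L (qconj z)))
                  + (F z * L z + G z * qconj (K (qconj z))) * J) h].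

(* h = (q - p)^{*n}.  For n < 0 the sphere through p is not in the domain of h;
   prescribing the values of h there on the line through p (with 0 ^ n = 0 at
   z = p) is a harmless convention. *)
Definition is_star_power p (n : int) (h : H -> H) : Prop :=
  regular (if 0 <= n then setT else ~` qsphere (qre p) (qabs (qim p))) h /\
  forall I, SS I -> cline I p -> forall z, cline I z -> h z = (z - p) ^ n.

(** * Singularities *)

Definition same_line q p : Prop := exists2 I, SS I & cline I q /\ cline I p.

Definition sigma q p : R :=
  if `[< same_line q p >] then qabs (q - p)
  else Num.sqrt ((qre q - qre p) ^+ 2 + (qabs (qim q) + qabs (qim p)) ^+ 2).

Definition tau q p : R :=
  if `[< same_line q p >] then qabs (q - p)
  else Num.sqrt ((qre q - qre p) ^+ 2 + (qabs (qim q) - qabs (qim p)) ^+ 2).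

Definition annulus p (r1 r2 : R) : set H :=
  [set q | r1 < tau q p /\ sigma q p < r2].

Definition singularity Omega' p : Prop :=
  exists2 r : R, 0 < r & annulus p 0 r `<=` Omega'.

(* The sum over all n in Z of u n is l, the nonnegative and the negative parts
   being both convergent. *)
Definition is_bilateral_sum (u : int -> H) (l : H) : Prop :=
  exists s t : H,
    [/\ series (fun n : nat => u n%:Z) @ \oo --> s,
        series (fun n : nat => u (- n.+1%:Z)) @ \oo --> t
      & l = s + t].

Definition laurent_expansion f p (r : R) (a : int -> H) : Prop :=
  exists P : int -> H -> H, (forall n, is_star_power p n (P n)) /\
    forall q, annulus p 0 r q -> is_bilateral_sum (fun n => P n q * a n) (f q).

Definition pole Omega' f p : Prop :=
  exists (r : R) (a : int -> H),
    [/\ 0 < r, annulus p 0 r `<=` Omega', laurent_expansion f p r a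
      & exists m : nat, forall k : nat, (m < k)%N -> a (- k%:Z) = 0].

Definition removable Omega' f p : Prop :=
  singularity Omega' p /\
  exists (U : set H) (g : H -> H),
    [/\ open U, U p, regular U g & {in U `&` Omega', g =1 f}].

(** * Semiregular functions *)

(* A semiregular function before extension across its removable singularities:
   distinct elements may have to be identified, see [coincide]. *)
Record semiregular Omega := Semiregular {
  srdom : set H;
  srfun :> H -> H;
  srdom_ssd : symmetric_slice_domain srdom;
  srdom_sub : srdom `<=` Omega;
  srfun_regular : regular srdom srfun;
  srfun_sing : forall p, (Omega `\` srdom) p ->
    pole srdom srfun p \/ removable srdom srfun p }.

Section Operations.
Variable Omega : set H.
Implicit Types u v w : semiregular Omega.

Definition coincide u v : Prop := {in srdom u `&` srdom v, u =1 v}.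

(* w represents u + v, which is regular on [srdom u `&` srdom v]. *)
Definition is_semiregular_sum u v w : Prop :=
  {in (srdom u `&` srdom v) `&` srdom w, forall q, w q = u q + v q}.

(* w represents u * v, which is regular on [srdom u `&` srdom v]. *)
Definition is_semiregular_product u v w : Prop :=
  exists2 k : H -> H, is_star_product (srdom u `&` srdom v) u v k
    & {in (srdom u `&` srdom v) `&` srdom w, w =1 k}.

End Operations.
End Regular.

(* Main.v *)
(* On a line R + I R write a quaternion as a = P a + Q a, where P a commutes and
   Q a anticommutes with I.  The splitting formula of the star product becomes
   (f * g)(z) = P (f z) g(z) + Q (f z) g(conj z), which makes associativity and
   distributivity pointwise identities of a Z/2-grading.

   A point is a pole or a removable singularity if and only if f grows at most
   like a power of 1/|z - p| on the lines through p: multiplying by (z - p)^m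
   gives a bounded holomorphic function on a punctured disc, which has a power
   series by Cauchy's formula.  This growth condition is stable under sums, star
   products and the conjugate f^c.  If f is not 0, the symmetrization
   f^s = f * f^c maps each R + I R to itself, so its zeros are isolated on each
   line and, being invariant under conjugation, fill whole spheres x + y S; off
   them (f^s)^-1 f^c is the inverse of f, and |f^s| is bounded below by a power of
   |z - p|, so only poles are created.  Removing such spheres and real points does
   not disconnect the slices, so the domains involved remain symmetric slice
   domains. *)

Require Import Defs.
From HB Require Import structures.
From mathcomp Require Import all_boot all_order all_algebra.
From mathcomp Require Import all_classical all_reals all_analysis.
From mathcomp Require Import ring lra.
Import Order.TTheory GRing.Theory Num.Theory.
Import numFieldNormedType.Exports.
Set Implicit Arguments.
Unset Strict Implicit.
Unset Printing Implicit Defensive.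
Local Open Scope classical_set_scope.
Local Open Scope ring_scope.
(* The analysis library shadows [cpoint]. *)
Import Defs.

(** * Quaternions and the complex lines R + I R *)

(** Everything rests on writing f w - f z = (w - z) phi w with the increment on the left. Right
    multiplication by constants and left multiplication by functions into the line preserve this
    form. A factor anticommuting with I turns w - z into its conjugate; this is why Q f has to meet
    g (conj z), and why the star product is again holomorphic. Cauchy's formula is obtained from
    circles about p alone. The integral of the difference quotient of f at z over the circle of
    radius r has zero derivative in r except at r = |z - p|, where it is still continuous, and it
    tends to 0 with r because f is bounded. So it vanishes, and no value of f at p enters: the power
    series and the removability of a bounded singularity come out together. Semiregular functions
    have different domains, so equality means agreement on the common domain. That this is
    transitive, and that the new domains are symmetric slice domains, rests on one fact: the missing
    points are isolated on every line, although they may fill spheres in H. *)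

Section QuatAlgebra.
Variable R : realType.
Local Notation H := (quat R).
Local Notation SS := (@imag_units R).
Implicit Types (p q z w a b I J : H).

Lemma quatE q : q = mkq (qre q) (qci q) (qcj q) (qck q).
Proof. by apply: quatP; rewrite mkqE. Qed.

Lemma qre0 : qre (0 : H) = 0. Proof. by rewrite /qre mxE. Qed.
Lemma qcj0 : qcj (0 : H) = 0. Proof. by rewrite /qcj mxE. Qed.
Lemma qreN q : qre (- q) = - qre q. Proof. by rewrite /qre mxE. Qed.
Lemma qciN q : qci (- q) = - qci q. Proof. by rewrite /qci mxE. Qed.
Lemma qcjN q : qcj (- q) = - qcj q. Proof. by rewrite /qcj mxE. Qed.
Lemma qckN q : qck (- q) = - qck q. Proof. by rewrite /qck mxE. Qed.
Lemma qoneE : 1 = mkq 1 0 0 0 :> H. Proof. by []. Qed.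

Lemma mkqD (x y z t x' y' z' t' : R) :
  mkq x y z t + mkq x' y' z' t' = mkq (x + x') (y + y') (z + z') (t + t').
Proof. by apply: quatP; rewrite ?(mkqE, qcoordD). Qed.
Lemma mkqN (x y z t : R) : - mkq x y z t = mkq (- x) (- y) (- z) (- t).
Proof. by apply: quatP; rewrite ?(qreN, qciN, qcjN, qckN, mkqE). Qed.
Lemma mkqZ (c x y z t : R) :
  c *: mkq x y z t = mkq (c * x) (c * y) (c * z) (c * t).
Proof. by apply: quatP; rewrite ?(mkqE, qcoordZ). Qed.
Lemma mkqM (x y z t x' y' z' t' : R) :
  mkq x y z t * mkq x' y' z' t' =
  mkq (x * x' - y * y' - z * z' - t * t') (x * y' + y * x' + z * t' - t * z')
    (x * z' - y * t' + z * x' + t * y') (x * t' + y * z' - z * y' + t * x').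
Proof. by rewrite qmulE /qmul !mkqE. Qed.
Lemma mkq_conj (x y z t : R) : qconj (mkq x y z t) = mkq x (- y) (- z) (- t).
Proof. by rewrite /qconj !mkqE. Qed.
Definition mkqR := (mkqD, mkqN, mkqZ, mkqM, mkq_conj).

Lemma qconjD p q : qconj (p + q) = qconj p + qconj q.
Proof. by rewrite (quatE p) (quatE q) !mkqR; congr mkq; ring. Qed.
Lemma qconjN p : qconj (- p) = - qconj p.
Proof. by rewrite (quatE p) !mkqR; congr mkq; ring. Qed.
Lemma qconjB p q : qconj (p - q) = qconj p - qconj q.
Proof. by rewrite qconjD qconjN. Qed.
Lemma qconjM p q : qconj (p * q) = qconj q * qconj p.
Proof. by rewrite (quatE p) (quatE q) !mkqR; congr mkq; ring. Qed.
Lemma qconjK : involutive (@qconj R).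
Proof. by move=> p; rewrite (quatE p) !mkqR; congr mkq; ring. Qed.
Lemma qconjZ (c : R) q : qconj (c *: q) = c *: qconj q.
Proof. by rewrite (quatE q) !mkqR; congr mkq; ring. Qed.
Lemma qconj1 : qconj 1 = 1 :> H.
Proof. by rewrite qoneE !mkqR oppr0. Qed.
Lemma qconj0 : qconj 0 = 0 :> H.
Proof. by rewrite -[0](subrr (0 : H)) qconjB !subrr. Qed.
Lemma qconjE q : qconj q = (qre q *+ 2) *: 1 - q.
Proof. by rewrite {1 3}(quatE q) qoneE !mkqR; congr mkq; ring. Qed.

Lemma qunitE q : (q \is a GRing.unit) = (q != 0). Proof. by []. Qed.
Lemma mulqV q : q != 0 -> q * q^-1 = 1.
Proof. by move=> q0; rewrite divrr ?qunitE. Qed.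
Lemma mulVq q : q != 0 -> q^-1 * q = 1.
Proof. by move=> q0; rewrite mulVr ?qunitE. Qed.
Lemma mulqI q : q != 0 -> injective ( *%R q).
Proof. by move=> q0 a b h; rewrite -(mul1r a) -(mulVq q0) -mulrA h mulrA mulVq ?mul1r. Qed.

Lemma qdotE p q : qre (p * qconj q) = qdot p q.
Proof. by rewrite (quatE p) (quatE q) !mkqR /qdot !mkqE; ring. Qed.
Lemma qdot_ge0 q : 0 <= qdot q q.
Proof. by rewrite /qdot -!expr2 !addr_ge0 ?sqr_ge0. Qed.
Lemma qmul_conj q : q * qconj q = qdot q q *: 1.
Proof.
by rewrite (quatE q) qoneE !mkqR /qdot !mkqE; congr mkq; ring.
Qed.
Lemma qdotM p q : qdot (p * q) (p * q) = qdot p p * qdot q q.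
Proof. by rewrite (quatE p) (quatE q) !mkqR /qdot !mkqE; ring. Qed.

Lemma qabs_ge0 q : 0 <= qabs q. Proof. exact: sqrtr_ge0. Qed.
Lemma qabs_sqr q : qabs q ^+ 2 = qdot q q.
Proof. by rewrite sqr_sqrtr ?qdot_ge0. Qed.
Lemma qabsM p q : qabs (p * q) = qabs p * qabs q.
Proof. by rewrite /qabs qdotM sqrtrM ?qdot_ge0. Qed.
Lemma qabsN q : qabs (- q) = qabs q.
Proof. by rewrite /qabs (quatE q) !mkqR /qdot !mkqE; congr Num.sqrt; ring. Qed.
Lemma qabs_conj q : qabs (qconj q) = qabs q.
Proof. by rewrite /qabs (quatE q) !mkqR /qdot !mkqE; congr Num.sqrt; ring. Qed.
Lemma qabsZ (c : R) q : qabs (c *: q) = `|c| * qabs q.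
Proof.
rewrite /qabs -sqrtr_sqr -sqrtrM ?sqr_ge0// (quatE q) !mkqR /qdot !mkqE.
by congr Num.sqrt; ring.
Qed.
Lemma qabs1 : qabs 1 = 1 :> R.
Proof.
rewrite /qabs qoneE /qdot !mkqE -[RHS]sqrtr1; congr Num.sqrt; ring.
Qed.
Lemma qabs0 : qabs (0 : H) = 0.
Proof. by rewrite -(scale0r (0 : H)) qabsZ normr0 mul0r. Qed.
Lemma qabs_eq0 q : (qabs q == 0) = (q == 0).
Proof.
apply/eqP/eqP => [h|->]; last exact: qabs0.
apply: contraTeq isT => /qdot_neq0; rewrite -qabs_sqr h expr0n /=.
by rewrite eqxx.
Qed.
Lemma qabs_gt0 q : (0 < qabs q) = (q != 0).
Proof. by rewrite lt_def qabs_eq0 qabs_ge0 andbT. Qed.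
Lemma qabsBC p q : qabs (p - q) = qabs (q - p).
Proof. by rewrite -qabsN opprB. Qed.
Lemma qabsX q n : qabs (q ^+ n) = qabs q ^+ n.
Proof. by elim: n => [|n IH]; rewrite ?expr0 ?qabs1// !exprS qabsM IH. Qed.
Lemma qabsV q : qabs q^-1 = (qabs q)^-1.
Proof.
have [->|q0] := eqVneq q 0; first by rewrite invr0 qabs0 invr0.
apply: (mulfI (x := qabs q)); first by rewrite qabs_eq0.
by rewrite -qabsM mulqV// qabs1 mulfV// qabs_eq0.
Qed.

Lemma qabs_re q : `|qre q| <= qabs q.
Proof.
rewrite -sqrtr_sqr ler_sqrt ?qdot_ge0//.
by rewrite /qdot -!expr2 -!addrA lerDl !addr_ge0 ?sqr_ge0.
Qed.

Lemma qdotC p q : qdot p q = qdot q p.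
Proof. by rewrite /qdot; ring. Qed.

(** Cauchy-Schwarz, read off from the multiplicativity of the modulus. *)
Lemma qdot_le p q : `|qdot p q| <= qabs p * qabs q.
Proof. by rewrite -qdotE (le_trans (qabs_re _))// qabsM qabs_conj. Qed.

Lemma qabsD p q : qabs (p + q) <= qabs p + qabs q.
Proof.
rewrite -(ler_pXn2r (ltn0Sn 1)) ?nnegrE ?addr_ge0 ?qabs_ge0//.
rewrite sqrrD !qabs_sqr.
have -> : qdot (p + q) (p + q) = qdot p p + qdot p q *+ 2 + qdot q q.
  by rewrite /qdot !qcoordD; ring.
by rewrite lerD2r lerD2l lerMn2r (le_trans (ler_norm _) (qdot_le _ _)).
Qed.
Lemma qabsB p q : qabs (p - q) <= qabs p + qabs q.
Proof. by rewrite -(qabsN q) qabsD. Qed.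
Lemma qabs_sub p q : qabs p - qabs q <= qabs (p - q).
Proof. by rewrite lerBlDr -{1}(subrK q p) qabsD. Qed.
Lemma qabs_tri p q r : qabs (p - r) <= qabs (p - q) + qabs (q - r).
Proof. by rewrite (le_trans _ (qabsD _ _))// addrA subrK. Qed.

Lemma qabs_sum (n : nat) (F : nat -> H) :
  qabs (\sum_(i < n) F i) <= \sum_(i < n) qabs (F i).
Proof.
elim: n => [|n IH]; first by rewrite !big_ord0 qabs0.
by rewrite !big_ord_recr/= (le_trans (qabsD _ _))// lerD2r.
Qed.

Lemma qcoord_ind (P : R -> Prop) q :
  P (qre q) -> P (qci q) -> P (qcj q) -> P (qck q) -> forall k, P (q 0 k).
Proof.
move=> h0 h1 h2 h3 [[|[|[|[|//]]]] hk].
- by rewrite (bool_irrelevance hk isT).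
- by rewrite (bool_irrelevance hk isT).
- by rewrite (bool_irrelevance hk isT).
- by rewrite (bool_irrelevance hk isT).
Qed.

Lemma qhalf q : 2^-1 *: (q + q) = q.
Proof. by rewrite -[in X in _ *: X](scale1r q) -scalerDl scalerA mulVf ?scale1r// -mulr2n pnatr_eq0. Qed.

Lemma qabs_coord q (k : 'I_4) : `|q 0 k| <= qabs q.
Proof.
move: k; apply: (qcoord_ind (P := fun x => `|x| <= qabs q)); rewrite -sqrtr_sqr ler_sqrt ?qdot_ge0// /qdot;
  nra.
Qed.

Lemma nbhs_qabsP z (A : set H) :
  nbhs z A <-> exists2 e : R, 0 < e & forall w, qabs (w - z) < e -> A w.
Proof.
split=> [/nbhs_ballP[e /= e0 zA]|[e e0 zA]].
  exists e => // w wz; apply: zA; split=> // i j; rewrite ord1.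
  have := qabs_coord (w - z) j; rewrite !mxE distrC => h.
  exact: le_lt_trans wz.
(* Four coordinates below [e / 2] give a modulus below [e]. *)
apply/nbhs_ballP; exists (e / 2) => /=; first exact: divr_gt0.
move=> w [_ zw]; apply: zA.
rewrite -(gtr0_norm e0) -sqrtr_sqr ltr_sqrt ?exprn_gt0//.
have h k : `|(w - z) 0 k| < e / 2 by rewrite !mxE distrC; exact: zw.
move: h; rewrite /qdot /qre /qci /qcj /qck => h.
have {}h k : (w - z) 0 k ^+ 2 < (e / 2) ^+ 2.
  by rewrite -real_normK ?num_real// ltrXn2r//; exact: h.
set a := (_ 0 _); set b := (_ 0 _); set c := (_ 0 _); set d := (_ 0 _).
have ha : a ^+ 2 < (e / 2) ^+ 2 by exact: h.
have hb : b ^+ 2 < (e / 2) ^+ 2 by exact: h.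
have hc : c ^+ 2 < (e / 2) ^+ 2 by exact: h.
have hd : d ^+ 2 < (e / 2) ^+ 2 by exact: h.
nra.
Qed.

Lemma cvg_qabsP (T : Type) (F : set_system T) (FF : Filter F) (f : T -> H) z :
  f @ F --> z <-> forall e : R, 0 < e -> \forall x \near F, qabs (f x - z) < e.
Proof.
split=> [fz e e0|h A /nbhs_qabsP[e e0 zA]].
  have : nbhs z [set w | qabs (w - z) < e] by apply/nbhs_qabsP; exists e.
  exact: fz.
by move: (h e e0); apply: filterS => x /zA.
Qed.

Lemma imag_unitsP I : SS I <-> qre I = 0 /\ qdot I I = 1.
Proof.
rewrite /imag_units /= expr2 (quatE I) !mkqR /qdot !mkqE oppr0.
set a := qre I; set b := qci I; set c := qcj I; set d := qck I.
split=> [h|[-> h]]; last first.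
  by congr mkq; rewrite ?mulr0 ?mul0r; nra.
have := congr1 (@qre R) h; have := congr1 (@qci R) h.
have := congr1 (@qcj R) h; have := congr1 (@qck R) h.
rewrite !mkqE => h3 h2 h1 h0 {h}.
(* The vector part of the square is twice [a] times (b, c, d), so a nonzero [a] would make [I] real,
   with a nonnegative square. *)
have [a0|a0] := eqVneq a 0; first by split=> //; rewrite a0 in h0 *; nra.
have [b0 c0 d0] : [/\ b = 0, c = 0 & d = 0].
  by split; apply: (mulfI a0); rewrite mulr0; nra.
move: h0; rewrite b0 c0 d0 => h0.
have : 0 <= a * a by rewrite -expr2 sqr_ge0.
by nra.
Qed.

Section FixI.
Variable I : H.
Hypothesis SI : SS I.

Lemma SSsqr : I * I = -1. Proof. by move: SI; rewrite /imag_units/= expr2. Qed.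
Lemma SSre : qre I = 0. Proof. by case/imag_unitsP: SI. Qed.
Lemma SSdot : qdot I I = 1. Proof. by case/imag_unitsP: SI. Qed.
Lemma SSabs : qabs I = 1. Proof. by rewrite /qabs SSdot sqrtr1. Qed.
Lemma SSconj : qconj I = - I.
Proof. by rewrite qconjE SSre mul0rn scale0r sub0r. Qed.
Lemma SS_neq0 : I != 0. Proof. by rewrite -qabs_gt0 SSabs. Qed.
Lemma SSN : SS (- I). Proof. by rewrite /imag_units/= sqrrN. Qed.
Lemma SSK a : I * (I * a) = - a. Proof. by rewrite mulrA SSsqr mulN1r. Qed.
Lemma SSKr a : a * I * I = - a. Proof. by rewrite -mulrA SSsqr mulrN1. Qed.

Lemma qre_cpoint x y : qre (cpoint x y I) = x.
Proof. by rewrite /cpoint qreD !qreZ SSre qoneE mkqE; ring. Qed.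
Lemma qim_cpoint x y : qim (cpoint x y I) = y *: I.
Proof.
rewrite /qim /cpoint !qcoordD !qcoordZ qoneE !mkqE [in RHS](quatE I) mkqR SSre.
by congr mkq; ring.
Qed.
Lemma qdot_cpoint x y : qdot (cpoint x y I) I = y.
Proof.
have := SSdot; rewrite /qdot !qcoordD !qcoordZ qoneE !mkqE SSre => h.
by transitivity (y * (0 * 0 + qci I * qci I + qcj I * qcj I + qck I * qck I)); [ring|rewrite h mulr1].
Qed.
Lemma cpoint_conj x y : qconj (cpoint x y I) = cpoint x (- y) I.
Proof. by rewrite /cpoint qconjD !qconjZ SSconj qconj1 scalerN scaleNr. Qed.
Lemma qabs_cpoint x y : qabs (cpoint x y I) = Num.sqrt (x ^+ 2 + y ^+ 2).
Proof.
rewrite /qabs; congr Num.sqrt.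
have : qre (cpoint x y I * qconj (cpoint x y I)) = x ^+ 2 + y ^+ 2.
  rewrite cpoint_conj /cpoint scaleNr mulrBr !mulrDl -!scalerAl -!scalerAr !mul1r.
  rewrite mulr1 SSsqr !qreD !qreN !qreD !qreZ SSre qreN qoneE mkqE; ring.
by rewrite qdotE.
Qed.

Lemma cline_cpoint x y : cline I (cpoint x y I). Proof. by exists x, y. Qed.

(* [1] and [I] are orthonormal, so the projection of [q] on [R + I R] is [(q - I q I) / 2]. *)
Definition qproj (J q : H) : H := 2^-1 *: (q - J * q * J).
Definition qproj' (J q : H) : H := 2^-1 *: (q + J * q * J).

Lemma qproj_cpoint q : qproj I q = cpoint (qre q) (qdot q I) I.
Proof.
have := SSdot; have := SSre; rewrite /qproj /cpoint.
rewrite (quatE I) (quatE q) qoneE !mkqR /qdot !mkqE.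
set b := qci I; set c := qcj I; set d := qck I => -> h.
have e0 : (b * b + c * c + d * d) = 1 by rewrite -h; ring.
congr mkq; last 3 first.
(* The two sides agree only modulo |I|^2 = 1: their difference is a multiple of 1 - |I|^2. The next
   two coordinates are treated alike. *)
- apply/subr0_eq; transitivity (2^-1 * qci q * (1 - (b * b + c * c + d * d)));
    by [field|rewrite e0; ring].
- apply/subr0_eq; transitivity (2^-1 * qcj q * (1 - (b * b + c * c + d * d)));
    by [field|rewrite e0; ring].
- apply/subr0_eq; transitivity (2^-1 * qck q * (1 - (b * b + c * c + d * d)));
    by [field|rewrite e0; ring].
transitivity (2^-1 * (qre q + qre q * (b * b + c * c + d * d))).
  by field.
by rewrite e0; field.
Qed.

Lemma qproj_cline q : cline I (qproj I q).
Proof. by rewrite qproj_cpoint; exact: cline_cpoint. Qed.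

(** Turns membership in the line into a commutation equation, from which the closure properties
    below follow; the converse holds because an element commuting with [I] equals its own
    projection. *)
Lemma clineP q : cline I q <-> I * q = q * I.
Proof.
split=> [[x [y ->]]|h].
  by rewrite /cpoint mulrDl mulrDr -!scalerAl -!scalerAr mulr1 mul1r.
have -> : q = qproj I q; last exact: qproj_cline.
by rewrite /qproj h SSKr opprK qhalf.
Qed.

Lemma cline_proj q : cline I q -> qproj I q = q.
Proof.
move=> /clineP h.
by rewrite /qproj h SSKr opprK qhalf.
Qed.
Lemma cline_proj' q : cline I q -> qproj' I q = 0.
Proof. by move=> /clineP h; rewrite /qproj' h SSKr subrr scaler0. Qed.

Lemma qproj_decomp q : q = qproj I q + qproj' I q.
Proof.
by rewrite /qproj /qproj' -scalerDr addrACA addNr addr0 qhalf.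
Qed.
Lemma qproj'_anti q : I * qproj' I q = - (qproj' I q * I).
Proof.
rewrite /qproj' -scalerAr -scalerAl -scalerN; congr (_ *: _).
by rewrite mulrDr mulrDl -!mulrA SSK !mulrA SSKr opprD opprK addrC.
Qed.

Lemma cline1 : cline I 1. Proof. by apply/clineP; rewrite mulr1 mul1r. Qed.
Lemma clineI : cline I I. Proof. by apply/clineP. Qed.
Lemma clineZ (c : R) q : cline I q -> cline I (c *: q).
Proof. by move=> /clineP h; apply/clineP; rewrite -scalerAr -scalerAl h. Qed.
Lemma cline_real (c : R) : cline I (c *: 1).
Proof. exact/clineZ/cline1. Qed.
Lemma clineD p q : cline I p -> cline I q -> cline I (p + q).
Proof. by move=> /clineP h /clineP k; apply/clineP; rewrite mulrDr mulrDl h k. Qed.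
Lemma clineN p : cline I p -> cline I (- p).
Proof. by move=> /clineP h; apply/clineP; rewrite mulrN mulNr h. Qed.
Lemma clineB p q : cline I p -> cline I q -> cline I (p - q).
Proof. by move=> h /clineN; exact: clineD. Qed.
Lemma clineM p q : cline I p -> cline I q -> cline I (p * q).
Proof. by move=> /clineP h /clineP k; apply/clineP; rewrite mulrA h -mulrA k mulrA. Qed.
Lemma clineX p n : cline I p -> cline I (p ^+ n).
Proof.
by move=> h; elim: n => [|n IH]; [exact: cline1|rewrite exprS; exact: clineM].
Qed.
Lemma clineV p : cline I p -> cline I p^-1.
Proof.
move=> /clineP h; apply/clineP.
have [->|p0] := eqVneq p 0; first by rewrite invr0 mulr0 mul0r.
apply: (mulqI p0).
by rewrite [in RHS]mulrA mulqV// mul1r mulrA -h -mulrA mulqV// mulr1.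
Qed.
Lemma cline_conj p : cline I p -> cline I (qconj p).
Proof. by move=> h; rewrite qconjE; apply: clineB => //; exact: cline_real. Qed.
Lemma cline_comm p q : cline I p -> cline I q -> p * q = q * p.
Proof.
move=> [x [y ->]] /clineP h.
by rewrite /cpoint mulrDl mulrDr -!scalerAl -!scalerAr mulr1 mul1r h.
Qed.
(** This twisted commutation is the source of the conjugate variable in the star product. *)
Lemma cline_anti p q : cline I p -> I * q = - (q * I) -> q * p = qconj p * q.
Proof.
move=> [x [y ->]] h; rewrite cpoint_conj /cpoint mulrDl mulrDr.
by rewrite -!scalerAl -!scalerAr mulr1 mul1r h scaleNr scalerN opprK.
Qed.
Lemma clineN_unit q : cline (- I) q <-> cline I q.
Proof.
split=> [[x [y ->]]|[x [y ->]]]; last by exists x, (- y); rewrite /cpoint scalerN scaleNr opprK.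
by exists x, (- y); rewrite /cpoint scalerN scaleNr.
Qed.
End FixI.

(** With 0 <= y, the number y is the modulus of the imaginary part; [ssd_codiscrete] uses this to
    compare points of different lines. *)
Lemma cline_ex q : exists2 I, SS I & exists x y, 0 <= y /\ q = cpoint x y I.
Proof.
pose v := qim q; have qv : q = qre q *: 1 + v.
  by rewrite /v /qim {1}(quatE q) qoneE !mkqR; congr mkq; ring.
have v0 : qre v = 0 by rewrite /v /qim mkqE.
have [vz|vn] := eqVneq v 0.
  exists (mkq 0 1 0 0); last first.
    by exists (qre q), 0; split=> //; rewrite /cpoint scale0r addr0 {1}qv vz addr0.
  by apply/imag_unitsP; rewrite /qdot !mkqE; split=> //; ring.
exists ((qabs v)^-1 *: v).
  apply/imag_unitsP; rewrite qreZ v0 mulr0; split=> //.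
  rewrite -qabs_sqr qabsZ ger0_norm ?invr_ge0 ?qabs_ge0// mulVf ?expr1n//.
  by rewrite qabs_eq0.
exists (qre q), (qabs v); split; first exact: qabs_ge0.
by rewrite /cpoint scalerA mulfV ?qabs_eq0// scale1r.
Qed.

Lemma cpoint_inj I J (x y x' y' : R) : SS I -> SS J -> cpoint x y I = cpoint x' y' J ->
  x = x' /\ y *: I = y' *: J.
Proof.
move=> SI SJ h; split; first by rewrite -(qre_cpoint SI x y) h qre_cpoint.
by rewrite -(qim_cpoint SI x y) h qim_cpoint.
Qed.

Lemma cline_unique I J x y : SS I -> SS J -> y != 0 ->
  cline J (cpoint x y I) -> J = I \/ J = - I.
Proof.
move=> SI SJ y0 [x' [y' /(cpoint_inj SI SJ)[_ h]]].
have hI : I = (y' / y) *: J by rewrite mulrC -scalerA -h scalerA mulVf ?scale1r.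
have : (y' / y) ^+ 2 = 1.
  have := SSdot SI; rewrite hI -qabs_sqr qabsZ SSabs// mulr1.
  by rewrite real_normK ?num_real.
move/eqP; rewrite sqrf_eq1 => /orP[]/eqP c; rewrite c in hI.
  by left; rewrite hI scale1r.
by right; rewrite hI scaleN1r opprK.
Qed.

End QuatAlgebra.

(** * Limits and derivatives of quaternionic functions *)

Section QuatLimits.
Variable R : realType.
Local Notation H := (quat R).
Implicit Types (p q z w a b I J : H).

Section Filter.
Variables (T : Type) (F : set_system T).
Context {FF : Filter F}.
Implicit Types f g : T -> H.

Lemma cvg_qabs0P f z : f @ F --> z <-> qabs (f x - z) @[x --> F] --> (0 : R).
Proof.
rewrite cvg_qabsP; split=> [h|/cvgrPdist_lt h e e0].
  apply/cvgrPdist_lt => e e0; move: (h e e0); apply: filterS => x.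
  by rewrite sub0r normrN ger0_norm ?qabs_ge0.
by move: (h e e0); apply: filterS => x; rewrite sub0r normrN ger0_norm ?qabs_ge0.
Qed.

Lemma qabs_dist p q : `|qabs p - qabs q| <= qabs (p - q).
Proof.
by rewrite ler_norml qabs_sub andbT lerNl opprB qabsBC qabs_sub.
Qed.

Lemma cvg_qabs f z : f @ F --> z -> qabs (f x) @[x --> F] --> qabs z.
Proof.
move=> /cvg_qabsP h; apply/cvgrPdist_lt => e e0; move: (h e e0).
by apply: filterS => x; apply: le_lt_trans; rewrite distrC qabs_dist.
Qed.

Lemma cvg_qabs_squeeze f z (B : T -> R) : (\forall x \near F, qabs (f x - z) <= B x) ->
  B @ F --> (0 : R) -> f @ F --> z.
Proof.
move=> h /cvgrPdist_lt hB; apply/cvg_qabsP => e e0; near=> x.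
have h1 : qabs (f x - z) <= B x by near: x.
have : `|0 - B x| < e by near: x; exact: hB.
by rewrite sub0r normrN => /(le_lt_trans (ler_norm _)); exact: le_lt_trans.
Unshelve. all: by end_near. Qed.

(** The proof goes through the modulus, which is multiplicative, whereas the sup norm of [quat] is
    not. *)
Lemma cvgqM f g a b : f @ F --> a -> g @ F --> b -> f x * g x @[x --> F] --> a * b.
Proof.
move=> /cvg_qabs0P ha /cvg_qabs0P hb.
apply: (@cvg_qabs_squeeze _ _ (fun x => qabs (f x - a) * qabs (g x - b)
   + qabs a * qabs (g x - b) + qabs (f x - a) * qabs b)).
  near=> x; rewrite -!qabsM.
  have -> : f x * g x - a * b = (f x - a) * (g x - b) + a * (g x - b) + (f x - a) * b.
    rewrite -mulrDl subrK mulrBr mulrBl addrA subrK//.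
  by rewrite (le_trans (qabsD _ _))// lerD2r qabsD.
rewrite -[0](_ : 0 * 0 + qabs a * 0 + 0 * qabs b = 0); last by rewrite !(mulr0, mul0r, addr0).
apply: cvgD; first (apply: cvgD; first exact: cvgM).
  by apply: cvgM => //; exact: cvg_cst.
by apply: cvgM => //; exact: cvg_cst.
Unshelve. all: by end_near. Qed.

Lemma cvgqV f a : a != 0 -> f @ F --> a -> (f x)^-1 @[x --> F] --> a^-1.
Proof.
move=> a0 fa; have /cvg_qabs0P ha := fa; have na := cvg_qabs fa.
have qa0 : qabs a != 0 by rewrite qabs_eq0.
apply: (@cvg_qabs_squeeze _ _ (fun x => (qabs (f x))^-1 * qabs (f x - a) * (qabs a)^-1)).
  have /cvg_qabsP/(_ _ (_ : 0 < qabs a)) := fa.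
  rewrite qabs_gt0 => /(_ a0); apply: filterS => x xa.
  have fx0 : f x != 0.
    by apply: contraTneq xa => ->; rewrite sub0r qabsN ltxx.
  rewrite -!qabsV -!qabsM -qabsN opprB mulrBr mulVq// mulrBl mul1r -mulrA mulqV//.
  by rewrite mulr1.
rewrite -[X in _ --> X](_ : (qabs a)^-1 * 0 * (qabs a)^-1 = 0); last by rewrite mulr0 mul0r.
apply: cvgM; last exact: cvg_cst.
by apply: cvgM => //; exact: cvgV.
Qed.

Lemma cvgqconj f a : f @ F --> a -> qconj (f x) @[x --> F] --> qconj a.
Proof.
move=> /cvg_qabs0P ha; apply/cvg_qabs0P.
by under eq_fun do rewrite -qconjB qabs_conj.
Qed.

Lemma cvg_coord f a (k : 'I_4) : f @ F --> a -> f x 0 k @[x --> F] --> a 0 k.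
Proof.
move=> /cvg_qabsP h; apply/cvgrPdist_lt => e e0; move: (h e e0).
apply: filterS => x; apply: le_lt_trans; rewrite distrC.
by have := qabs_coord (f x - a) k; rewrite !mxE.
Qed.

Lemma cvgqB f g a b : f @ F --> a -> g @ F --> b -> f x - g x @[x --> F] --> a - b.
Proof. by move=> fa gb; apply: cvgB. Qed.

Lemma cvgqZ (c : R) f a : f @ F --> a -> c *: f x @[x --> F] --> c *: a.
Proof.
move=> fa; have -> : (fun x => c *: f x) = (fun x => (c *: 1) * f x).
  by apply/funext => x; rewrite -scalerAl mul1r.
have -> : c *: a = (c *: 1) * a by rewrite -scalerAl mul1r.
by apply: cvgqM => //; exact: cvg_cst.
Qed.

Lemma cvgqproj I f a : f @ F --> a -> qproj I (f x) @[x --> F] --> qproj I a.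
Proof.
move=> fa; apply/cvgqZ/cvgqB => //; apply: cvgqM; last exact: cvg_cst.
by apply: cvgqM => //; exact: cvg_cst.
Qed.

Lemma cvgqproj' I f a : f @ F --> a -> qproj' I (f x) @[x --> F] --> qproj' I a.
Proof.
move=> fa; apply: cvgqZ; apply: cvgD => //; apply: cvgqM; last exact: cvg_cst.
by apply: cvgqM => //; exact: cvg_cst.
Qed.

Lemma qabs_le_lim f a (C : R) : ProperFilter F ->
  f @ F --> a -> (\forall x \near F, qabs (f x) <= C) -> qabs a <= C.
Proof.
move=> PF /cvg_qabs fa h; rewrite -(cvg_lim _ fa)//.
by apply: limr_le; [exact: cvgP fa|exact: h].
Qed.

End Filter.
End QuatLimits.

Section RealCurves.
Variable R : realType.
Local Notation H := (quat R).

Lemma is_derive_cvg (V W : normedModType R) (f : V -> W) (a v : V) (d : W) :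
  h^-1 *: (f (h *: v + a) - f a) @[h --> 0^'] --> d -> is_derive a v f d.
Proof.
move=> h; apply: DeriveDef; first by apply/cvg_ex; exists d.
by rewrite /derive; apply: cvg_lim.
Qed.

Lemma is_derive_lim (V W : normedModType R) (f : V -> W) (a v : V) (d : W) :
  is_derive a v f d -> h^-1 *: (f (h *: v + a) - f a) @[h --> 0^'] --> d.
Proof. by case=> /cvg_ex[l hl] <-; rewrite /derive (cvg_lim _ hl). Qed.

(** The mean value theorem is about real functions, hence the passage to coordinates. *)
Lemma coord_derive (f : H -> H) (z v : H) (t : R) (k : 'I_4) :
  derivable f (z + t *: v) v ->
  is_derive t (1 : R) (fun s => f (z + s *: v) 0 k) (('D_v f (z + t *: v)) 0 k).
Proof.
move=> /derivableP/is_derive_lim h; apply: is_derive_cvg.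
have -> : (fun h : R => h^-1 *: (f (z + (h *: 1 + t) *: v) 0 k - f (z + t *: v) 0 k))
   = (fun h : R => (h^-1 *: (f (h *: v + (z + t *: v)) - f (z + t *: v))) 0 k).
  apply/funext => s; rewrite !mxE.
  by rewrite -[s *: 1]/(s * 1) mulr1 scalerDl addrCA.
exact: cvg_coord.
Qed.

(** Stated for [t] of either sign, since the sides of the rectangle joining two points may run in
    either direction. *)
Lemma mvt0 (u du : R -> R) (t : R) :
  (forall s, `|s| <= `|t| -> is_derive s (1 : R) u (du s)) ->
  exists2 s, `|s| <= `|t| & u t - u 0 = du s * t.
Proof.
move=> hd; have cu s : `|s| <= `|t| -> {for s, continuous u}.
  by move=> /hd [d _]; apply/differentiable_continuous/derivable1_diffP.
have [t0|t0] := leP 0 t.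
  have h s : s \in `[0, t] -> `|s| <= `|t|.
    by rewrite in_itv/= => /andP[s0 st]; rewrite !ger0_norm.
  have [||s sI e] := @MVT_segment R u du 0 t t0.
  - by move=> s sI; apply/hd/h; exact: subset_itv_oo_cc.
  - by apply: continuous_in_subspaceT => s; rewrite inE => sI; exact/cu/h.
  by exists s; [exact: h|rewrite e subr0].
have h s : s \in `[t, 0] -> `|s| <= `|t|.
  by rewrite in_itv/= => /andP[s0 st]; rewrite !ler0_norm ?lerN2// ltW.
have [||s sI e] := @MVT_segment R u du t 0 (ltW t0).
- by move=> s sI; apply/hd/h; exact: subset_itv_oo_cc.
- by apply: continuous_in_subspaceT => s; rewrite inE => sI; exact/cu/h.
by exists s; [exact: h|rewrite -opprB e sub0r mulrN opprK].
Qed.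
End RealCurves.

(** * Holomorphy along a complex line *)

Section ComplexDerivative.
Variable R : realType.
Local Notation H := (quat R).
Local Notation SS := (@imag_units R).
Implicit Types (p q z w a b I J d : H) (f g F G : H -> H) (W V : set H).

(* The filter of neighborhoods of [z] in the line R + I R. *)
Definition sln I z : set_system H := within (cline I) (nbhs z).

Global Instance sln_filter I z : Filter (sln I z).
Proof. exact: within_filter. Qed.

Lemma sln_nearP I z (P : set H) : sln I z P <->
  exists2 e : R, 0 < e & forall w, cline I w -> qabs (w - z) < e -> P w.
Proof.
rewrite /sln /within /= -/(nbhs z _); split.
  by move=> /nbhs_qabsP[e e0 h]; exists e => // w Iw wz; exact: h.
by move=> [e e0 h]; apply/nbhs_qabsP; exists e => // w wz Iw; exact: h.
Qed.

Lemma sln_id I z : w @[w --> sln I z] --> z.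
Proof. exact: cvg_within. Qed.

Lemma sln_cline I z : \forall w \near sln I z, cline I w.
Proof. by apply/sln_nearP; exists 1. Qed.

Lemma sln_self I z (P : set H) : cline I z -> sln I z P -> P z.
Proof. by move=> Iz /sln_nearP[e e0 h]; apply: h => //; rewrite subrr qabs0. Qed.

Lemma sln_open I z W : open W -> W z -> \forall w \near sln I z, W w.
Proof.
move=> oW Wz; have /nbhs_qabsP[e e0 h] : nbhs z W by exact: open_nbhs_nbhs.
by apply/sln_nearP; exists e => // w _; exact: h.
Qed.

Lemma continuous_qconj : continuous (@qconj R).
Proof. by move=> z; apply: (@cvgqconj _ _ (nbhs z) _ id z); exact: cvg_id. Qed.
Lemma continuous_qproj I : continuous (@qproj R I).
Proof. by move=> z; apply: (@cvgqproj _ _ (nbhs z) _ _ id z); exact: cvg_id. Qed.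
Lemma continuous_qproj' I : continuous (@qproj' R I).
Proof. by move=> z; apply: (@cvgqproj' _ _ (nbhs z) _ _ id z); exact: cvg_id. Qed.
Lemma continuous_qmulr c : continuous (fun a : H => a * c).
Proof.
by move=> z; apply: (@cvgqM _ _ (nbhs z) _ id (fun=> c)); [exact: cvg_id|exact: cvg_cst].
Qed.
Lemma continuous_qmull c : continuous (fun a : H => c * a).
Proof.
by move=> z; apply: (@cvgqM _ _ (nbhs z) _ (fun=> c) id); [exact: cvg_cst|exact: cvg_id].
Qed.

Lemma sln_comp I J (s : H -> H) z : (forall z, cline J z -> cline I (s z)) ->
  continuous s -> s w @[w --> sln J z] --> sln I (s z).
Proof.
move=> sI sc A /sln_nearP[e e0 hA].
have /(sc z)/nbhs_qabsP[e' e'0 h'] : nbhs (s z) [set w | qabs (w - s z) < e].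
  by apply/nbhs_qabsP; exists e.
by apply/sln_nearP; exists e' => // w Iw wz; apply: hA; [exact: sI|exact: h'].
Qed.

(* Caratheodory's form of complex differentiability along the line R + I R. *)
Definition cderiv I f z d := exists phi : H -> H,
  [/\ phi z = d, phi w @[w --> sln I z] --> d
    & \forall w \near sln I z, f w = f z + (w - z) * phi w].

(** Continuity of the derivative is part of the notion because [holomorphic] asks for continuous
    partial derivatives. *)
Definition holo I W f := exists d : H -> H, forall z, W z -> cline I z ->
  cderiv I f z (d z) /\ d w @[w --> sln I z] --> d z.

Lemma cderiv_cvg I f z d : cderiv I f z d -> f w @[w --> sln I z] --> f z.
Proof.
move=> [phi [_ phid fE]].
rewrite -[X in _ --> X](_ : f z + (z - z) * d = f z); last by rewrite subrr mul0r addr0.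
have : f z + (w - z) * phi w @[w --> sln I z] --> f z + (z - z) * d.
  apply: cvgD; first exact: cvg_cst.
  by apply: cvgqM => //; apply: cvgqB; [exact: sln_id|exact: cvg_cst].
apply: cvg_trans; apply: near_eq_cvg; move: fE; apply: filterS => w ->//.
Qed.

Lemma cderiv_congr I f g z d : cline I z -> (\forall w \near sln I z, f w = g w) ->
  cderiv I f z d -> cderiv I g z d.
Proof.
move=> Iz fg [phi [pz phid fE]]; exists phi; split=> //.
have := sln_self Iz fg; rewrite /= => <-.
by near=> w; have <- : f w = g w; near: w.
Unshelve. all: by end_near. Qed.

Lemma holo_cvg I W f z : holo I W f -> W z -> cline I z ->
  f w @[w --> sln I z] --> f z.
Proof. by move=> [d h] Wz Iz; have [/cderiv_cvg] := h z Wz Iz. Qed.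

Lemma holoW I W V f : V `<=` W -> holo I W f -> holo I V f.
Proof. by move=> VW [d h]; exists d => z /VW Wz Iz; exact: h. Qed.

Lemma holo_congr I W f g : open W -> (forall z, W z -> cline I z -> f z = g z) ->
  holo I W f -> holo I W g.
Proof.
move=> oW fg [d h]; exists d => z Wz Iz; have [h1 h2] := h z Wz Iz.
split=> //; apply: cderiv_congr h1 => //.
have h3 := @sln_open I z W oW Wz; have h4 := @sln_cline I z.
by near=> w; apply: fg; [near: w|near: w].
Unshelve. all: by end_near. Qed.

Lemma holo_cst I W a : holo I W (fun=> a).
Proof.
exists (fun=> 0) => z _ _; split; last exact: cvg_cst.
exists (fun=> 0); split=> //; first exact: cvg_cst.
by apply: nearW => w; rewrite mulr0 addr0.
Qed.

Lemma holo_id I W : holo I W id.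
Proof.
exists (fun=> 1) => z _ _; split; last exact: cvg_cst.
exists (fun=> 1); split=> //; first exact: cvg_cst.
by apply: nearW => w; rewrite mulr1 addrC subrK.
Qed.

Lemma holoD I W f g : holo I W f -> holo I W g -> holo I W (fun z => f z + g z).
Proof.
move=> [d hf] [d' hg]; exists (fun z => d z + d' z) => z Wz Iz.
have [[phi [pz pd fE]] dz] := hf z Wz Iz.
have [[phi' [pz' pd' gE]] dz'] := hg z Wz Iz.
split; last exact: cvgD.
exists (fun w => phi w + phi' w); split; [by rewrite pz pz'|exact: cvgD|].
by near=> w; rewrite mulrDr addrACA; congr (_ + _); near: w.
Unshelve. all: by end_near. Qed.

(* [F z] need only commute with the increments [w - z], up to the change of sign
   of [I] when [s] is the conjugation. *)
Lemma holoM_gen I W V (s : H -> H) F g : SS I ->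
  (forall z, cline I z -> cline I (s z)) -> continuous s ->
  (forall z w, s (z - w) = s z - s w) ->
  (forall z, W z -> cline I z -> V (s z)) ->
  (forall z w, W z -> cline I z -> cline I w -> F z * s w = w * F z) ->
  holo I W F -> holo I V g -> holo I W (fun z => F z * g (s z)).
Proof.
move=> SI sI sc sB sV Fs [d hF] [d' hg].
exists (fun z => d z * g (s z) + F z * d' (s z)) => z Wz Iz.
have [[phi [pz pd FE]] dz] := hF z Wz Iz.
have [gd dz'] := hg (s z) (sV _ Wz Iz) (sI _ Iz).
have gc := cderiv_cvg gd; have [phi' [pz' pd' gE]] := gd.
have Fc := cderiv_cvg (hF z Wz Iz).1.
have ss := sln_comp (z := z) sI sc.
have g1 : g (s w) @[w --> sln I z] --> g (s z) by apply: cvg_comp gc.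
have d1 : d' (s w) @[w --> sln I z] --> d' (s z) by apply: cvg_comp dz'.
have p1 : phi' (s w) @[w --> sln I z] --> d' (s z) by apply: cvg_comp pd'.
split.
  exists (fun w => phi w * g (s w) + F z * phi' (s w)); split.
  - by rewrite pz pz'.
  - by apply: cvgD; apply: cvgqM => //; exact: cvg_cst.
  have gE' : \forall w \near sln I z, g (s w) = g (s z) + (s w - s z) * phi' (s w).
    by move: (ss _ gE).
  near=> w.
  have Iw : cline I w by near: w; exact: sln_cline.
  have -> : F w = F z + (w - z) * phi w by near: w.
  have e : g (s w) = g (s z) + (s w - s z) * phi' (s w) by near: w.
  rewrite mulrDl {1}e mulrDr -addrA; congr (_ + _).
  (* [Fs] carries the increment [s (w - z)] across [F z], where it becomes w - z on the left. *)
  rewrite -sB mulrA Fs//; last exact: clineB.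
  by rewrite mulrDr !mulrA addrC.
by apply: cvgD; apply: cvgqM.
Unshelve. all: by end_near. Qed.

Lemma holoM I W F g : SS I -> (forall z, W z -> cline I z -> cline I (F z)) ->
  holo I W F -> holo I W g -> holo I W (fun z => F z * g z).
Proof.
move=> SI FI hF hg; apply: (@holoM_gen I W W id) => //; first by move=> z; exact: cvg_id.
by move=> z w Wz Iz Iw; apply: (cline_comm SI) => //; exact: FI.
Qed.

(** Conjugating the variable makes g antiholomorphic; a left factor anticommuting with [I]
    conjugates the increments once more and restores holomorphy. *)
Lemma holoM_twist I W F g : SS I -> (forall z, W z -> W (qconj z)) ->
  (forall z, W z -> cline I z -> I * F z = - (F z * I)) ->
  holo I W F -> holo I W g -> holo I W (fun z => F z * g (qconj z)).
Proof.
move=> SI Wc FI hF hg; apply: (@holoM_gen I W W) => //.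
- by move=> z; exact: cline_conj.
- exact: continuous_qconj.
- exact: qconjB.
- by move=> z Wz _; exact: Wc.
move=> z w Wz Iz Iw; rewrite (cline_anti SI (cline_conj SI Iw) (FI z Wz Iz)).
by rewrite qconjK.
Qed.

(** One transport principle for the projections, right multiplications, the double conjugation and
    the passage between lines: [L] has to be additive and to absorb the change of variable [s]. *)
Lemma holo_lin I J W V (s L : H -> H) f :
  (forall z, cline J z -> cline I (s z)) -> continuous s ->
  (forall z w, s (z - w) = s z - s w) ->
  (forall z, W z -> cline J z -> V (s z)) ->
  continuous L -> (forall a b, L (a - b) = L a - L b) ->
  (forall z a, cline J z -> L (s z * a) = z * L a) ->
  SS J -> holo I V f -> holo J W (fun z => L (f (s z))).
Proof.
move=> sI sc sB sV Lc LB Ls SJ [d hf].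
have LD a b : L (a + b) = L a + L b.
  by rewrite -{1}[b]opprK LB; congr (_ + _); rewrite -sub0r LB -[0](subrr b) LB subrr sub0r opprK.
exists (fun z => L (d (s z))) => z Wz Jz.
have [fd dz] := hf (s z) (sV _ Wz Jz) (sI _ Jz).
have [phi [pz pd fE]] := fd.
have ss := sln_comp (z := z) sI sc.
split.
  exists (fun w => L (phi (s w))); split; first by rewrite pz.
    by apply: continuous_cvg; [exact: Lc|apply: cvg_comp pd].
  have fE' : \forall w \near sln J z, f (s w) = f (s z) + (s w - s z) * phi (s w).
    by move: (ss _ fE).
  near=> w.
  have Jw : cline J w by near: w; exact: sln_cline.
  have -> : f (s w) = f (s z) + (s w - s z) * phi (s w) by near: w.
  by rewrite LD -sB Ls//; exact: clineB.
by apply: continuous_cvg; [exact: Lc|apply: cvg_comp dz].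
Unshelve. all: by end_near. Qed.

Lemma holo_left I W f (L : H -> H) : SS I -> continuous L ->
  (forall a b, L (a - b) = L a - L b) ->
  (forall z a, cline I z -> L (z * a) = z * L a) ->
  holo I W f -> holo I W (fun z => L (f z)).
Proof. by move=> SI Lc LB Lz; apply: (@holo_lin I I W W id) => // z; exact: cvg_id. Qed.

Lemma qprojB I a b : qproj I (a - b) = qproj I a - qproj I b.
Proof.
rewrite /qproj -scalerBr; congr (_ *: _).
by rewrite mulrBr mulrBl !opprB addrACA [RHS]addrACA [in RHS](addrC (- _) (- b)).
Qed.
Lemma qproj'B I a b : qproj' I (a - b) = qproj' I a - qproj' I b.
Proof.
rewrite /qproj' -scalerBr; congr (_ *: _).
by rewrite mulrBr mulrBl opprD addrACA.
Qed.
Lemma qprojM I z a : SS I -> cline I z -> qproj I (z * a) = z * qproj I a.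
Proof.
move=> SI /(clineP SI) h; rewrite /qproj -scalerAr mulrBr; congr (_ *: (_ - _)).
by rewrite !mulrA h.
Qed.
Lemma qproj'M I z a : SS I -> cline I z -> qproj' I (z * a) = z * qproj' I a.
Proof.
move=> SI /(clineP SI) h; rewrite /qproj' -scalerAr mulrDr; congr (_ *: (_ + _)).
by rewrite !mulrA h.
Qed.

Lemma holo_proj I W f : SS I -> holo I W f -> holo I W (fun z => qproj I (f z)).
Proof.
move=> SI; apply: holo_left => //.
- exact: continuous_qproj.
- exact: qprojB.
- by move=> z a; exact: qprojM.
Qed.
Lemma holo_proj' I W f : SS I -> holo I W f -> holo I W (fun z => qproj' I (f z)).
Proof.
move=> SI; apply: holo_left => //.
- exact: continuous_qproj'.
- exact: qproj'B.
- by move=> z a; exact: qproj'M.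
Qed.
Lemma holoMr I W f c : SS I -> holo I W f -> holo I W (fun z => f z * c).
Proof.
move=> SI; apply: (@holo_left I W f (fun a => a * c)) => //.
- exact: continuous_qmulr.
- by move=> a b; rewrite mulrBl.
- by move=> z a _; rewrite mulrA.
Qed.
Lemma holoN I W f : SS I -> holo I W f -> holo I W (fun z => - f z).
Proof.
move=> SI hf; have := holoMr (- 1) SI hf.
by under eq_fun do rewrite mulrN1.
Qed.
Lemma holoB I W f g : SS I -> holo I W f -> holo I W g -> holo I W (fun z => f z - g z).
Proof. by move=> SI hf hg; apply: holoD => //; exact: holoN. Qed.
(** Schwarz reflection. The projection keeps the values on the line, where the reversal of products
    by conjugation does no harm. *)
Lemma holo_conj_proj I W f : SS I -> (forall z, W z -> W (qconj z)) ->
  holo I W f -> holo I W (fun z => qconj (qproj I (f (qconj z)))).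
Proof.
move=> SI Wc; apply: (@holo_lin I I W W _ (fun a => qconj (qproj I a))) => //.
- by move=> z; exact: cline_conj.
- exact: continuous_qconj.
- exact: qconjB.
- by move=> z Wz _; exact: Wc.
- by move=> a; apply: (@cvgqconj _ _ (nbhs a) _ (qproj I)); exact: continuous_qproj.
- by move=> a b; rewrite qprojB qconjB.
move=> z a Iz; rewrite qprojM//; last exact: cline_conj.
rewrite qconjM qconjK; apply: (cline_comm SI) => //; apply: cline_conj => //.
exact: qproj_cline.
Qed.

Lemma holoV I W F : SS I -> open W -> (forall z, W z -> cline I z -> cline I (F z)) ->
  (forall z, W z -> cline I z -> F z != 0) ->
  holo I W F -> holo I W (fun z => (F z)^-1).
Proof.
move=> SI oW FI F0 [d hF].
exists (fun z => - ((F z)^-1 * d z * (F z)^-1)) => z Wz Iz.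
have [Fd dz] := hF z Wz Iz; have Fc := cderiv_cvg Fd.
have iFc : (F w)^-1 @[w --> sln I z] --> (F z)^-1 by apply: cvgqV => //; exact: F0.
split; last first.
  by apply: cvgN; apply: cvgqM => //; apply: cvgqM.
have [phi [pz pd FE]] := Fd.
exists (fun w => - ((F w)^-1 * phi w * (F z)^-1)); split; first by rewrite pz.
  apply: cvgN; apply: cvgqM; last exact: cvg_cst.
  exact: cvgqM.
near=> w.
have Iw : cline I w by near: w; exact: sln_cline.
have Ww : W w by near: w; exact: sln_open.
have E : F w = F z + (w - z) * phi w by near: w.
have Fw0 := F0 w Ww Iw; have Fz0 := F0 z Wz Iz.
have cw : (w - z) * (F w)^-1 = (F w)^-1 * (w - z).
  by apply: (cline_comm SI); [exact: clineB|apply: clineV => //; exact: FI].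
rewrite mulrN !mulrA cw -[_ * _ * phi w]mulrA.
have -> : (w - z) * phi w = F w - F z by rewrite E addrAC subrr add0r.
by rewrite mulrBr mulVq// mulrBl mul1r -mulrA mulqV// mulr1 opprB addrC subrK.
Unshelve. all: by end_near. Qed.

Lemma holoX I W f n : SS I -> (forall z, W z -> cline I z -> cline I (f z)) ->
  holo I W f -> holo I W (fun z => f z ^+ n).
Proof.
move=> SI fI hf; elim: n => [|n IH]; first exact: holo_cst.
under eq_fun do rewrite exprS; exact: holoM.
Qed.

End ComplexDerivative.

(** * Equivalence with the definition by partial derivatives *)

Section HolomorphicHolo.
Variable R : realType.
Local Notation H := (quat R).
Local Notation SS := (@imag_units R).
Implicit Types (p q z w a b I J d : H) (f g F G : H -> H) (W V : set H).

(** The factor 2 is the square root of the number of coordinates. *)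
Lemma qabs_le_coord q (c : R) : (forall k, `|q 0 k| <= c) -> qabs q <= 2 * c.
Proof.
move=> h; have c0 : 0 <= c by exact: le_trans (h 0).
rewrite -[leRHS]ger0_norm ?mulr_ge0// -sqrtr_sqr ler_sqrt ?sqr_ge0// /qdot.
have {}h k : q 0 k ^+ 2 <= c ^+ 2.
  by rewrite -real_normK ?num_real// lerXn2r ?nnegrE//; exact: h.
have h0 : qre q ^+ 2 <= c ^+ 2 by exact: h.
have h1 : qci q ^+ 2 <= c ^+ 2 by exact: h.
have h2 : qcj q ^+ 2 <= c ^+ 2 by exact: h.
have h3 : qck q ^+ 2 <= c ^+ 2 by exact: h.
nra.
Qed.

Lemma coordZ_le (c m e : R) q k : `|c| <= m -> qabs q <= e -> `|(c *: q) 0 k| <= e * m.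
Proof.
move=> cm qe; rewrite (le_trans (qabs_coord _ _))// qabsZ mulrC.
by apply: ler_pM => //; exact: qabs_ge0.
Qed.

(** The increment of one coordinate along two sides of a rectangle, [a] in direction 1 and then [b]
    in direction [I]; [d1] and [d2] are the derivatives at the intermediate points that the mean
    value theorem provides for this coordinate. *)
Lemma two_step (fw fa fz d d1 d2 I : H) (a b m e : R) k : SS I ->
  `|a| <= m -> `|b| <= m -> qabs (d1 - d) <= e -> qabs (d2 - d) <= e ->
  fa 0 k - fz 0 k = d1 0 k * a -> fw 0 k - fa 0 k = (I * d2) 0 k * b ->
  `|(fw - fz - cpoint a b I * d) 0 k| <= 2 * e * m.
Proof.
move=> SI am bm e1 e2 h1 h2.
have hb : `|(b *: (I * (d2 - d))) 0 k| <= e * m.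
  by apply: coordZ_le => //; rewrite qabsM SSabs// mul1r.
have ha : `|(a *: (d1 - d)) 0 k| <= e * m by exact: coordZ_le.
have -> : (fw - fz - cpoint a b I * d) 0 k =
    (b *: (I * (d2 - d))) 0 k + (a *: (d1 - d)) 0 k.
  rewrite /cpoint mulrDl -!scalerAl mul1r mulrBr.
  move: h2; set c := I * d2; set c' := I * d => h2.
  move: h1 h2; rewrite !mxE => h1 h2.
  have -> : fw 0 k - fz 0 k = (fw 0 k - fa 0 k) + (fa 0 k - fz 0 k) by ring.
  by rewrite h1 h2; ring.
by rewrite (le_trans (ler_normD _ _))// -mulrA mulr_natl mulr2n lerD.
Qed.

Lemma within_slice W I z : open W -> W z -> within (slice W I) (nbhs z) = sln I z.
Proof.
move=> oW Wz; apply/seteqP; split=> P /=.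
  rewrite /within/= -/(nbhs z _) => h; rewrite /sln/within/= -/(nbhs z _).
  have : nbhs z W by exact: open_nbhs_nbhs.
  by move: h; apply: filterS2 => w h Ww Iw; exact: h.
by rewrite /sln /within/= -!/(nbhs z _); apply: filterS => w h [_ Iw]; exact: h.
Qed.

Lemma cderiv_is_derive I f z d v : cline I z -> cline I v -> SS I -> cderiv I f z d ->
  is_derive z v f (v * d).
Proof.
move=> Iz Iv SI [phi [pz pd fE]]; apply: is_derive_cvg.
have sI h : cline I (h *: v + z) by apply: clineD => //; exact: clineZ.
have tz : (h *: v + z : H) @[h --> (0 : R)^'] --> z.
  rewrite -[X in _ --> X](_ : 0 *: v + z = z); last by rewrite scale0r add0r.
  apply: cvgD; last exact: cvg_cst.
  have -> : (fun h : R => h *: v) = (fun h : R => (h *: 1) * v).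
    by apply/funext => h; rewrite -scalerAl mul1r.
  have -> : (0 : R) *: v = 0 * v by rewrite scale0r mul0r.
  apply: cvgqM; last exact: cvg_cst.
  apply: (@cvg_qabs_squeeze _ _ _ _ _ _ (fun h : R => `|h|)).
    by apply: nearW => h; rewrite subr0 qabsZ qabs1 mulr1.
  have hn : `|h| @[h --> (0 : R)] --> `|0 : R| by apply: cvg_norm; exact: cvg_id.
  by rewrite normr0 in hn; exact: cvg_within_filter hn.
have ts : (h *: v + z : H) @[h --> (0 : R)^'] --> sln I z.
  move=> A; rewrite /sln /within/= -/(nbhs z _) => /tz.
  rewrite /nbhs/=; apply: filterS => h; apply; exact: sI.
have fE' : \forall h \near (0 : R)^', f (h *: v + z) = f z + (h *: v + z - z) * phi (h *: v + z).
  by move: (ts _ fE).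
have : v * phi (h *: v + z) @[h --> (0 : R)^'] --> v * d.
  apply: cvgqM; first exact: cvg_cst.
  exact: cvg_comp ts pd.
apply: cvg_trans; apply: near_eq_cvg.
near=> h.
have h0 : h != 0 by near: h; exact: nbhs_dnbhs_neq.
have -> : f (h *: v + z) = f z + (h *: v + z - z) * phi (h *: v + z) by near: h.
by rewrite addrAC subrr add0r addrK -scalerAl scalerA mulVf// scale1r.
Unshelve. all: by end_near. Qed.

Lemma holo_holomorphic I W f : SS I -> open W -> holo I W f -> holomorphic I (slice W I) f.
Proof.
move=> SI oW [d h].
have h1 z : slice W I z -> is_derive z 1 f (d z).
  by move=> [Wz Iz]; rewrite -[d z]mul1r; apply: cderiv_is_derive (h z Wz Iz).1 => //; exact: cline1.
have hI z : slice W I z -> is_derive z I f (I * d z).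
  by move=> [Wz Iz]; apply: cderiv_is_derive (h z Wz Iz).1 => //; exact: clineI.
have E1 z : slice W I z -> 'D_1 f z = d z by move=> /h1[].
have EI z : slice W I z -> 'D_I f z = I * d z by move=> /hI[].
split.
- by move=> z Wz; split; [case: (h1 z Wz)|case: (hI z Wz)].
- apply/subspace_continuousP => z Wz; rewrite within_slice//; last by case: Wz.
  rewrite /from_subspace/= E1//; have := (h z Wz.1 Wz.2).2; apply: cvg_trans; apply: near_eq_cvg.
  have h3 := @sln_open R I z W oW Wz.1; have h4 := @sln_cline R I z.
  by near=> w; rewrite E1//; split; near: w.
- apply/subspace_continuousP => z Wz; rewrite within_slice//; last by case: Wz.
  rewrite /from_subspace/= EI//; have := (h z Wz.1 Wz.2).2.
  move=> /(cvgqM (cvg_cst I)); apply: cvg_trans; apply: near_eq_cvg.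
  have h3 := @sln_open R I z W oW Wz.1; have h4 := @sln_cline R I z.
  by near=> w; rewrite EI//; split; near: w.
- by move=> z Wz; rewrite E1// EI// SSK// subrr scaler0.
Unshelve. all: by end_near. Qed.

(* Continuity of the partial derivatives and the mean value theorem on the two sides of a
   rectangle give complex differentiability. *)
Lemma holomorphic_holo I W f : SS I -> open W -> holomorphic I (slice W I) f -> holo I W f.
Proof.
move=> SI oW [df /subspace_continuousP c1 _ CR].
have EI z : slice W I z -> 'D_I f z = I * 'D_1 f z.
  move=> /CR /eqP; rewrite scaler_eq0 invr_eq0 pnatr_eq0/= => /eqP h.
  apply: (mulqI (SS_neq0 SI)); rewrite SSK//; apply/eqP.
  by rewrite -addr_eq0 addrC h.
exists (fun z => 'D_1 f z) => z Wz Iz.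
have dz : 'D_1 f w @[w --> sln I z] --> 'D_1 f z.
  by rewrite -(@within_slice W)//; exact: c1.
split=> //.
pose phi w := if w == z then 'D_1 f z else (w - z)^-1 * (f w - f z).
exists phi; split; first by rewrite /phi eqxx.
  apply/cvg_qabsP => e e0.
  (* [two_step] and [qabs_le_coord] lose a factor 2 each, so the final bound is e / 2. *)
  have e8 : 0 < e / 8 by exact: divr_gt0.
  have [r1 r10 h1] := (sln_nearP I z _).1 (@sln_open R I z W oW Wz).
  have [r2 r20 h2] := (sln_nearP I z _).1 ((cvg_qabsP _ _ _).1 dz _ e8).
  apply/sln_nearP; exists (Num.min r1 r2); first by rewrite lt_min r10.
  move=> w Iw; rewrite lt_min => /andP[wr1 wr2].
  rewrite /phi; case: eqVneq => [_|wz]; first by rewrite subrr qabs0.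
  have := clineB SI Iw Iz; move=> [a [b wE]].
  have ew : w = z + a *: 1 + b *: I by rewrite -addrA -/(cpoint a b I) -wE addrC subrK.
  have hab : qabs (w - z) = Num.sqrt (a ^+ 2 + b ^+ 2) by rewrite wE qabs_cpoint.
  have ha : `|a| <= qabs (w - z) by rewrite hab -sqrtr_sqr ler_sqrt ?addr_ge0 ?sqr_ge0// lerDl sqr_ge0.
  have hb : `|b| <= qabs (w - z) by rewrite hab -sqrtr_sqr ler_sqrt ?addr_ge0 ?sqr_ge0// lerDr sqr_ge0.
  (* No point of the rectangle is farther from [z] than [w], so the whole rectangle stays in the
     region controlled by [r1] and [r2]. *)
  have box s t : `|s| <= `|a| -> `|t| <= `|b| ->
      slice W I (z + s *: 1 + t *: I) /\
      qabs ('D_1 f (z + s *: 1 + t *: I) - 'D_1 f z) < e / 8.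
    move=> sa tb.
    have Iu : cline I (z + s *: 1 + t *: I).
      by rewrite -addrA; apply: clineD => //; exact: cline_cpoint.
    have hu : qabs (z + s *: 1 + t *: I - z) <= qabs (w - z).
      rewrite -(addrA z) (addrC z) addrK -/(cpoint s t I) qabs_cpoint// hab.
      rewrite ler_sqrt ?addr_ge0 ?sqr_ge0// lerD//.
        by rewrite -[leLHS]real_normK ?num_real// -[leRHS]real_normK ?num_real// lerXn2r ?nnegrE.
      by rewrite -[leLHS]real_normK ?num_real// -[leRHS]real_normK ?num_real// lerXn2r ?nnegrE.
    split; first by split=> //; apply: h1 => //; exact: le_lt_trans wr1.
    by apply: h2 => //; exact: le_lt_trans wr2.
  have wz0 : w - z != 0 by rewrite subr_eq0.
  have main k : `|(f w - f z - (w - z) * 'D_1 f z) 0 k| <= 2 * (e / 8) * qabs (w - z).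
    have a0 s : z + s *: 1 = z + s *: 1 + 0 *: I by rewrite scale0r addr0.
    have b0 : `|0 : R| <= `|b| by rewrite normr0.
    have [s sa hs] := @mvt0 R (fun s => f (z + s *: 1) 0 k)
      (fun s => ('D_1 f (z + s *: 1)) 0 k) a
      (fun s sa => @coord_derive R f z 1 s k
        (df _ (eq_ind_r (slice W I) (box s 0 sa b0).1 (a0 s))).1).
    have [t tb ht] := @mvt0 R (fun t => f (z + a *: 1 + t *: I) 0 k)
      (fun t => ('D_I f (z + a *: 1 + t *: I)) 0 k) b
      (fun t tb => @coord_derive R f (z + a *: 1) I t k
        (df _ (box a t (lexx _) tb).1).2).
    move: hs ht; rewrite !scale0r !addr0 -ew => hs ht.
    have [S1 d1] := box s 0 sa b0; have [S2 d2] := box a t (lexx _) tb.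
    move: hs d1; rewrite [in X in _ -> X](_ : z + s *: 1 + 0 *: I = z + s *: 1) -?a0// => hs d1.
    rewrite EI// in ht; rewrite [X in X * 'D_1 f z]wE.
    by apply: (two_step SI ha hb (ltW d1) (ltW d2) hs ht).
  have -> : (w - z)^-1 * (f w - f z) - 'D_1 f z = (w - z)^-1 * (f w - f z - (w - z) * 'D_1 f z).
    by rewrite [in RHS]mulrBr mulrA mulVq// mul1r.
  have q0 : 0 < qabs (w - z) by rewrite qabs_gt0.
  rewrite qabsM qabsV mulrC ltr_pdivrMr//.
  apply: le_lt_trans (qabs_le_coord main) _.
  rewrite mulrA ltr_pM2r//; lra.
by near=> w; rewrite /phi; case: eqVneq => [->|wz];
  [rewrite subrr mul0r addr0|rewrite mulrA mulqV ?subr_eq0// mul1r addrC subrK].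
Unshelve. all: by end_near. Qed.

End HolomorphicHolo.

(** * Integration over circles *)

Section QuatCurves.
Variable R : realType.
Local Notation H := (quat R).
Local Notation SS := (@imag_units R).
Implicit Types (f g : R -> H) (t : R) (I d : H).

Definition qder g t d := h^-1 *: (g (h + t) - g t) @[h --> (0 : R)^'] --> d.

Lemma qder_coord g t d k : qder g t d ->
  is_derive t (1 : R) (fun s => g s 0 k) (d 0 k).
Proof.
move=> hg; apply: is_derive_cvg.
have : (h^-1 *: (g (h + t) - g t)) 0 k @[h --> (0 : R)^'] --> d 0 k by exact: cvg_coord.
apply: cvg_trans; apply: near_eq_cvg; apply: nearW => s.
by rewrite !mxE -[s *: 1]/(s * 1) mulr1.
Qed.

Lemma qder_cvg g t d : qder g t d -> g (h + t) @[h --> (0 : R)^'] --> g t.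
Proof.
move=> hg.
have h1 : (h *: 1 : H) * (h^-1 *: (g (h + t) - g t)) + g t @[h --> (0 : R)^'] --> 0 * d + g t.
  apply: cvgD; last exact: cvg_cst.
  apply: cvgqM => //; apply: (@cvg_qabs_squeeze _ _ _ _ _ _ (fun h : R => `|h|)).
    by apply: nearW => h; rewrite subr0 qabsZ qabs1 mulr1.
  have hn : `|h| @[h --> (0 : R)] --> `|0 : R| by apply: cvg_norm; exact: cvg_id.
  by rewrite normr0 in hn; exact: cvg_within_filter hn.
rewrite mul0r add0r in h1; move: h1; apply: cvg_trans; apply: near_eq_cvg.
near=> h.
have h0 : h != 0 by near: h; exact: nbhs_dnbhs_neq.
by rewrite -scalerAl mul1r scalerA mulfV// scale1r subrK.
Unshelve. all: by end_near. Qed.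

Lemma qder_continuous g t d : qder g t d -> {for t, continuous g}.
Proof.
move=> /qder_cvg/cvg_qabsP h; apply/cvg_qabsP => e e0; move: (h e e0).
rewrite near_withinE => /nbhs_ballP[r /= r0 hr].
apply/nbhs_ballP; exists r => //= s.
have [->|st] := eqVneq s t; first by rewrite subrr qabs0.
move=> ts; have := hr (s - t); rewrite subrK; apply.
  by rewrite /ball/= sub0r normrN distrC.
by rewrite subr_eq0.
Qed.

Lemma qderM f g t a b : qder f t a -> qder g t b ->
  qder (fun s => f s * g s) t (a * g t + f t * b).
Proof.
move=> ha hb; have gc := qder_cvg hb; rewrite /qder.
have : (h^-1 *: (f (h + t) - f t)) * g (h + t) + f t * (h^-1 *: (g (h + t) - g t))
    @[h --> (0 : R)^'] --> a * g t + f t * b.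
  by apply: cvgD; apply: cvgqM => //; exact: cvg_cst.
apply: cvg_trans; apply: near_eq_cvg; apply: nearW => h.
rewrite -scalerAl -scalerAr -scalerDr; congr (_ *: _).
by rewrite mulrBr mulrBl addrA subrK.
Qed.

Lemma qderD f g t a b : qder f t a -> qder g t b ->
  qder (fun s => f s + g s) t (a + b).
Proof.
move=> ha hb.
have : h^-1 *: (f (h + t) - f t) + h^-1 *: (g (h + t) - g t) @[h --> (0 : R)^'] --> a + b.
  exact: cvgD.
apply: cvg_trans; apply: near_eq_cvg.
by apply: nearW => h /=; rewrite -scalerDr opprD addrACA.
Qed.

Lemma qder_cst c t : qder (fun=> c) t 0.
Proof.
have : (0 : H) @[_ --> (0 : R)^'] --> (0 : H) by exact: cvg_cst.
by apply: cvg_trans; apply: near_eq_cvg; apply: nearW => h /=; rewrite subrr scaler0.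
Qed.

Lemma qderMl c g t b : qder g t b -> qder (fun s => c * g s) t (c * b).
Proof.
move=> h; have := qderM (qder_cst c t) h; rewrite mul0r add0r; exact.
Qed.
Lemma qderMr c g t b : qder g t b -> qder (fun s => g s * c) t (b * c).
Proof.
move=> h; have := qderM h (qder_cst c t); rewrite mulr0 addr0; exact.
Qed.

Lemma qderZ (u : R -> R) (u' : R) c t : is_derive t (1 : R) u u' ->
  qder (fun s => u s *: c) t (u' *: c).
Proof.
move=> /is_derive_lim hu.
have {}hu : h^-1 * (u (h + t) - u t) @[h --> (0 : R)^'] --> u'.
  move: hu; apply: cvg_trans; apply: near_eq_cvg; apply: nearW => h /=.
  by rewrite -[h *: 1]/(h * 1) mulr1.
rewrite /qder.
apply: (@cvg_qabs_squeeze _ _ _ _ _ _ (fun h : R => `|h^-1 * (u (h + t) - u t) - u'| * qabs c)).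
  apply: nearW => h; rewrite -qabsZ -scalerBl scalerA -scalerBl//.
rewrite -[X in _ --> X](mul0r (qabs c)); apply: cvgM; last exact: cvg_cst.
have h2 : `|h^-1 * (u (h + t) - u t) - u'| @[h --> (0 : R)^'] --> `|u' - u'|.
  by apply: cvg_norm; apply: cvgB => //; exact: cvg_cst.
by rewrite subrr normr0 in h2.
Qed.

Lemma qder_comp I (psi : H -> H) (gam : R -> H) t d gam' :
  (forall s, cline I (gam s)) -> cderiv I psi (gam t) d -> qder gam t gam' ->
  qder (fun s => psi (gam s)) t (gam' * d).
Proof.
move=> gI [phi [pz pd fE]] hg.
have gs : gam (h + t) @[h --> (0 : R)^'] --> sln I (gam t).
  move=> A; rewrite /sln /within/= -/(nbhs (gam t) _) => /(qder_cvg hg).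
  rewrite /nbhs/=; apply: filterS => h; apply; exact: gI.
have fE' : \forall h \near (0 : R)^', psi (gam (h + t)) =
    psi (gam t) + (gam (h + t) - gam t) * phi (gam (h + t)).
  by move: (gs _ fE).
have : (h^-1 *: (gam (h + t) - gam t)) * phi (gam (h + t)) @[h --> (0 : R)^'] --> gam' * d.
  by apply: cvgqM => //; exact: cvg_comp gs pd.
apply: cvg_trans; apply: near_eq_cvg; near=> h.
have -> : psi (gam (h + t)) = psi (gam t) + (gam (h + t) - gam t) * phi (gam (h + t)).
  by near: h.
by rewrite addrAC subrr add0r scalerAl.
Unshelve. all: by end_near. Qed.

Definition qcircle I t : H := cpoint (cos t) (sin t) I.

Lemma qcircle_der I t : SS I -> qder (qcircle I) t (I * qcircle I t).
Proof.
move=> SI; rewrite /qcircle /cpoint mulrDr -!scalerAr mulr1 (SSsqr SI) addrC scalerN -scaleNr.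
by apply: qderD; apply: qderZ; exact: is_derive1.
Qed.

End QuatCurves.

Section CircleIntegral.
Variable R : realType.
Local Notation H := (quat R).
Local Notation SS := (@imag_units R).
Local Notation mu := (@lebesgue_measure R).
Local Notation T := (pi *+ 2 : R).
Local Notation D := (`[0, T]%classic : set R).
Implicit Types (f g : R -> H) (t : R) (I d : H).

Definition qint g : H := \row_k \int[mu]_(t in D) (g t 0 k).

Lemma twopi_gt0 : 0 < T. Proof. by rewrite mulrn_wgt0// pi_gt0. Qed.

Lemma D_measurable : measurable (D : set (measurableTypeR R)).
Proof. exact: measurable_itv. Qed.

Lemma Rint_cst (C : R) : \int[mu]_(t in D) C = C * T.
Proof.
rewrite Rintegral_cst; last exact: D_measurable.
have h : lebesgue_measure D = T%:E.
  by rewrite lebesgue_measure_itv/= lte_fin twopi_gt0 sube0.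
by congr (_ * _); rewrite -[RHS]/(fine T%:E) -h.
Qed.

Lemma coord_continuousT g (k : 'I_4) : continuous g -> continuous (fun t => g t 0 k).
Proof. by move=> cg t; apply: cvg_coord; exact: cg. Qed.

Lemma cont_integrable (u : R -> R) : continuous u -> mu.-integrable D (EFin \o u).
Proof.
move=> cu; apply: continuous_compact_integrable; first exact: segment_compact.
exact: continuous_subspaceT.
Qed.

Lemma coord_integrable g k : continuous g -> mu.-integrable D (EFin \o (fun t => g t 0 k)).
Proof. by move=> cg; apply: cont_integrable; exact: coord_continuousT. Qed.

Lemma qintD f g : continuous f -> continuous g ->
  qint (fun t => f t + g t) = qint f + qint g.
Proof.
move=> cf cg; apply/rowP => k; rewrite !mxE.
under eq_Rintegral do rewrite mxE.
by apply: RintegralD; [exact: D_measurable|exact: coord_integrable|exact: coord_integrable].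
Qed.

(** Multiplication by a quaternion mixes the four coordinates linearly; this lets [qintMl] take it
    out of a coordinatewise integral. *)
Lemma int_lin4 (c : 'I_4 -> R) g : continuous g ->
  \int[mu]_(t in D) (\sum_(j < 4) c j * g t 0 j) = \sum_(j < 4) c j * qint g 0 j.
Proof.
move=> cg.
have h j : mu.-integrable D (EFin \o (fun t => c j * g t 0 j)).
  by apply: cont_integrable => t; apply: cvgM; [exact: cvg_cst|apply: coord_continuousT].
have hc (j : 'I_4) : continuous (fun t => c j * g t 0 j).
  by move=> t; apply: cvgM; [exact: cvg_cst|apply: coord_continuousT].
under eq_Rintegral do rewrite !big_ord_recr big_ord0/= add0r.
rewrite RintegralD//; last first.
  by apply: cont_integrable => t; apply: cvgD; [apply: cvgD|]; exact: hc.
rewrite RintegralD//; last first.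
  by apply: cont_integrable => t; apply: cvgD; exact: hc.
rewrite RintegralD// !RintegralZl//; try exact: coord_integrable.
by rewrite !big_ord_recr big_ord0/= add0r !mxE.
Qed.

Lemma qmul_coord (c q : H) k : (c * q) 0 k = \sum_(j < 4) (c * delta_mx 0 j) 0 k * q 0 j.
Proof.
rewrite {1}(row_sum_delta q) mulr_sumr summxE; apply: eq_bigr => j _.
by rewrite -scalerAr mxE mulrC.
Qed.

Lemma qintMl c g : continuous g -> qint (fun t => c * g t) = c * qint g.
Proof.
move=> cg; apply/rowP => k; rewrite qmul_coord -int_lin4// mxE.
by apply: eq_Rintegral => t _; rewrite qmul_coord.
Qed.

Lemma eq_qint f g : f =1 g -> qint f = qint g.
Proof. by move=> fg; congr qint; apply/funext. Qed.

Lemma continuous_qsum (n : nat) (F : nat -> R -> H) : (forall k, continuous (F k)) ->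
  continuous (fun t => \sum_(k < n) F k t).
Proof.
move=> cF; elim: n => [|n IH].
  have -> : (fun t => \sum_(k < 0) F k t) = (fun=> 0 : H).
    by apply/funext => t; rewrite big_ord0.
  exact: cst_continuous.
have -> : (fun t => \sum_(k < n.+1) F k t) = (fun t => \sum_(k < n) F k t + F n t).
  by apply/funext => t; rewrite big_ord_recr.
by move=> t; apply: cvgD; [exact: IH|exact: cF].
Qed.

Lemma qint_sum (n : nat) (F : nat -> R -> H) : (forall k, continuous (F k)) ->
  qint (fun t => \sum_(k < n) F k t) = \sum_(k < n) qint (F k).
Proof.
move=> cF; elim: n => [|n IH].
  rewrite big_ord0; apply/rowP => k; rewrite !mxE.
  under eq_Rintegral do rewrite big_ord0 mxE.
  by rewrite Rintegral_cst ?mul0r//; exact: D_measurable.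
rewrite big_ord_recr/= -IH -qintD//; last exact: continuous_qsum.
by apply: eq_qint => t; rewrite big_ord_recr.
Qed.

Lemma qint_le g (C : R) : 0 <= C -> continuous g ->
  (forall t, D t -> qabs (g t) <= C) -> qabs (qint g) <= 2 * (C * T).
Proof.
move=> C0 cg gC; apply: qabs_le_coord => k; rewrite mxE.
have cn : continuous (fun t => `|g t 0 k|).
  by move=> t; apply: cvg_norm; apply: coord_continuousT.
apply: le_trans (le_normr_Rintegral D_measurable (coord_integrable _ cg)) _.
rewrite -Rint_cst.
apply: le_Rintegral; [exact: D_measurable|exact: cont_integrable| |].
  by apply: cont_integrable; exact: cst_continuous.
by move=> t Dt; rewrite (le_trans (qabs_coord _ _))// gC.
Qed.

Lemma qint_cst c : qint (fun=> c) = T *: c.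
Proof.
apply/rowP => k; by rewrite !mxE Rint_cst mulrC.
Qed.

Lemma qint_FTC g (G : R -> H) : continuous g -> (forall t, qder G t (g t)) ->
  qint g = G T - G 0.
Proof.
move=> cg hG; apply/rowP => k; rewrite !mxE.
have hk t : is_derive t (1 : R) (fun s => G s 0 k) (g t 0 k) by exact: qder_coord.
have cG : continuous (fun s => G s 0 k).
  by move=> t; apply/differentiable_continuous/derivable1_diffP; case: (hk t).
rewrite /Rintegral (@continuous_FTC2 _ (fun t => g t 0 k) (fun t => G t 0 k))//.
- exact: twopi_gt0.
- by apply: continuous_subspaceT; exact: coord_continuousT.
- split; first by move=> t _; case: (hk t).
  + exact/cvg_at_right_filter/cG.
  + exact/cvg_at_left_filter/cG.
- by move=> t _; rewrite derive1E; case: (hk t).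
Qed.

Lemma qint_cvg (psi : R -> R -> H) (u v r0 : R) (C : R) : u < r0 < v ->
  (forall r, u < r < v -> continuous (psi r)) ->
  (forall t, D t -> forall r, u < r < v -> {for r, continuous (psi ^~ t)}) ->
  (forall r, u < r < v -> forall t, D t -> qabs (psi r t) <= C) ->
  {for r0, continuous (fun r => qint (psi r))}.
Proof.
move=> hr0 c1 c2 hC; apply/cvg_qabsP.
have hk (k : 'I_4) : {for r0, continuous (fun r => qint (psi r) 0 k)}.
  have -> : (fun r => qint (psi r) 0 k) = fun r => \int[mu]_(t in D) (psi r t 0 k).
    by apply/funext => r; rewrite mxE.
  apply: (@continuity_under_integral R _ _ mu (fun r t => psi r t 0 k) D D_measurable u v _ _ (fun=> C)).
  - by move=> r; rewrite /= in_itv/= => /c1 h; apply: coord_integrable.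
  - apply/aeW => t Dt r; rewrite inE/= in_itv/= => hr.
    by apply: cvg_coord; exact: c2.
  - by apply: cont_integrable; exact: cst_continuous.
  - move=> r; rewrite /= in_itv/= => hr; apply/aeW => t Dt.
    by rewrite (le_trans (qabs_coord _ _))// hC.
  - by rewrite inE/= in_itv.
move=> e e0; have e4 : 0 < e / 4 by exact: divr_gt0.
have h k : \forall r \near r0, `|(qint (psi r) - qint (psi r0)) 0 k| <= e / 4.
  move/cvgrPdist_le: (hk k) => /(_ _ e4); apply: filterS => r.
  by rewrite distrC !mxE.
near=> r; apply: (@le_lt_trans _ _ (2 * (e / 4))); last by lra.
apply: qabs_le_coord => k; move: k; near: r; apply: filter_forall => k; exact: h.
Unshelve. all: by end_near. Qed.

Lemma qint_der (psi psi' : R -> R -> H) (u v r0 : R) (C : R) k : u < r0 < v -> 0 <= C ->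
  (forall r, u < r < v -> continuous (psi r)) ->
  (forall t, D t -> forall r, u < r < v -> qder (psi ^~ t) r (psi' r t)) ->
  (forall r, u < r < v -> forall t, D t -> qabs (psi' r t) <= C) ->
  is_derive r0 (1 : R) (fun r => qint (psi r) 0 k) (qint (psi' r0) 0 k).
Proof.
move=> hr0 C0 c1 c2 hC.
have E r t : u < r < v -> D t -> partial1of2 (fun r t => psi r t 0 k) r t = psi' r t 0 k.
  move=> hr Dt; rewrite partial1of2E.
  by have [] := qder_coord k (c2 t Dt r hr).
apply: is_derive_cvg.
have := @cvg_differentiation_under_integral R _ _ mu (fun r t => psi r t 0 k) D D_measurable r0 u v _ _ _ (fun=> C).
rewrite /= in_itv/= => /(_ hr0) h.
have -> : qint (psi' r0) 0 k = \int[mu]_(t in D) partial1of2 (fun r t => psi r t 0 k) r0 t.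
  by rewrite mxE; apply: eq_Rintegral => t; rewrite inE => Dt; rewrite E.
have : h^-1 *: (\int[mu]_(y in D) psi (h + r0) y 0 k - \int[mu]_(y in D) psi r0 y 0 k)
  @[h --> (0:R)^'] --> \int[mu]_(t in D) partial1of2 (fun r t => psi r t 0 k) r0 t.
  apply: h => //.
  - by move=> r; rewrite in_itv/= => /c1 h; apply: coord_integrable.
  - by move=> r t; rewrite in_itv/= => hr Dt; have [] := qder_coord k (c2 t Dt r hr).
  - by apply: cont_integrable; exact: cst_continuous.
  - move=> r t; rewrite in_itv/= => hr Dt; rewrite E//.
    by rewrite (le_trans (qabs_coord _ _))// hC.
apply: cvg_trans; apply: near_eq_cvg; apply: nearW => h0.
by rewrite !mxE -[h0 *: 1]/(h0 * 1) mulr1.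
Qed.

End CircleIntegral.

(** * Cauchy's theorem for concentric circles *)

Section Circles.
Variable R : realType.
Local Notation H := (quat R).
Local Notation SS := (@imag_units R).
Local Notation T := (pi *+ 2 : R).
Local Notation D := (`[0, T]%classic : set R).
Variables (I p : H).
Hypotheses (SI : SS I) (Ip : cline I p).
Implicit Types (psi dpsi : H -> H) (r t u v : R) (w : H).

Definition circ r t : H := p + r *: qcircle I t.

Lemma qabs_circle t : qabs (qcircle I t) = 1.
Proof. by rewrite /qcircle qabs_cpoint// cos2Dsin2 sqrtr1. Qed.
Lemma circle_cline t : cline I (qcircle I t). Proof. exact: cline_cpoint. Qed.
Lemma circ_cline r t : cline I (circ r t).
Proof. by apply: clineD => //; apply: clineZ => //; exact: circle_cline. Qed.
Lemma circB r t : circ r t - p = r *: qcircle I t.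
Proof. by rewrite /circ addrAC subrr add0r. Qed.
Lemma qabs_circ r t : qabs (circ r t - p) = `|r|.
Proof. by rewrite circB qabsZ qabs_circle mulr1. Qed.

Lemma circ_der_t r t : qder (circ r) t (I * (r *: qcircle I t)).
Proof.
rewrite -[X in qder _ _ X]add0r; apply: qderD; first exact: qder_cst.
have := qderMl (c := r *: 1) (qcircle_der (t := t) SI).
rewrite -scalerAl mul1r scalerAr.
by under eq_fun do rewrite -scalerAl mul1r.
Qed.
Lemma circ_der_r r t : qder (circ ^~ t) r (qcircle I t).
Proof.
rewrite -[X in qder _ _ X]add0r; apply: qderD; first exact: qder_cst.
by rewrite -[X in qder _ _ X]scale1r; apply: (@qderZ _ id); exact: is_derive_id.
Qed.

Lemma circ_continuous_t r : continuous (circ r).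
Proof. by move=> t; apply: qder_continuous; exact: circ_der_t. Qed.
Lemma circ_continuous_r t : continuous (circ ^~ t).
Proof. by move=> r; apply: qder_continuous; exact: circ_der_r. Qed.
Lemma circle_continuous : continuous (qcircle I).
Proof. by move=> t; apply: qder_continuous; exact: qcircle_der. Qed.

Lemma circ_continuous2 : continuous (fun x : R * R => circ x.1 x.2).
Proof.
move=> x; apply: cvgD; first exact: cvg_cst.
have -> : (fun x : R * R => x.1 *: qcircle I x.2) = (fun x => (x.1 *: 1) * qcircle I x.2).
  by apply/funext => y; rewrite -scalerAl mul1r.
have -> : x.1 *: qcircle I x.2 = (x.1 *: 1) * qcircle I x.2 by rewrite -scalerAl mul1r.
have c1 : y.1 @[y --> x] --> x.1 by exact: cvg_fst.
apply: cvgqM.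
  apply: (@cvg_qabs_squeeze _ _ _ _ _ _ (fun y : R * R => `|y.1 - x.1|)).
    by apply: nearW => y; rewrite -scalerBl qabsZ qabs1 mulr1.
  have h2 : `|y.1 - x.1| @[y --> x] --> `|x.1 - x.1|.
    by apply: cvg_norm; apply: cvgB => //; exact: cvg_cst.
  by rewrite subrr normr0 in h2.
by apply: (@cvg_comp _ _ _ snd (qcircle I)); [exact: cvg_snd|exact: circle_continuous].
Qed.

Lemma cvg_into_sln (U : Type) (F : set_system U) (FF : Filter F) (g : U -> H) w :
  (forall x, cline I (g x)) -> g @ F --> w -> g @ F --> sln I w.
Proof.
move=> gI gw A; rewrite /sln /within/= -/(nbhs w _) => /gw.
rewrite /nbhs/=; apply: filterS => x; apply; exact: gI.
Qed.

Definition annul_cont (P : R -> Prop) psi :=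
  forall w, cline I w -> P (qabs (w - p)) -> psi v @[v --> sln I w] --> psi w.

Lemma psi_circ_continuous_t P psi r : annul_cont P psi -> P `|r| ->
  continuous (fun t => psi (circ r t)).
Proof.
move=> h Pr t; apply: (@cvg_comp _ _ _ (circ r) psi); last first.
  by apply: h; [exact: circ_cline|rewrite qabs_circ].
by apply: cvg_into_sln => [t'|]; [exact: circ_cline|exact: circ_continuous_t].
Qed.
Lemma psi_circ_continuous_r P psi r t : annul_cont P psi -> P `|r| ->
  {for r, continuous (fun r => psi (circ r t))}.
Proof.
move=> h Pr; apply: (@cvg_comp _ _ _ (circ ^~ t) psi); last first.
  by apply: h; [exact: circ_cline|rewrite qabs_circ].
by apply: cvg_into_sln => [t'|]; [exact: circ_cline|exact: circ_continuous_r].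
Qed.

(** Compactness of the parameter rectangle gives the constants that dominate the integrals below. *)
Lemma annul_bound psi u v : 0 <= u -> annul_cont (fun r => u <= r <= v) psi ->
  exists2 M, 0 <= M & forall r t, u <= r <= v -> D t -> qabs (psi (circ r t)) <= M.
Proof.
move=> u0 h; pose A := `[u, v]%classic `*` D.
have cA : compact A by apply: compact_setX; exact: segment_compact.
have cg : {within A, continuous (fun x : R * R => qabs (psi (circ x.1 x.2)) : R^o)}.
  apply: continuous_in_subspaceT => x; rewrite inE => -[/=].
  rewrite in_itv/= => /andP[ux xv] _; apply: cvg_qabs.
  apply: (@cvg_comp _ _ _ (fun x : R * R => circ x.1 x.2) psi); last first.
    apply: h; first exact: circ_cline.
    by rewrite qabs_circ ger0_norm ?ux// (le_trans u0).
  by apply: cvg_into_sln => [y|]; [exact: circ_cline|exact: circ_continuous2].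
have /compact_bounded[M [_ hM]] := continuous_compact cg cA.
exists (`|M| + 1) => [|r t uv Dt]; first by rewrite addr_ge0.
have /hM/(_ (qabs (psi (circ r t)))) : M < `|M| + 1.
  by rewrite (le_lt_trans (ler_norm _))// ltrDl.
move=> h1; have {h1} : `|qabs (psi (circ r t))| <= `|M| + 1.
  by apply: h1; exists (r, t) => //; split.
by rewrite ger0_norm ?qabs_ge0.
Qed.

(** Since dw = I r e^{It} dt, this is - I times the contour integral of dw psi(w) over the circle of
    radius r. *)
Definition circ_int psi r : H := qint (fun t => (r *: qcircle I t) * psi (circ r t)).

(* The integrand is [- I] times the angular derivative of [e^{It} psi(p + r e^{It})] once
   differentiated with respect to [r]: this is Cauchy's theorem for circles. *)
Lemma circ_int_der psi dpsi (a b r : R) k : 0 <= a -> a < r < b ->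
  (forall w, cline I w -> a < qabs (w - p) < b -> cderiv I psi w (dpsi w)) ->
  annul_cont (fun r => a < r < b) dpsi ->
  is_derive r (1 : R) (fun r => circ_int psi r 0 k) 0.
Proof.
move=> a0 /andP[ar rb] hd cd.
(* Midpoints: the closed annulus between [u] and [v] lies in the open one, so the functions are
   bounded on it. *)
pose u := (a + r) / 2; pose v := (r + b) / 2.
have [au ur rv vb] : [/\ a < u, u < r, r < v & v < b] by rewrite /u /v; split; lra.
have u0 : 0 <= u by rewrite (le_trans a0)// ltW.
have cp : annul_cont (fun r => a < r < b) psi.
  by move=> w Iw hw; apply: cderiv_cvg (hd w Iw hw).
pose E s t := psi (circ s t) + (s *: qcircle I t) * dpsi (circ s t).
have iP s : u < s < v -> a < `|s| < b.
  move=> /andP[us sv]; rewrite ger0_norm ?(le_trans u0 (ltW us))//.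
  by rewrite (lt_trans au us) (lt_trans sv vb).
pose Psi s t := qcircle I t * E s t.
have [M1 M10 hM1] : exists2 M, 0 <= M & forall r t, u <= r <= v -> D t -> qabs (psi (circ r t)) <= M.
  apply: annul_bound => // w Iw /andP[h1 h2]; apply: cp => //.
  by rewrite (lt_le_trans au h1) (le_lt_trans h2 vb).
have [M2 M20 hM2] : exists2 M, 0 <= M & forall r t, u <= r <= v -> D t -> qabs (dpsi (circ r t)) <= M.
  apply: annul_bound => // w Iw /andP[h1 h2]; apply: cd => //.
  by rewrite (lt_le_trans au h1) (le_lt_trans h2 vb).
have cPsi s : u < s < v -> continuous (Psi s).
  move=> hs t; apply: cvgqM; first exact: circle_continuous.
  apply: cvgD; first exact: (psi_circ_continuous_t cp (iP _ hs)).
  apply: cvgqM; last exact: (psi_circ_continuous_t cd (iP _ hs)).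
  by apply: cvgqZ; exact: circle_continuous.
have -> : 0 = qint (Psi r) 0 k.
  have hr : u < r < v by rewrite ur.
  have e1 : qint (fun t => I * Psi r t) = I * qint (Psi r) by apply: qintMl; exact: cPsi.
  have e2 : qint (fun t => I * Psi r t) = 0.
    rewrite (@qint_FTC _ _ (fun t => qcircle I t * psi (circ r t))).
    - by rewrite /circ /qcircle cos2pi sin2pi cos0 sin0 subrr.
    - by move=> t; apply: cvgqM; [exact: cvg_cst|exact: cPsi].
    move=> t; have -> : I * Psi r t = I * qcircle I t * psi (circ r t) +
        qcircle I t * (I * (r *: qcircle I t) * dpsi (circ r t)).
      rewrite /Psi /E; move: (circle_cline t) (psi _) (dpsi _).
      move: (qcircle I t) => c cI A B.
      by rewrite !mulrDr !mulrA (cline_comm SI (clineI SI) cI).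
    apply: qderM; first exact: qcircle_der.
    apply: (qder_comp (I := I)); [by move=> s; exact: circ_cline| |exact: circ_der_t].
    by apply: hd; [exact: circ_cline|rewrite qabs_circ; exact: iP].
  have : qint (Psi r) = 0 by apply: (mulqI (SS_neq0 SI)); rewrite -e1 e2 mulr0.
  by move=> ->; rewrite mxE.
apply: (@qint_der _ (fun s t => (s *: qcircle I t) * psi (circ s t)) Psi u v r (M1 + v * M2)).
- by rewrite ur.
- by rewrite addr_ge0// mulr_ge0// (le_trans u0)// ltW// (lt_trans ur).
- move=> s hs t; apply: cvgqM; last exact: (psi_circ_continuous_t cp (iP _ hs)).
  by apply: cvgqZ; exact: circle_continuous.
- move=> t Dt s hs.
  have -> : Psi s t = qcircle I t * psi (circ s t) +
      (s *: qcircle I t) * (qcircle I t * dpsi (circ s t)).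
    by rewrite /Psi /E mulrDr -!scalerAl !scalerAr.
  apply: qderM.
    rewrite -[X in qder _ _ X]scale1r; apply: (@qderZ _ id); exact: is_derive_id.
  apply: (qder_comp (I := I)); [by move=> s'; exact: circ_cline| |exact: circ_der_r].
  by apply: hd; [exact: circ_cline|rewrite qabs_circ; exact: iP].
- move=> s /andP[us sv] t Dt; rewrite /Psi qabsM qabs_circle mul1r.
  have hs : u <= s <= v by rewrite !ltW.
  rewrite (le_trans (qabsD _ _))// lerD ?hM1// qabsM qabsZ qabs_circle mulr1.
  have s0 : 0 <= s by rewrite (le_trans u0)// ltW.
  by rewrite ger0_norm// ler_pM ?qabs_ge0 ?hM2// ltW.
Qed.

(** Allows [circ_int_diff_quot0] to cross a circle on which the integrand is merely known to be
    continuous. *)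
Lemma circ_int_continuous psi (a b r : R) : 0 <= a -> a < r < b ->
  annul_cont (fun r => a < r < b) psi -> {for r, continuous (circ_int psi)}.
Proof.
move=> a0 /andP[ar rb] cp.
pose u := (a + r) / 2; pose v := (r + b) / 2.
have [au ur rv vb] : [/\ a < u, u < r, r < v & v < b] by rewrite /u /v; split; lra.
have u0 : 0 <= u by rewrite (le_trans a0)// ltW.
have iP s : u < s < v -> a < `|s| < b.
  move=> /andP[us sv]; rewrite ger0_norm ?(le_trans u0 (ltW us))//.
  by rewrite (lt_trans au us) (lt_trans sv vb).
have [M1 M10 hM1] : exists2 M, 0 <= M & forall r t, u <= r <= v -> D t -> qabs (psi (circ r t)) <= M.
  apply: annul_bound => // w Iw /andP[h1 h2]; apply: cp => //.
  by rewrite (lt_le_trans au h1) (le_lt_trans h2 vb).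
apply: (@qint_cvg _ (fun s t => (s *: qcircle I t) * psi (circ s t)) u v r (v * M1)).
- by rewrite ur.
- move=> s hs t; apply: cvgqM; last exact: (psi_circ_continuous_t cp (iP _ hs)).
  by apply: cvgqZ; exact: circle_continuous.
- move=> t Dt s hs; apply: cvgqM; last exact: (psi_circ_continuous_r cp (iP _ hs)).
  have : qder (fun s : R => s *: qcircle I t) s (1 *: qcircle I t).
    by apply: (@qderZ _ id); exact: is_derive_id.
  by move=> /qder_continuous; exact.
- move=> s /andP[us sv] t Dt.
  have hs : u <= s <= v by rewrite !ltW.
  rewrite qabsM qabsZ qabs_circle mulr1.
  have s0 : 0 <= s by rewrite (le_trans u0)// ltW.
  by rewrite ger0_norm// ler_pM ?qabs_ge0 ?hM1// ltW.
Qed.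

End Circles.

(** * Power series of bounded holomorphic functions *)

Section LaurentBounded.
Variable R : realType.
Local Notation H := (quat R).
Local Notation SS := (@imag_units R).
Local Notation T := (pi *+ 2 : R).
Local Notation D := (`[0, T]%classic : set R).

Lemma open_qabsP (A : set H) : open A <->
  forall z, A z -> exists2 e : R, 0 < e & forall w, qabs (w - z) < e -> A w.
Proof.
split=> [oA z Az|h]; first by apply/nbhs_qabsP; exact: open_nbhs_nbhs.
by rewrite openE => z /h /nbhs_qabsP.
Qed.

(** A punctured ball of H; its trace on a line through [p] is a punctured disc. *)
Definition pdisc (p : H) (rho : R) : set H := [set w | 0 < qabs (w - p) < rho].

Lemma open_pdisc p rho : open (pdisc p rho).
Proof.
apply/open_qabsP => z /andP[z0 zr].
exists (Num.min (qabs (z - p)) (rho - qabs (z - p))); first by rewrite lt_min z0 subr_gt0.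
move=> w; rewrite lt_min => /andP[w1 w2]; rewrite /pdisc/=; apply/andP; split.
  by have := qabs_tri z w p; rewrite (qabsBC z w); lra.
have := qabs_tri w z p; lra.
Qed.

Section Fix.
Variables (I p : H) (f : H -> H) (rho C : R).
Hypotheses (SI : SS I) (Ip : cline I p) (rho0 : 0 < rho).
Hypothesis hf : holo I (pdisc p rho) f.
Hypothesis fC : forall w, cline I w -> pdisc p rho w -> qabs (f w) <= C.

Let b := rho / 2.
Let b0 : 0 < b. Proof. exact: divr_gt0. Qed.
Let brho : b < rho. Proof. by rewrite /b ltr_pdivrMr// ltr_pMr// ltr1n. Qed.

Lemma bound_ge0 : 0 <= C.
Proof.
apply: le_trans (fC (w := circ I p b 0) _ _); [exact: qabs_ge0|exact: circ_cline|].
by rewrite /pdisc/= qabs_circ// gtr0_norm// b0.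
Qed.

Section FixZ.
Variable z : H.
Hypotheses (Iz : cline I z) (zp : 0 < qabs (z - p)) (zb : qabs (z - p) < b).

Let zd : pdisc p rho z. Proof. by rewrite /pdisc/= zp (lt_trans zb). Qed.

(** [h] is the difference quotient of [f] at [z], completed at [z] by the derivative of [f], which
    makes it continuous there. *)
Lemma diff_quot_facts : exists h dh : H -> H,
  [/\ forall w, w != z -> h w = (w - z)^-1 * (f w - f z),
      annul_cont I p (fun r => 0 < r < rho) h,
      forall w, cline I w -> pdisc p rho w -> w != z -> cderiv I h w (dh w)
    & forall w, cline I w -> pdisc p rho w -> w != z -> dh v @[v --> sln I w] --> dh w].
Proof.
have [d hd] := hf; have [[phi [pz pd fE]] _] := hd z zd Iz.
pose g w := (w - z)^-1 * (f w - f z).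
pose h w := if w == z then d z else g w.
pose V := pdisc p rho `\ z.
have oV : open V.
  apply/open_qabsP => w [dw /= wz].
  have [e e0 he] := (open_qabsP _).1 (@open_pdisc p rho) w dw.
  exists (Num.min e (qabs (w - z))); first by rewrite lt_min e0 qabs_gt0 subr_eq0; exact/eqP.
  move=> v; rewrite lt_min => /andP[/he hv vw]; split => //= vz.
  by move: vw; rewrite vz qabsBC ltxx.
have [dh hdh] : holo I V g.
  apply: holoM => //.
  - by move=> w _ Iw; apply: clineV => //; exact: clineB.
  - apply: holoV => //.
    + by move=> w _ Iw; exact: clineB.
    + by move=> w [_ /= wz] _; rewrite subr_eq0; exact/eqP.
    + by apply: holoB => //; [exact: holo_id|exact: holo_cst].
  - apply: holoB => //; last exact: holo_cst.
    by apply: holoW hf => w [].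
have hg w : V w -> cline I w -> \forall v \near sln I w, g v = h v.
  move=> Vw Iw; have := sln_open I oV Vw; apply: filterS => v [_ /= vz].
  by rewrite /h; case: eqP.
have hh w : cline I w -> pdisc p rho w -> w != z -> cderiv I h w (dh w).
  move=> Iw dw wz; have Vw : V w by split=> //; exact/eqP.
  by apply: cderiv_congr (hdh w Vw Iw).1 => //; exact: hg.
exists h, dh; split=> //.
- by move=> w /negbTE wz; rewrite /h wz.
- move=> w Iw dw; have [->|wz] := eqVneq w z; last exact: cderiv_cvg (hh _ Iw dw wz).
  rewrite {2}/h eqxx; move: pd; apply: cvg_trans; apply: near_eq_cvg.
  near=> v; rewrite /h; case: eqVneq => [->|vz]; first by rewrite pz.
  have e : f v = f z + (v - z) * phi v by near: v.
  by rewrite /g e addrAC subrr add0r mulrA mulVq ?mul1r// subr_eq0.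
- move=> w Iw dw wz; have Vw : V w by split=> //; exact/eqP.
  exact: (hdh w Vw Iw).2.
Unshelve. all: by end_near. Qed.

(** The integral is constant for radii below m = |z - p| and for radii above it, and continuous at
    m, hence the same on both sides. It tends to 0 with the radius, because the integrand stays
    bounded apart from the factor r. *)
Lemma circ_int_diff_quot0 (h dh : H -> H) :
  (forall w, w != z -> h w = (w - z)^-1 * (f w - f z)) ->
  annul_cont I p (fun r => 0 < r < rho) h ->
  (forall w, cline I w -> pdisc p rho w -> w != z -> cderiv I h w (dh w)) ->
  (forall w, cline I w -> pdisc p rho w -> w != z -> dh v @[v --> sln I w] --> dh w) ->
  circ_int I p h b = 0.
Proof.
move=> hE hc hd hdc; pose m := qabs (z - p).
have cJ (r : R) k : 0 < r < rho -> {for r, continuous (fun r => circ_int I p h r 0 k)}.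
  move=> hr; have cr := circ_int_continuous SI Ip (lexx 0) hr hc.
  by apply: cvg_coord; exact: cr.
have ne w : qabs (w - p) != m -> w != z by apply: contra_neq => ->.
have dJ1 (r : R) k : 0 < r < m -> is_derive r (1 : R) (fun r => circ_int I p h r 0 k) 0.
  move=> hr; apply: (@circ_int_der R I p SI Ip h dh 0 m r k (lexx 0) hr).
    move=> w Iw /andP[w0 wm]; apply: hd => //; last by apply: ne; rewrite lt_eqF.
    by rewrite /pdisc/= w0 (lt_trans wm (lt_trans zb brho)).
  move=> w Iw /andP[w0 wm]; apply: hdc => //; last by apply: ne; rewrite lt_eqF.
  by rewrite /pdisc/= w0 (lt_trans wm (lt_trans zb brho)).
have dJ2 (r : R) k : m < r < rho -> is_derive r (1 : R) (fun r => circ_int I p h r 0 k) 0.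
  move=> hr; apply: (@circ_int_der R I p SI Ip h dh m rho r k (ltW zp) hr).
    move=> w Iw /andP[w0 wm]; apply: hd => //; last by apply: ne; rewrite gt_eqF.
    by rewrite /pdisc/= wm (lt_trans zp w0).
  move=> w Iw /andP[w0 wm]; apply: hdc => //; last by apply: ne; rewrite gt_eqF.
  by rewrite /pdisc/= wm (lt_trans zp w0).
have J1 a k : 0 < a < m -> circ_int I p h a 0 k = circ_int I p h m 0 k.
  move=> /andP[a0 am]; apply/esym/subr0_eq.
  have [||c _ ->] := @MVT_segment R (fun r => circ_int I p h r 0 k) (fun=> 0) a m (ltW am).
  - by move=> x; rewrite in_itv/= => /andP[ax xm]; apply: dJ1; rewrite xm (lt_trans a0).
  - apply: continuous_in_subspaceT => x; rewrite inE/= in_itv/= => /andP[ax xm].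
    by apply: cJ; rewrite (lt_le_trans a0)// (le_lt_trans xm)// (lt_trans zb).
  - by rewrite mul0r.
have J2 k : circ_int I p h b 0 k = circ_int I p h m 0 k.
  apply/subr0_eq.
  have [||c _ ->] := @MVT_segment R (fun r => circ_int I p h r 0 k) (fun=> 0) m b (ltW zb).
  - by move=> x; rewrite in_itv/= => /andP[ax xm]; apply: dJ2; rewrite ax (lt_trans xm).
  - apply: continuous_in_subspaceT => x; rewrite inE/= in_itv/= => /andP[ax xm].
    by apply: cJ; rewrite (lt_le_trans zp)// (le_lt_trans xm).
  - by rewrite mul0r.
have C0 := bound_ge0.
have T0 : 0 <= T by exact/ltW/twopi_gt0.
have m2 : 0 <= (m / 2)^-1 by rewrite invr_ge0 divr_ge0// ltW.
(* For |w - p| <= m / 2 the quotient is at most (C + C) / (m / 2); the outer 2 comes from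
   [qint_le]. *)
pose K := 2 * ((m / 2)^-1 * (C + C) * T).
have K0 : 0 <= K.
  by apply: mulr_ge0 => //; apply: mulr_ge0 => //; apply: mulr_ge0 => //; exact: addr_ge0.
have small a : 0 < a <= m / 2 -> qabs (circ_int I p h a) <= a * K.
  move=> /andP[a0 am]; have am' : a < m by rewrite (le_lt_trans am)// ltr_pdivrMr// ltr_pMr// ltr1n.
  have ar : a < rho by rewrite (lt_trans am')// (lt_trans zb).
  have -> : a * K = 2 * (a * ((m / 2)^-1 * (C + C)) * T) by rewrite /K; ring.
  apply: qint_le.
  - by apply: mulr_ge0; [exact: ltW|apply: mulr_ge0 => //; exact: addr_ge0].
  - move=> t; apply: cvgqM; first by apply: cvgqZ; exact: circle_continuous.
    by apply: (psi_circ_continuous_t SI Ip hc); rewrite gtr0_norm// a0.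
  move=> t Dt; rewrite qabsM qabsZ qabs_circle// mulr1 gtr0_norm//.
  have wa : qabs (circ I p a t - p) = a by rewrite qabs_circ// gtr0_norm.
  rewrite ler_pM2l// hE; last by apply: ne; rewrite wa lt_eqF.
  have wz : m / 2 <= qabs (circ I p a t - z).
    by have := qabs_tri z (circ I p a t) p; rewrite wa -/m (qabsBC z); move: am; lra.
  rewrite qabsM qabsV ler_pM ?invr_ge0 ?qabs_ge0//.
    by rewrite lef_pV2 ?posrE// ?divr_gt0// (lt_le_trans _ wz)// divr_gt0.
  rewrite (le_trans (qabsB _ _))// lerD// fC//; first exact: circ_cline.
  by rewrite /pdisc/= wa a0.
apply/rowP => k; transitivity (0 : R); last by rewrite mxE.
apply/eqP; rewrite -normr_le0; apply/ler_addgt0Pl => e e0; rewrite addr0.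
(* [K + 1] instead of [K] avoids a division by zero. *)
pose a := Num.min (m / 2) (e / (K + 1)).
have K1 : 0 < K + 1 by rewrite ltr_wpDl.
have a0 : 0 < a by rewrite lt_min !divr_gt0.
have am : a <= m / 2 by rewrite ge_min lexx.
rewrite J2 -(J1 a); last by rewrite a0 (le_lt_trans am)// ltr_pdivrMr// ltr_pMr// ltr1n.
rewrite (le_trans (qabs_coord _ _))// (le_trans (small a _))//; first by rewrite a0.
have ae : a <= e / (K + 1) by rewrite ge_min lexx orbT.
rewrite (@le_trans _ _ (e / (K + 1) * K)) ?ler_wpM2r//.
by rewrite mulrAC ler_pdivrMr// ler_wpM2l ?(ltW e0)// lerDl.
Qed.

End FixZ.

(** The inverse of b e^{It}, see [ci_inv], written through the conjugate so that its derivative in t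
    is immediate. *)
Let ci t : H := b^-1 *: qconj (qcircle I t).

Lemma ci_inv t : ci t = (b *: qcircle I t)^-1.
Proof.
have q0 : b *: qcircle I t != 0 by rewrite -qabs_gt0 qabsZ qabs_circle// mulr1 gtr0_norm.
apply: (mulqI q0); rewrite mulqV// /ci -scalerAl -scalerAr scalerA mulfV ?gt_eqF// scale1r.
by rewrite qmul_conj -qabs_sqr qabs_circle// expr1n scale1r.
Qed.

Lemma ci_cline t : cline I (ci t).
Proof. by apply: clineZ => //; apply: cline_conj => //; exact: circle_cline. Qed.

Lemma ci_der t : qder ci t (- (I * ci t)).
Proof.
have -> : ci = fun t => (b^-1 *: 1) * (cos t *: 1 + (- sin t) *: I).
  by apply/funext => s; rewrite /ci /qcircle cpoint_conj// -scalerAl mul1r.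
have -> : - (I * ((b^-1 *: 1) * (cos t *: 1 + (- sin t) *: I))) =
    (b^-1 *: 1) * ((- sin t) *: 1 + (- cos t) *: I).
  rewrite -!scalerAl !mul1r -scalerAr -scalerN; congr (_ *: _).
  rewrite mulrDr -!scalerAr mulr1 (SSsqr SI) scalerN scaleNr opprK opprD addrC.
  by rewrite !scaleNr.
by apply: qderMl; apply: qderD; apply: qderZ.
Qed.

Lemma ci_der_pow t n : qder (fun s => ci s ^+ n) t (- (n%:R *: (I * ci t ^+ n))).
Proof.
elim: n => [|n IH].
  by rewrite scale0r oppr0; exact: (qder_cst 1).
have -> : (fun s => ci s ^+ n.+1) = (fun s => ci s * ci s ^+ n).
  by apply/funext => s; rewrite exprS.
have := qderM (@ci_der t) IH; congr (qder _ _ _).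
move: (ci t) (@ci_cline t) => c cI.
rewrite mulrN -scalerAr mulrA (cline_comm SI cI (clineI SI)) mulNr -mulrA -exprS.
by rewrite -opprD -[X in X + _]scale1r -scalerDl -mulrS.
Qed.

Lemma ci_pow_continuous n : continuous (fun t => ci t ^+ n).
Proof. by move=> t; apply: qder_continuous; exact: ci_der_pow. Qed.

Lemma ci_period n : ci T ^+ n = ci 0 ^+ n.
Proof. by rewrite /ci /qcircle cos2pi sin2pi cos0 sin0. Qed.

Lemma qint_ci_pow n c : qint (fun t => ci t ^+ n * c) = if n == 0 then T *: c else 0.
Proof.
case: eqP => [->|/eqP n0].
  by under eq_qint do rewrite expr0 mul1r; exact: qint_cst.
have nR : n%:R != 0 :> R by rewrite pnatr_eq0.
(* The derivative of ci^n is - n I ci^n, so multiplying by I / n gives a periodic primitive. *)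
rewrite (@qint_FTC _ _ (fun t => (n%:R^-1 *: I) * (ci t ^+ n * c))).
- by rewrite ci_period subrr.
- by move=> t; apply: cvgqM; [exact: ci_pow_continuous|exact: cvg_cst].
move=> t; have -> : ci t ^+ n * c = (n%:R^-1 *: I) * (- (n%:R *: (I * ci t ^+ n)) * c).
  move: (ci t ^+ n) => x; rewrite mulNr -!scalerAl mulrN -scalerAr scalerN scalerA.
  by rewrite mulVf// scale1r -[I * x * c]mulrA SSK// opprK.
by apply: qderMl; apply: qderMr; exact: ci_der_pow.
Qed.

(** The hypothesis says that X = (1 - y)^-1; the geometric series is kept finite, with its exact
    remainder. *)
Lemma geometric_sum (y X : H) n : X = 1 + y * X ->
  X = (\sum_(k < n) y ^+ k) + y ^+ n * X.
Proof.
move=> hX; elim: n => [|n IH]; first by rewrite big_ord0 add0r expr0 mul1r.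
rewrite {1}IH big_ord_recr/= -addrA; congr (_ + _).
by rewrite {1}hX mulrDr mulr1 mulrA exprSr.
Qed.

Lemma f_circ_continuous : continuous (fun t => f (circ I p b t)).
Proof.
apply: (@psi_circ_continuous_t _ _ _ SI Ip (fun r => 0 < r < rho)).
  by move=> w Iw hw; exact: holo_cvg hf _ Iw.
by rewrite gtr0_norm// b0.
Qed.

(** The coefficients are Cauchy's. The integral of X (f(w) - f(z)) with X = (w - p) (w - z)^-1
    vanishes, and X is expanded in powers of (z - p) (w - p)^-1 on the circle of radius b = rho / 2.
    For |z - p| <= b / 2 the kernel X is bounded by 2. *)
Lemma bounded_power_series : exists a : nat -> H, forall z n, cline I z ->
  0 < qabs (z - p) <= rho / 4 ->
  qabs (f z - \sum_(k < n.+1) (z - p) ^+ k * a k) <= 8 * C * (qabs (z - p) / (rho / 2)) ^+ n.+1.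
Proof.
exists (fun k => T^-1 *: qint (fun t => ci t ^+ k * f (circ I p b t))) => z n Iz /andP[zp z4].
pose m := qabs (z - p); pose zeta := z - p.
have mb2 : m <= b / 2 by rewrite (le_trans z4)// /b; lra.
have mb : m < b by rewrite (le_lt_trans mb2)// ltr_pdivrMr// ltr_pMr// ltr1n.
have C0 := bound_ge0.
have T0 := twopi_gt0 R; have Tn0 : T != 0 by rewrite gt_eqF.
have [h [dh [hE hc hd hdc]]] := diff_quot_facts Iz zp mb.
have J0 := circ_int_diff_quot0 Iz zp mb hE hc hd hdc.
pose c t := b *: qcircle I t.
have cab t : qabs (c t) = b by rewrite qabsZ qabs_circle// mulr1 gtr0_norm.
have cz t : circ I p b t - z = c t - zeta by rewrite /circ /zeta opprB addrA (addrC p).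
have cz_ge t : b / 2 <= qabs (c t - zeta).
  by have := qabs_sub (c t) zeta; rewrite cab -/m; move: mb2; lra.
have cz0 t : c t - zeta != 0 by rewrite -qabs_gt0 (lt_le_trans _ (cz_ge t))// divr_gt0.
pose X t := c t * (c t - zeta)^-1.
have Iz' : cline I zeta by exact: clineB.
have Ic t : cline I (c t) by apply: clineZ => //; exact: circle_cline.
have hX t : X t = 1 + (zeta * ci t) * X t.
  rewrite /X ci_inv -/(c t) mulrA -[zeta * _ * _]mulrA mulVq ?mulr1; last first.
    by rewrite -qabs_gt0 cab.
  by rewrite -(mulqV (cz0 t)) -mulrDl subrK.
pose F t := f (circ I p b t) - f z.
have cF : continuous F by move=> t; apply: cvgB; [exact: f_circ_continuous|exact: cvg_cst].
have cc : continuous c by move=> t; apply: cvgqZ; exact: circle_continuous.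
have cX : continuous X.
  move=> t; apply: cvgqM; first exact: cc.
  by apply: cvgqV => //; apply: cvgqB; [exact: cc|exact: cvg_cst].
have JX : circ_int I p h b = qint (fun t => X t * F t).
  apply: eq_qint => t; rewrite hE; first by rewrite mulrA cz.
  by rewrite -subr_eq0 cz.
pose Rem := qint (fun t => (ci t ^+ n.+1 * X t) * F t).
have cRem : continuous (fun t => (ci t ^+ n.+1 * X t) * F t).
  by move=> t; apply: cvgqM; [apply: cvgqM; [exact: ci_pow_continuous|exact: cX]|exact: cF].
have cT k : continuous (fun t => ci t ^+ k * F t).
  by move=> t; apply: cvgqM; [exact: ci_pow_continuous|exact: cF].
have split : qint (fun t => X t * F t) =
    (\sum_(k < n.+1) zeta ^+ k * qint (fun t => ci t ^+ k * F t)) + zeta ^+ n.+1 * Rem.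
  rewrite /Rem -qintMl//.
  transitivity (qint (fun t => (\sum_(k < n.+1) zeta ^+ k * (ci t ^+ k * F t)) +
      zeta ^+ n.+1 * (ci t ^+ n.+1 * X t * F t))).
    apply: eq_qint => t; rewrite {1}(geometric_sum n.+1 (hX t)) mulrDl mulr_suml; congr (_ + _).
      apply: eq_bigr => k _; rewrite exprMn_comm ?mulrA//.
      exact: (cline_comm SI Iz' (ci_cline t)).
    rewrite exprMn_comm ?mulrA//; exact: (cline_comm SI Iz' (ci_cline t)).
  rewrite qintD; first congr (_ + _).
  - rewrite (@qint_sum _ _ (fun k t => zeta ^+ k * (ci t ^+ k * F t))).
      by apply: eq_bigr => k _; apply: qintMl; exact: cT.
    by move=> k t; apply: cvgqM; [exact: cvg_cst|exact: cT].
  - apply: (@continuous_qsum _ n.+1 (fun k t => zeta ^+ k * (ci t ^+ k * F t))) => k t.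
    by apply: cvgqM; [exact: cvg_cst|exact: cT].
  - by move=> t; apply: cvgqM; [exact: cvg_cst|exact: cRem].
(* The constant f(z) contributes to the coefficient of order 0 only, since the other powers of [ci]
   have zero mean. *)
have coef (k : nat) : qint (fun t => ci t ^+ k * F t) =
    qint (fun t => ci t ^+ k * f (circ I p b t)) - (if k == 0 then T *: f z else 0).
  rewrite -qint_ci_pow -[- qint _]mulN1r -qintMl; last first.
    by move=> t; apply: cvgqM; [exact: ci_pow_continuous|exact: cvg_cst].
  rewrite -qintD.
  - by apply: eq_qint => t; rewrite mulN1r -mulrBr.
  - by move=> t; apply: cvgqM; [exact: ci_pow_continuous|exact: f_circ_continuous].
  - move=> t; apply: cvgqM; first exact: cvg_cst.
    by apply: cvgqM; [exact: ci_pow_continuous|exact: cvg_cst].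
pose A k := qint (fun t => ci t ^+ k * f (circ I p b t)).
have key : f z - \sum_(k < n.+1) zeta ^+ k * (T^-1 *: A k) =
    T^-1 *: (zeta ^+ n.+1 * Rem).
  have : 0 = (\sum_(k < n.+1) zeta ^+ k * A k)
       - T *: f z + zeta ^+ n.+1 * Rem.
    rewrite -[LHS]J0 JX split; congr (_ + _).
    transitivity (\sum_(k < n.+1) (zeta ^+ k * A k - zeta ^+ k * (if k == 0 :> nat then T *: f z else 0))).
      by apply: eq_bigr => k _; rewrite coef mulrBr.
    rewrite sumrB; congr (_ - _).
    by rewrite big_ord_recl/= expr0 mul1r big1 ?addr0// => k _; rewrite mulr0.
  move=> /(congr1 (fun x => T^-1 *: x)); rewrite scaler0 !scalerDr scalerN scalerA mulVf// scale1r.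
  rewrite scaler_sumr; under eq_bigr do rewrite scalerAr.
  by move=> e; apply/eqP; rewrite -subr_eq0 -oppr_eq0 opprB opprB addrC -e.
rewrite -/zeta key qabsZ ger0_norm ?invr_ge0 ?(ltW T0)// qabsM qabsX -/m.
(* The 8 of the statement is the product of the 2 of [qint_le], the bound 2 on [X] and the 2 of |F|
   <= C + C. *)
have Rb : qabs Rem <= 2 * ((b^-1 ^+ n.+1 * 2 * (C + C)) * T).
  apply: qint_le => //.
    by rewrite !mulr_ge0 ?exprn_ge0 ?invr_ge0 ?addr_ge0// ltW.
  move=> t Dt; rewrite !qabsM qabsX; apply: ler_pM; rewrite ?mulr_ge0 ?exprn_ge0 ?qabs_ge0//.
    apply: ler_pM; rewrite ?mulr_ge0 ?exprn_ge0 ?qabs_ge0//.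
      by rewrite /ci qabsZ qabs_conj qabs_circle// mulr1 ger0_norm// invr_ge0 ltW.
    rewrite cab qabsV ler_pdivrMr; last by rewrite qabs_gt0.
    by have := cz_ge t; lra.
  have h1 : pdisc p rho (circ I p b t) by rewrite /pdisc/= qabs_circ// gtr0_norm// b0.
  have h2 : pdisc p rho z by rewrite /pdisc/= zp (lt_trans mb).
  by rewrite (le_trans (qabsB _ _))// lerD// fC//; exact: circ_cline.
rewrite -/b expr_div_n.
apply: (@le_trans _ _ (T^-1 * (m ^+ n.+1 * (2 * ((b^-1 ^+ n.+1 * 2 * (C + C)) * T))))).
  rewrite ler_wpM2l ?invr_ge0 ?(ltW T0)// ler_wpM2l// exprn_ge0// qabs_ge0//.
rewrite exprVn le_eqVlt; apply/orP; left; apply/eqP.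
set B := b ^+ _; set M := m ^+ _.
have B0 : B != 0 by rewrite expf_neq0// gt_eqF.
move: Tn0; move: (_ *+ 2) => tp tp0.
by field; rewrite B0 tp0.
Qed.

End Fix.
End LaurentBounded.

(** * Moderate growth and isolated zeros *)

Section Growth.
Variable R : realType.
Local Notation H := (quat R).
Local Notation SS := (@imag_units R).
Implicit Types (p z w I : H) (f g : H -> H) (W A : set H).

(* At most a pole at [p]: the growth condition characterizing poles and removable
   singularities. *)
Definition moderate f I p := exists (m : nat) (C r : R), 0 < r /\
  forall z, cline I z -> pdisc p r z -> qabs (z - p) ^+ m * qabs (f z) <= C.

Lemma pdiscW p (r s : R) z : r <= s -> pdisc p r z -> pdisc p s z.
Proof. by move=> rs /andP[z0 zr]; rewrite /pdisc/= z0 (lt_le_trans zr). Qed.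

(** Applies the power series to the bounded function (z - p)^m f. Writing the error with [2 * r]
    keeps the ratio at most 1/2 on the whole disc of radius [r]. *)
Lemma moderate_series f I p (r0 : R) : SS I -> cline I p -> 0 < r0 ->
  holo I (pdisc p r0) f -> moderate f I p ->
  exists (m : nat) (a : nat -> H) (r K : R), [/\ 0 < r, 0 <= K &
    forall z n, cline I z -> 0 < qabs (z - p) <= r ->
    qabs ((z - p) ^+ m * f z - \sum_(k < n.+1) (z - p) ^+ k * a k) <=
      K * (qabs (z - p) / (2 * r)) ^+ n.+1].
Proof.
move=> SI Ip r00 hf [m [C [r [r1 hC]]]].
pose rho := Num.min r0 r.
have rho0 : 0 < rho by rewrite lt_min r00.
pose g z := (z - p) ^+ m * f z.
have hg : holo I (pdisc p rho) g.
  apply: holoM => //.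
  - by move=> z _ Iz; apply: clineX => //; exact: clineB.
  - apply: holoX => //; first by move=> z _ Iz; exact: clineB.
    by apply: holoB => //; [exact: holo_id|exact: holo_cst].
  - by apply: holoW hf => z; apply: pdiscW; rewrite ge_min lexx.
have gC w : cline I w -> pdisc p rho w -> qabs (g w) <= C.
  move=> Iw dw; rewrite /g qabsM qabsX; apply: hC => //.
  by apply: pdiscW dw; rewrite ge_min lexx orbT.
have [a ha] := bounded_power_series SI Ip rho0 hg gC.
exists m, a, (rho / 4), (8 * C); split.
- by rewrite divr_gt0.
- by rewrite mulr_ge0// (bound_ge0 SI Ip rho0 gC).
- move=> z n Iz hz; have -> : 2 * (rho / 4) = rho / 2 by field.
  exact: ha.
Qed.

Lemma expr_small (K x e : R) : 0 <= K -> 0 <= x < 1 -> 0 < e ->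
  exists n, K * x ^+ n.+1 < e.
Proof.
move=> K0 /andP[x0 x1] e0.
have : (fun n => K * x ^+ n) @ \oo --> K * 0.
  by apply: cvgM; [exact: cvg_cst|apply: cvg_expr; rewrite ger0_norm].
rewrite mulr0 => /cvgrPdist_lt/(_ _ e0)[n _ hn]; exists n.
have := hn n.+1 (leqnSn n).
by rewrite /= sub0r normrN ger0_norm// mulr_ge0// exprn_ge0.
Qed.

(** The real arithmetic of the next lemma: for small x the remainder takes at most half of the
    leading term, and x ^+ m <= 1 is dropped. *)
Lemma lower_bound_arith (K x s A F : R) (k m : nat) : 0 <= K -> 0 < x -> x < 1 -> 0 < s ->
  x < A / (2 * (K / s ^+ k.+1 + 1)) -> 0 <= F ->
  x ^+ k * A <= x ^+ m * F + K * (x / s) ^+ k.+1 -> A / 2 * x ^+ k <= F.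
Proof.
move=> K0 x0 x1 s0; rewrite expr_div_n [x ^+ k.+1]exprSr.
have u0 : 0 < s ^+ k.+1 by exact: exprn_gt0.
have y0 : 0 < x ^+ k by exact: exprn_gt0.
move: (s ^+ k.+1) (x ^+ k) u0 y0 => u y u0 y0 xA F0 h.
have v0 : 0 <= K / u by rewrite divr_ge0// ltW.
have -> : A / 2 * y = y * A - y * (A / 2) by field.
have xm : x ^+ m * F <= F by rewrite ler_piMl// exprn_ile1// ltW.
have e : K * (y * x / u) = y * (K / u * x) by ring.
rewrite {}e in h; move: (K / u) v0 xA h => v v0 xA h.
have v1 : 0 < 2 * (v + 1) by rewrite mulr_gt0// ltr_wpDl.
rewrite ltr_pdivlMr// in xA.
have h3 : v * x <= A / 2 by lra.
have h4 : y * (v * x) <= y * (A / 2) by rewrite ler_wpM2l// ltW.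
rewrite lerBlDr; lra.
Qed.

(** If all coefficients vanish, the error bound tends to 0 at each fixed point; otherwise the first
    nonzero coefficient dominates near [p]. *)
Lemma moderate_dichotomy f I p (r0 : R) : SS I -> cline I p -> 0 < r0 ->
  holo I (pdisc p r0) f -> moderate f I p ->
  (exists2 r : R, 0 < r & forall z, cline I z -> pdisc p r z -> f z = 0) \/
  (exists (k : nat) (c r : R), [/\ 0 < c, 0 < r & forall z, cline I z -> pdisc p r z ->
     c * qabs (z - p) ^+ k <= qabs (f z)]).
Proof.
move=> SI Ip r00 hf hm.
have [m [a [r [K [r1 K0 h]]]]] := moderate_series SI Ip r00 hf hm.
have [a0|/existsNP[k0 ak0]] := pselect (forall k, a k = 0).
  left; exists r => // z Iz /andP[z0 zr].
  have zp0 : (z - p) ^+ m != 0 by rewrite -qabs_gt0 qabsX exprn_gt0.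
  suff : qabs ((z - p) ^+ m * f z) = 0.
    move/eqP; rewrite qabs_eq0 => /eqP e; apply: (mulqI zp0); rewrite e mulr0//.
  apply/eqP; rewrite eq_le qabs_ge0 andbT.
  apply/ler_addgt0Pl => e e0; rewrite addr0.
  have [|n hn] := @expr_small K (qabs (z - p) / (2 * r)) e K0 _ e0.
    have r2 : 0 < 2 * r by rewrite mulr_gt0.
    rewrite divr_ge0 ?(ltW z0) ?(ltW r2)//= ltr_pdivrMr// mul1r.
    by rewrite (lt_trans zr)// ltr_pMl// ltr1n.
  have := h z n Iz; rewrite z0 (ltW zr) => /(_ isT).
  rewrite big1 ?subr0 => [h1|i _]; last by rewrite a0 mulr0.
  exact: (le_trans h1 (ltW hn)).
right.
have exk : exists k, a k != 0 by exists k0; apply/eqP.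
pose k := ex_minn exk; have [ak kmin] : a k != 0 /\ forall j, (j < k)%N -> a j = 0.
  rewrite /k; case: ex_minnP => i ai hi; split=> // j ji.
  by apply/eqP; apply: contraTT ji => /hi; rewrite -leqNgt.
have A0 : 0 < qabs (a k) by rewrite qabs_gt0.
pose B := K / (2 * r) ^+ k.+1 + 1.
have r2 : 0 < 2 * r by rewrite mulr_gt0.
have B0 : 0 < B by rewrite ltr_wpDl// divr_ge0// exprn_ge0// ltW.
(* The three bounds are those of the expansion, of x < 1 and of the smallness condition in
   [lower_bound_arith]. *)
pose s := Num.min (Num.min r 1) (qabs (a k) / (2 * B)).
exists k, (qabs (a k) / 2), s; split.
- exact: divr_gt0.
- by rewrite !lt_min r1 ltr01/= divr_gt0// mulr_gt0.
move=> z Iz /andP[z0]; rewrite !lt_min => /andP[/andP[zr z1] zB].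
have := h z k Iz; rewrite z0 (ltW zr) => /(_ isT).
rewrite big_ord_recr/= big1 => [|i _]; last by rewrite kmin ?mulr0.
rewrite add0r => hz.
set x := qabs (z - p) in z0 zr z1 zB hz *.
have h1 : x ^+ k * qabs (a k) <= x ^+ m * qabs (f z) + K * (x / (2 * r)) ^+ k.+1.
  rewrite -!qabsX -!qabsM -lerBlDl (le_trans (qabs_sub _ _))// qabsBC//.
exact: (lower_bound_arith K0 z0 z1 r2 zB (qabs_ge0 _) h1).
Qed.

Lemma moderate_at f I W p : cline I p -> open W -> W p -> holo I W f -> moderate f I p.
Proof.
move=> Ip oW Wp hf; have /cvg_qabsP/(_ 1 ltr01) := holo_cvg hf Wp Ip.
move=> /sln_nearP[r r0 hr]; exists 0%N, (qabs (f p) + 1), r; split=> // z Iz /andP[_ zr].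
rewrite expr0 mul1r; have := hr z Iz zr => h.
by have := qabs_sub (f z) (f p); lra.
Qed.

(** Connectedness as an induction principle with explicit radii, the form in which the arguments on
    slices use it. *)
Lemma connected_qabsP A : connected A <-> forall P : H -> Prop,
  (exists z, A z /\ P z) ->
  (forall z, A z -> P z -> exists2 e : R, 0 < e & forall w, A w -> qabs (w - z) < e -> P w) ->
  (forall z, A z -> ~ P z -> exists2 e : R, 0 < e & forall w, A w -> qabs (w - z) < e -> ~ P w) ->
  forall z, A z -> P z.
Proof.
have gen (Q : H -> Prop) :
    (forall z, A z -> Q z -> exists2 e : R, 0 < e & forall w, A w -> qabs (w - z) < e -> Q w) ->
    exists2 C, open C & [set z | A z /\ Q z] = A `&` C.
  (* The interior of the implication is open in H and has trace [Q] on [A]. *)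
  move=> hQ; exists ([set z | A z -> Q z]^°); first exact: open_interior.
  apply/seteqP; split=> z /= [Az Qz]; split=> //; last first.
    by apply: (interior_subset Qz).
  have [e e0 he] := hQ z Az Qz.
  by apply/nbhs_qabsP; exists e => // w wz Aw; exact: he.
split=> [cA P [z0 [Az0 Pz0]] hP hnP|h B [b Bb] [C oC BC] [C' cC' BC']].
  have e : [set z | A z /\ P z] = A.
    apply: cA; first by exists z0.
      exact: gen.
    have [C oC hC] := gen (fun z => ~ P z) hnP.
    exists (~` C); first exact: open_closedC.
    apply/seteqP; split=> z /= [Az].
      move=> Pz; split=> // Cz.
      by have : (A `&` C) z by []; rewrite -hC => -[].
    move=> nC; split=> //; apply: contrapT => nP.
    by apply: nC; have : [set z | A z /\ ~ P z] z by []; rewrite hC => -[].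
  by move=> z Az; rewrite -e in Az; case: Az.
have BA : B `<=` A by rewrite BC; exact: subIsetl.
apply/seteqP; split=> // z Az; apply: (h B) => //.
- by exists b; split=> //; exact: BA.
- move=> w Aw Bw; have : C w by move: Bw; rewrite BC => -[].
  move=> /((open_qabsP _).1 oC)[e e0 he]; exists e => // v Av vw.
  by rewrite BC; split=> //; exact: he.
- move=> w Aw nBw; have : (~` C') w by move=> C'w; apply: nBw; rewrite BC'; split.
  move=> /((open_qabsP _).1 (closed_openC cC'))[e e0 he]; exists e => // v Av vw.
  by rewrite BC' => -[_]; exact: he.
Qed.

Lemma pdisc_sub W p : open W -> W p -> exists2 r : R, 0 < r & pdisc p r `<=` W.
Proof.
by move=> /open_qabsP h /h[r r0 hr]; exists r => // z /andP[_]; exact: hr.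
Qed.

Lemma cline_near I p (r : R) : SS I -> cline I p -> 0 < r ->
  exists z, cline I z /\ pdisc p r z.
Proof.
move=> SI Ip r0; exists (p + (r / 2) *: 1); split.
  by apply: clineD => //; exact: cline_real.
rewrite /pdisc/= addrAC subrr add0r qabsZ qabs1 mulr1 gtr0_norm ?divr_gt0//.
by rewrite /= ltr_pdivrMr// ltr_pMr// ltr1n.
Qed.

(** Let Z be the set of points with a punctured disc on which f vanishes. The local dichotomy makes
    Z and its complement relatively open, so Z is empty or everything; in the second case continuity
    gives the zeros at the centres. *)
Lemma slice_dichotomy I W f : SS I -> open W -> connected (slice W I) -> holo I W f ->
  (forall z, slice W I z -> f z = 0) \/
  (forall p, slice W I p -> exists2 r : R, 0 < r &
     forall z, cline I z -> pdisc p r z -> f z != 0).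
Proof.
move=> SI oW cW hf.
pose Z p := exists2 r : R, 0 < r & forall z, cline I z -> pdisc p r z -> f z = 0.
have dich p : slice W I p -> Z p \/ exists2 r : R, 0 < r &
     forall z, cline I z -> pdisc p r z -> f z != 0.
  move=> [Wp Ip]; have [r r0 rW] := pdisc_sub oW Wp.
  have [|[k [c [s [c0 s0 hs]]]]] := moderate_dichotomy SI Ip r0 (holoW rW hf) (moderate_at Ip oW Wp hf).
    by left.
  right; exists s => // z Iz dz; rewrite -qabs_gt0 (lt_le_trans _ (hs z Iz dz))//.
  by rewrite mulr_gt0// exprn_gt0//; case/andP: dz.
have Zopen p : slice W I p -> Z p ->
    exists2 e : R, 0 < e & forall w, slice W I w -> qabs (w - p) < e -> Z w.
  move=> Wp [r r0 hr]; exists r => // w Ww wr.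
  have [->|wp] := eqVneq w p; first by exists r.
  have [|s s0 sr] := pdisc_sub (@open_pdisc R p r) (p := w).
    by rewrite /pdisc/= wr qabs_gt0 subr_eq0 wp.
  by exists s => // z Iz /sr; exact: hr.
have nZopen p : slice W I p -> ~ Z p ->
    exists2 e : R, 0 < e & forall w, slice W I w -> qabs (w - p) < e -> ~ Z w.
  move=> Wp nZp; have [//|[r r0 hr]] := dich p Wp.
  exists r => // w Ww wr [s s0 hs].
  have [e|wp] := eqVneq w p; first by apply: nZp; rewrite -e; exists s.
  have [|t t0 tr] := pdisc_sub (@open_pdisc R p r) (p := w).
    by rewrite /pdisc/= wr qabs_gt0 subr_eq0 wp.
  have st0 : 0 < Num.min s t by rewrite lt_min s0.
  have [z [Iz dz]] := cline_near SI Ww.2 st0.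
  have := hr z Iz (tr _ (pdiscW _ dz)); rewrite ge_min lexx orbT => /(_ isT).
  by rewrite hs ?eqxx//; apply: pdiscW dz; rewrite ge_min lexx.
have [[p [Wp Zp]]|nZ] := pselect (exists p, slice W I p /\ Z p).
  left=> z Wz.
  have [r r0 hr] : Z z.
    by apply: ((connected_qabsP _).1 cW Z) Wz => //; exists p.
  apply/eqP; apply: contrapT => /negP fz.
  have /cvg_qabsP/(_ (qabs (f z))) := holo_cvg hf Wz.1 Wz.2.
  rewrite qabs_gt0 => /(_ fz)/sln_nearP[e e0 he].
  have re0 : 0 < Num.min r e by rewrite lt_min r0.
  have [w [Iw dw]] := cline_near SI Wz.2 re0.
  have := he w Iw; rewrite hr//; last by apply: pdiscW dw; rewrite ge_min lexx.
  rewrite sub0r qabsN ltxx => /(_ _)/Bool.diff_false_true; apply.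
  by case/andP: dw => _; rewrite lt_min => /andP[].
right=> p Wp; have [Zp|//] := dich p Wp.
by exfalso; apply: nZ; exists p.
Qed.

(** The real points near [x0] lie on the line and are zeros of f - g accumulating at [x0], which
    contradicts the second alternative of [slice_dichotomy]. *)
Lemma identity_theorem I W f g (x0 : R) : SS I -> open W -> connected (slice W I) ->
  holo I W f -> holo I W g -> W (x0 *: 1) ->
  (forall x : R, W (x *: 1) -> f (x *: 1) = g (x *: 1)) ->
  forall z, slice W I z -> f z = g z.
Proof.
move=> SI oW cW hf hg Wx0 fg z Wz.
have sx0 : slice W I (x0 *: 1) by split=> //; exact: cline_real.
have [h|h] := slice_dichotomy SI oW cW (holoB SI hf hg); first exact/subr0_eq/h.
have [r r0 hr] := h _ sx0; have [s s0 sW] := pdisc_sub oW Wx0.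
pose t := Num.min r s / 2.
have m0 : 0 < Num.min r s by rewrite lt_min r0.
have t0 : 0 < t by rewrite divr_gt0.
have tm : t < Num.min r s by rewrite ltr_pdivrMr// ltr_pMr// ltr1n.
have d : pdisc (x0 *: 1) (Num.min r s) ((x0 + t) *: 1).
  by rewrite /pdisc/= -scalerBl addrAC subrr add0r qabsZ qabs1 mulr1 gtr0_norm// t0.
have Wt : W ((x0 + t) *: 1) by apply/sW/(pdiscW _ d); rewrite ge_min lexx orbT.
have := hr ((x0 + t) *: 1) (cline_real SI _) (pdiscW _ d).
by rewrite fg// subrr eqxx ge_min lexx => /(_ isT).
Qed.

End Growth.

(** * Regular extension *)

Section Extension.
Variable R : realType.
Local Notation H := (quat R).
Local Notation SS := (@imag_units R).
Implicit Types (p q z w I J K : H) (f g phi : H -> H) (W A : set H) (x y : R).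

Lemma SSi : SS (mkq 0 1 0 0).
Proof. by apply/imag_unitsP; rewrite /qdot !mkqE; split=> //; ring. Qed.

Lemma bounded_additive_continuous (s : H -> H) (C : R) :
  (forall a b, s (a - b) = s a - s b) -> (forall a, qabs (s a) <= C * qabs a) -> continuous s.
Proof.
move=> sB sC z; apply: (@cvg_qabs_squeeze _ _ (nbhs z) _ s (s z) (fun w => C * qabs (w - z))).
  by apply: nearW => w; rewrite -sB.
rewrite -[X in _ --> X](mulr0 C); apply: cvgM; first exact: cvg_cst.
by apply/(@cvg_qabs0P _ _ (nbhs z) _ id z); exact: cvg_id.
Qed.

Lemma regularP W f : open W -> regular W f <-> forall I, SS I -> holo I W f.
Proof.
move=> oW; split=> h I SI; first exact/holomorphic_holo/h.
exact/holo_holomorphic/h.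
Qed.

Lemma sym_cpoint W x y I J : symmetric_set W -> SS I -> SS J ->
  W (cpoint x y I) -> W (cpoint x y J).
Proof. by move=> sW SI SJ /(sW x y I SI); apply; exists J. Qed.

Lemma cpointN x y I : cpoint x y (- I) = cpoint x (- y) I.
Proof. by rewrite /cpoint scalerN scaleNr. Qed.

Lemma sym_conj W z : symmetric_set W -> W z -> W (qconj z).
Proof.
move=> sW; have [I SI [x [y [_ ->]]]] := cline_ex z.
rewrite cpoint_conj// -cpointN; apply: sym_cpoint => //; exact: SSN.
Qed.

(* The representation formula: the value at x + y J of the regular extension of
   [phi], given on R + I R. *)
Definition rep I J x y phi : H :=
  2^-1 *: ((1 - J * I) * phi (cpoint x y I) + (1 + J * I) * phi (cpoint x (- y) I)).

(** At a real [q] the quotient is 0 and not a unit; by [rep_real] the choice of [J] does not matter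
    there. *)
Definition qext I phi q : H :=
  rep I ((qabs (qim q))^-1 *: qim q) (qre q) (qabs (qim q)) phi.

Lemma repN I J x y phi : rep I (- J) x (- y) phi = rep I J x y phi.
Proof. by rewrite /rep opprK mulNr opprK addrC. Qed.

Lemma rep_real I J x phi : rep I J x 0 phi = phi (x *: 1).
Proof.
rewrite /rep oppr0 /cpoint scale0r addr0 -mulrDl addrACA addNr addr0 -mulr2n.
by rewrite mulr_natl mulr2n qhalf.
Qed.

Lemma qextE I J x y phi : SS I -> SS J -> qext I phi (cpoint x y J) = rep I J x y phi.
Proof.
move=> SI SJ; rewrite /qext qre_cpoint// qim_cpoint// qabsZ SSabs// mulr1.
have [->|y0] := eqVneq y 0; first by rewrite normr0 !rep_real.
have [yp|yn] := ltP 0 y; first by rewrite gtr0_norm// scalerA mulVf// scale1r.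
have {}yn : y < 0 by rewrite lt_neqAle y0.
by rewrite ltr0_norm// scalerA invrN mulNr mulVf// scaleN1r repN.
Qed.

Lemma qext_id I phi z : SS I -> cline I z -> qext I phi z = phi z.
Proof.
move=> SI [x [y ->]]; rewrite qextE// /rep SSsqr// opprK subrr mul0r addr0.
by rewrite -mulr2n mulr_natl mulr2n qhalf.
Qed.

(* The conjugate lines R + J R and R + I R are identified by [x + y J |-> x + y I]. *)
Definition transp J I q : H := cpoint (qre q) (qdot q J) I.

Lemma qdotBl p q r : qdot (p - q) r = qdot p r - qdot q r.
Proof. by rewrite /qdot !qcoordD qreN qciN qcjN qckN; ring. Qed.

Lemma transpB J I p q : transp J I (p - q) = transp J I p - transp J I q.
Proof.
rewrite /transp /cpoint qreD qreN qdotBl !scalerBl opprD addrACA//.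
Qed.

Lemma transp_continuous J I : SS I -> SS J -> continuous (transp J I).
Proof.
move=> SI SJ; apply: (@bounded_additive_continuous _ 2); first exact: transpB.
move=> a; rewrite (le_trans (qabsD _ _))// !qabsZ (SSabs SI) qabs1 !mulr1.
rewrite mulr_natl mulr2n lerD ?qabs_re//.
by rewrite (le_trans (qdot_le _ _))// (SSabs SJ) mulr1.
Qed.

Lemma transp_cpoint J I x y : SS J -> transp J I (cpoint x y J) = cpoint x y I.
Proof. by move=> SJ; rewrite /transp qre_cpoint// qdot_cpoint. Qed.

Lemma cpoint_intertwine x y c K J : c * K = J * c -> c * cpoint x y K = cpoint x y J * c.
Proof.
by move=> e; rewrite /cpoint mulrDr mulrDl -!scalerAl -!scalerAr mulr1 mul1r e.
Qed.

(** For K = I and K = - I the factor 1 - J K satisfies (1 - J K) K = J (1 - J K). Left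
    multiplication by it therefore turns increments along R + K R into increments along R + J R, and
    each of the two terms of [rep] is holomorphic by itself. *)
Lemma holo_qext I W phi : SS I -> symmetric_set W -> open W -> holo I W phi ->
  forall J, SS J -> holo J W (qext I phi).
Proof.
move=> SI sW oW hphi J SJ.
have key (K : H) : SS K -> cline I K -> 
    holo J W (fun w => (2^-1 *: 1) * ((1 - J * K) * phi (transp J K w))).
  move=> SK IK.
  have e : (1 - J * K) * K = J * (1 - J * K).
    by rewrite mulrBl mulrBr mul1r mulr1 SSKr// SSK// !opprK addrC.
  apply: (@holo_lin R I J W W (transp J K) (fun a => (2^-1 *: 1) * ((1 - J * K) * a))) => //.
  - by move=> z Jz; rewrite /transp; apply: clineD => //; [exact: cline_real|exact: clineZ].
  - exact: transp_continuous.
  - exact: transpB.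
  - by move=> z Wz [x [y zE]]; rewrite zE transp_cpoint//; apply: (sym_cpoint sW SJ) => //; rewrite -zE.
  - move=> a; apply: (@cvgqM _ _ (nbhs a) _ (fun=> 2^-1 *: 1) (fun a => (1 - J * K) * a)); first exact: cvg_cst.
    exact: continuous_qmull.
  - by move=> a b; rewrite !mulrBr.
  - move=> z a [x [y ->]]; rewrite transp_cpoint// -!scalerAl !mul1r -scalerAr; congr (_ *: _).
    by rewrite !mulrA (cpoint_intertwine x y e).
have h1 : holo J W (fun w => (2^-1 *: 1) * ((1 - J * I) * phi (transp J I w))).
  by apply: key => //; exact: clineI.
have h2 : holo J W (fun w => (2^-1 *: 1) * ((1 - J * - I) * phi (transp J (- I) w))).
  by apply: key; [exact: SSN|exact/clineN/clineI].
apply: holo_congr (holoD h1 h2) => // z Wz [x [y ->]].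
rewrite qextE// !transp_cpoint// cpointN mulrN opprK -!scalerAl !mul1r -scalerDr//.
Qed.

(** Both sides are holomorphic on the line through [q] and agree at the real points, which belong to
    all lines. *)
Lemma regular_rep W f I q : symmetric_slice_domain W -> regular W f -> SS I -> W q ->
  f q = qext I f q.
Proof.
move=> [sW [oW _ [x0 Wx0] cW]] /regularP rf SI Wq; have {}rf := rf oW.
have [J SJ [x [y [_ qE]]]] := cline_ex q.
apply: (identity_theorem SJ oW (cW J SJ) (rf J SJ) _ Wx0).
- by apply: holo_qext => //; exact: rf.
- move=> x1 _; rewrite -[x1 *: 1](addr0 (x1 *: 1)) -(scale0r I) -/(cpoint x1 0 I).
  by rewrite qextE// rep_real /cpoint scale0r addr0.
- by split=> //; rewrite qE; exact: cline_cpoint.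
Qed.

Lemma qimB p q : qim (p - q) = qim p - qim q.
Proof.
by rewrite /qim !qcoordD qciN qcjN qckN mkqN mkqD subr0.
Qed.
Lemma qabs_qim q : qabs (qim q) <= qabs q.
Proof.
rewrite ler_sqrt ?qdot_ge0// /qim /qdot !mkqE; nra.
Qed.

Lemma qsphereP x y q : qsphere x y q <-> qre q = x /\ qabs (qim q) = `|y|.
Proof.
split=> [[J SJ <-]|[]].
  by rewrite qre_cpoint// qim_cpoint// qabsZ SSabs// mulr1.
have [J SJ [a [b [b0 ->]]]] := cline_ex q.
rewrite qre_cpoint// qim_cpoint// qabsZ SSabs// mulr1 => -> /eqP; rewrite eqr_norm2.
case/orP => /eqP ->; first by exists J.
by exists (- J); [exact: SSN|rewrite cpointN].
Qed.

Lemma qsphere_self p : qsphere (qre p) (qabs (qim p)) p.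
Proof. by apply/qsphereP; rewrite ger0_norm ?qabs_ge0. Qed.

Lemma qsphere_comp_sym x y : symmetric_set (~` qsphere x y : set H).
Proof.
move=> a b I SI /qsphereP nab q [J SJ <-] /qsphereP; apply: contra_not nab.
by rewrite !qre_cpoint// !qim_cpoint// !qabsZ !SSabs.
Qed.

Lemma qsphere_comp_open x y : open (~` qsphere x y : set H).
Proof.
apply/open_qabsP => z /qsphereP /not_andP nz.
pose d : R := if qre z == x then `|qabs (qim z) - `|y| | else `|qre z - x|.
have d0 : 0 < d.
  rewrite /d; case: eqP => e; rewrite normr_gt0 subr_eq0; apply/eqP => //.
  by move=> h; case: nz.
exists d => // w wz /qsphereP[e1 e2]; move: wz; rewrite /d; case: eqP => _.
  rewrite -e2 distrC => /lt_le_trans/(_ (qabs_dist _ _)); rewrite -qimB.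
  by move=> /lt_le_trans/(_ (qabs_qim _)); rewrite ltxx.
rewrite -e1 -(qreN w) -qreD => /lt_le_trans/(_ (qabs_re _)).
by rewrite qabsBC ltxx.
Qed.

(** A function exchanging conjugate values at conjugate points extends by the same real data [a],
    [b] to every line. Powers of q - p with [p] real are of this kind. *)
Lemma rep_intrinsic I J x y phi (a b : R) : SS I -> SS J ->
  phi (cpoint x y I) = cpoint a b I -> phi (cpoint x (- y) I) = cpoint a (- b) I ->
  rep I J x y phi = cpoint a b J.
Proof.
move=> SI SJ e1 e2; rewrite /rep e1 e2.
have -> : (1 - J * I) * cpoint a b I + (1 + J * I) * cpoint a (- b) I =
    (cpoint a b I + cpoint a (- b) I) - J * (I * (cpoint a b I - cpoint a (- b) I)).
  rewrite mulrBl mulrDl !mul1r addrACA; congr (_ + _).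
  by rewrite !mulrBr opprB addrC !mulrA.
have -> : cpoint a b I + cpoint a (- b) I = a *: 1 + a *: 1.
  by rewrite /cpoint scaleNr addrACA subrr addr0.
have -> : cpoint a b I - cpoint a (- b) I = b *: I + b *: I.
  by rewrite /cpoint scaleNr opprD opprK addrACA subrr add0r.
rewrite mulrDr -!scalerAr SSsqr// mulrDr -!scalerAr mulrN1 !scalerN opprD !opprK.
by rewrite addrACA qhalf.
Qed.

Lemma cpointM I (x y x' y' : R) : SS I ->
  cpoint x y I * cpoint x' y' I = cpoint (x * x' - y * y') (x * y' + y * x') I.
Proof.
move=> SI; rewrite /cpoint mulrDl !mulrDr -!scalerAl -!scalerAr !mul1r !mulr1 SSsqr//.
rewrite !scalerN !scalerA scalerBl scalerDl -!addrA; congr (_ + _).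
by rewrite addrA addrC.
Qed.

(** The order of the quantifiers is the point: [a] and [b] serve all units at once, as
    [rep_intrinsic] requires. *)
Lemma cpoint_pow_ex (x y : R) n : exists a b : R, forall I, SS I ->
  cpoint x y I ^+ n = cpoint a b I.
Proof.
elim: n => [|n [a [b h]]].
  by exists 1, 0 => I SI; rewrite expr0 /cpoint scale1r scale0r addr0.
by exists (x * a - y * b), (x * b + y * a) => I SI; rewrite exprS h// cpointM.
Qed.

Lemma cpoint_inv_ex (x y : R) : exists a b : R, forall I, SS I ->
  (cpoint x y I)^-1 = cpoint a b I.
Proof.
exists ((x ^+ 2 + y ^+ 2)^-1 * x), ((x ^+ 2 + y ^+ 2)^-1 * - y) => I SI.
have -> : (cpoint x y I)^-1 = qinv (cpoint x y I) by [].
rewrite /qinv cpoint_conj// -qabs_sqr qabs_cpoint// sqr_sqrtr ?addr_ge0 ?sqr_ge0//.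
by rewrite /cpoint scalerDr !scalerA.
Qed.

Lemma cpoint_exprz_ex (x y : R) (n : int) : exists a b : R, forall I, SS I ->
  cpoint x y I ^ n = cpoint a b I.
Proof.
case: n => n; first exact: cpoint_pow_ex.
have [a [b h]] := cpoint_pow_ex x y n.+1; have [c [d h']] := cpoint_inv_ex a b.
by exists c, d => I SI; rewrite -h'// -h.
Qed.

(** For a nonreal [p] only its own line constrains the values. A real [p] lies on all lines, and
    there the power is intrinsic. *)
Lemma star_power_qext I p (n : int) : SS I -> cline I p ->
  is_star_power p n (qext I (fun z => (z - p) ^ n)).
Proof.
move=> SI Ip; have [x0 [y0 pE]] := Ip.
pose phi z := (z - p) ^ n; rewrite -/phi.
rewrite /is_star_power; set W := if _ then _ else _.
have [sW oW] : symmetric_set W /\ open W.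
  rewrite /W; case: ifP => _; last by split; [exact: qsphere_comp_sym|exact: qsphere_comp_open].
  by split; [move=> ? ? ? ? ? ? ?|exact: openT].
have hphi : holo I W phi.
  have hX V m : holo I V (fun z => (z - p) ^+ m).
    apply: holoX => //; first by move=> z _ Iz; exact: clineB.
    by apply: holoB => //; [exact: holo_id|exact: holo_cst].
  rewrite /phi /W; case: {phi W sW oW} n => m /=; first exact: hX.
  apply: holoV => //; [exact: qsphere_comp_open| |].
  - by move=> z _ Iz; apply: clineX => //; exact: clineB.
  - move=> z /= Wz _; rewrite -qabs_gt0 qabsX exprn_gt0// qabs_gt0 subr_eq0.
    by apply/eqP => zp; apply: Wz; rewrite zp; exact: qsphere_self.
split; first by apply/regularP => // J SJ; exact: holo_qext.
move=> J SJ Jp z Jz; have [y00|y0n] := eqVneq y0 0; last first.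
  rewrite pE in Jp; have := cline_unique SI SJ y0n Jp.
  have Iz : J = I \/ J = - I -> cline I z.
    by case=> e; rewrite e in Jz => //; apply/clineN_unit.
  by move=> /Iz Iz'; rewrite qext_id.
have pr : p = x0 *: 1 by rewrite pE y00 /cpoint scale0r addr0.
have [x [y zE]] := Jz.
have cB K (b : R) : cpoint x b K - p = cpoint (x - x0) b K.
  by rewrite pr /cpoint addrAC scalerBl.
have [a [b hab]] := cpoint_exprz_ex (x - x0) y n.
rewrite zE qextE// cB hab//; apply: rep_intrinsic => //; first by rewrite /phi cB hab.
by rewrite /phi cB -!cpointN hab//; exact: SSN.
Qed.

End Extension.

(** * Symmetric sets with isolated singularities *)

Section Singularities.
Variable R : realType.
Local Notation H := (quat R).
Local Notation SS := (@imag_units R).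
Implicit Types (p q z w I J K : H) (f g phi : H -> H) (W A Omega : set H) (x y r : R).

Lemma annulus_line I p q r : SS I -> cline I p -> cline I q ->
  annulus p 0 r q <-> pdisc p r q.
Proof.
move=> SI Ip Iq; rewrite /annulus /tau /sigma /pdisc/=.
have -> : `[< same_line q p >] by apply/asboolP; exists I.
by split=> [[-> ->]|/andP[]].
Qed.

(** Off the line through a nonreal [p], sigma is at least |Im p|; for small radii the annulus
    therefore stays in that line. *)
Lemma annulus_small I x y r q : SS I -> y != 0 -> r <= `|y| ->
  annulus (cpoint x y I) 0 r q -> cline I q.
Proof.
move=> SI y0 ry [_]; rewrite /sigma; case: asboolP => [[J SJ [Jq Jp]] _|_].
  by have [e|e] := cline_unique SI SJ y0 Jp; rewrite e in Jq => //; apply/clineN_unit.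
move=> h; exfalso; move: h; rewrite ltNge => /negP; apply; apply: le_trans ry _.
rewrite qim_cpoint// [qabs (y *: I)]qabsZ (SSabs SI) mulr1 -[leLHS]ger0_norm// -sqrtr_sqr.
rewrite ler_sqrt ?addr_ge0 ?sqr_ge0// (@le_trans _ _ ((qabs (qim q) + `|y|) ^+ 2))//.
  by rewrite lerXn2r ?nnegrE ?addr_ge0 ?qabs_ge0// lerDr qabs_ge0.
by rewrite lerDr sqr_ge0.
Qed.

Lemma annulus_real x r q : annulus (x *: 1) 0 r q <-> pdisc (x *: 1) r q.
Proof.
have [J SJ [a [b [_ qE]]]] := cline_ex q.
apply: (annulus_line _ SJ); first exact: cline_real.
by rewrite qE; exact: cline_cpoint.
Qed.

Lemma cpointB x y (x' y' : R) I : cpoint x y I - cpoint x' y' I = cpoint (x - x') (y - y') I.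
Proof. by rewrite /cpoint !scalerBl opprD addrACA. Qed.

(** Reduces the four-dimensional condition to one line. Near a nonreal [p] the annulus shrinks into
    the line; near a real [p] the symmetry of [W] carries a punctured disc of one line to all the
    others. *)
Lemma singularity_line W I p : symmetric_set W -> SS I -> cline I p ->
  singularity W p <->
  exists2 r, 0 < r & forall z, cline I z -> pdisc p r z -> W z.
Proof.
move=> sW SI Ip; split=> [[r r0 h]|[r r0 h]].
  by exists r => // z Iz dz; apply: h; apply/(annulus_line r SI Ip Iz).
have [x [y pE]] := Ip; have [y0|y0] := eqVneq y 0.
  have pr : p = x *: 1 by rewrite pE y0 /cpoint scale0r addr0.
  exists r => // q; rewrite pr => /annulus_real; rewrite -pr.
  have [J SJ [a [b [_ ->]]]] := cline_ex q.
  rewrite /pdisc/= pr -[x *: 1]addr0 -(scale0r J) -/(cpoint x 0 J) cpointB qabs_cpoint// => d.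
  apply: (sym_cpoint sW SI SJ); apply: h; first exact: cline_cpoint.
  rewrite /pdisc/= pr -[x *: 1]addr0 -(scale0r I) -/(cpoint x 0 I) cpointB.
  by rewrite qabs_cpoint.
exists (Num.min r `|y|); first by rewrite lt_min r0 normr_gt0.
move=> q; rewrite pE => aq.
have Iq : cline I q by apply: annulus_small aq => //; rewrite ge_min lexx orbT.
apply: h => //; move/(annulus_line _ SI (cline_cpoint I x y) Iq): aq.
by rewrite -pE; apply: pdiscW; rewrite ge_min lexx.
Qed.

Lemma singularity_sub W p r : singularity W p -> 0 < r -> exists s, [/\ 0 < s, s <= r & annulus p 0 s `<=` W].
Proof.
move=> [t t0 h] r0; exists (Num.min t r); split; first by rewrite lt_min t0.
  by rewrite ge_min lexx orbT.
move=> q [q1 q2]; apply: h; split=> //; apply: lt_le_trans q2 _.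
by rewrite ge_min lexx.
Qed.

Lemma singularityI W V p : singularity W p -> singularity V p -> singularity (W `&` V) p.
Proof.
move=> hW [t t0 hV]; have [s [s0 st hs]] := singularity_sub hW t0.
by exists s => // q [q1 q2]; split; [exact: hs|apply: hV; split=> //; exact: lt_le_trans st].
Qed.

Lemma open_singularity W p : symmetric_set W -> open W -> W p -> singularity W p.
Proof.
move=> sW oW Wp; have [I SI [x [y [_ pE]]]] := cline_ex p.
apply/(singularity_line sW SI); first by rewrite pE; exact: cline_cpoint.
by have [r r0 h] := pdisc_sub oW Wp; exists r => // z _; exact: h.
Qed.

Lemma symI W V : symmetric_set W -> symmetric_set V -> symmetric_set (W `&` V).
Proof. by move=> sW sV x y I SI [Wx Vx] q hq; split; [exact: (sW x y I)|exact: (sV x y I)]. Qed.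

Lemma convex_connected A :
  (forall a b t, A a -> A b -> 0 <= t <= 1 -> A (a + t *: (b - a))) -> connected A.
Proof.
move=> cA; have [[a Aa]|A0] := pselect (exists a, A a); last first.
  have -> : A = set0 by apply/seteqP; split=> // z Az; apply: A0; exists z.
  exact: connected0.
pose seg b := [set a + t *: (b - a) | t in `[0, 1 : R]%classic].
have -> : A = \bigcup_(b in A) seg b.
  apply/seteqP; split=> z.
    by move=> Az; exists z => //; exists 1; rewrite /= ?in_itv/= ?ler01 ?lexx// scale1r addrC subrK.
  by move=> [b Ab [t]]; rewrite /= in_itv/= => t01 <-; exact: cA.
apply: bigcup_connected.
  by exists a => b Ab; exists 0; rewrite /= ?in_itv/= ?ler01 ?lexx// scale0r addr0.
move=> b Ab; apply: connected_continuous_connected; first exact: segment_connected.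
apply: continuous_subspaceT => t.
have : qder (fun t => a + t *: (b - a)) t (0 + 1 *: (b - a)).
  by apply: qderD; [exact: qder_cst|apply: (@qderZ _ id); exact: is_derive_id].
by move=> /qder_continuous.
Qed.

(** The punctured disc is covered by four half discs, given by the signs of the two real
    coordinates. They are convex, hence connected, and the points with coordinates of modulus r / 4
    link them. *)
Lemma pdisc_connected I p r : SS I -> cline I p -> 0 < r ->
  connected [set z | cline I z /\ pdisc p r z].
Proof.
move=> SI Ip r0.
pose C (l : H -> R) := [set z | [/\ cline I z, 0 < l (z - p) & qabs (z - p) < r]].
have cC (l : H -> R) : (forall a b, l (a + b) = l a + l b) -> (forall c a, l (c *: a) = c * l a) -> connected (C l).
  move=> lD lZ; apply: convex_connected => a b t [Ia la ar] [Ib lb br] /andP[t0 t1].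
  have e : a + t *: (b - a) - p = (1 - t) *: (a - p) + t *: (b - p).
    have -> : b - a = (b - p) - (a - p) by rewrite opprB addrA subrK.
    rewrite scalerBr scalerBl scale1r; move: (t *: (b - p)) (t *: (a - p)) => v u.
    by rewrite addrAC [v - u]addrC addrA.
  split.
  - by apply: clineD => //; apply: clineZ => //; exact: clineB.
  - rewrite e lD !lZ.
    have [->|tn1] := eqVneq t 1; first by rewrite subrr mul0r add0r mul1r.
    by rewrite ltr_wpDr// ?mulr_ge0 ?(ltW lb)// mulr_gt0// subr_gt0 lt_neqAle tn1.
  - rewrite e (le_lt_trans (qabsD _ _))// !qabsZ ger0_norm ?subr_ge0// ger0_norm//.
    have [->|tn1] := eqVneq t 1; first by rewrite subrr mul0r add0r mul1r.
    have t1' : 0 < 1 - t by rewrite subr_gt0 lt_neqAle tn1.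
    have -> : r = (1 - t) * r + t * r by rewrite -mulrDl subrK mul1r.
    by rewrite ltr_leD ?ltr_pM2l// ler_wpM2l// ltW.
have reD a b : qre (a + b) = qre a + qre b by exact: qreD.
have reZ c a : qre (c *: a) = c * qre a by exact: qreZ.
have dD a b : qdot (a + b) I = qdot a I + qdot b I by rewrite /qdot !qcoordD; ring.
have dZ c a : qdot (c *: a) I = c * qdot a I by rewrite /qdot !qcoordZ; ring.
pose l1 q := qre q; pose l2 q := qdot q I; pose l3 q := - qre q; pose l4 q := - qdot q I.
have c1 : connected (C l1) by exact: cC.
have c2 : connected (C l2) by exact: cC.
have c3 : connected (C l3).
  by apply: cC => [a b|c a]; rewrite /l3 ?reD ?opprD// reZ mulrN.
have c4 : connected (C l4).
  apply: cC => [a b|c a]; rewrite /l4; first by rewrite dD opprD.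
  by rewrite dZ mulrN.
have r4 : 0 < r / 4 by exact: divr_gt0.
have pt s t : `|s| <= r / 4 -> `|t| <= r / 4 ->
    [/\ cline I (p + cpoint s t I), qre (p + cpoint s t I - p) = s,
        qdot (p + cpoint s t I - p) I = t & qabs (p + cpoint s t I - p) < r].
  move=> hs ht; rewrite addrAC subrr add0r qre_cpoint// qdot_cpoint//; split=> //.
    by apply: clineD => //; exact: cline_cpoint.
  rewrite (le_lt_trans (qabsD _ _))// !qabsZ qabs1 (SSabs SI) !mulr1.
  by apply: (@le_lt_trans _ _ (r / 4 + r / 4)); [exact: lerD|lra].
have n4 : `|r / 4| <= r / 4 by rewrite gtr0_norm.
have nn4 : `|- (r / 4)| <= r / 4 by rewrite normrN gtr0_norm.
have -> : [set z | cline I z /\ pdisc p r z] = (C l1 `|` C l2) `|` (C l3 `|` C l4).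
  apply/seteqP; split=> z; last first.
    rewrite /C/= /pdisc/= => hz.
    have : cline I z /\ qabs (z - p) < r /\ z - p != 0.
      have n0 (l : H -> R) : l 0 = 0 -> 0 < l (z - p) -> z - p != 0.
        by move=> l0 lz; apply/eqP => e; rewrite e l0 ltxx in lz.
      have re0 : qre (0 : H) = 0 by exact: qre0.
      have d0 : qdot (0 : H) I = 0 by rewrite -(scale0r (0 : H)) dZ mul0r.
      case: hz => [[]|[]] [Iz lz zr]; split=> //; split=> //; apply: (n0 _ _ lz) => //.
        by rewrite /l3 re0 oppr0.
      by rewrite /l4 d0 oppr0.
    by move=> [Iz [zr zp]]; split=> //; rewrite qabs_gt0 zp.
  move=> [Iz /andP[z0 zr]]; have [s [t e]] := clineB SI Iz Ip.
  have es : qre (z - p) = s by rewrite e qre_cpoint.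
  have et : qdot (z - p) I = t by rewrite e qdot_cpoint.
  have [s0|s0|s0] := ltgtP s 0.
  - by right; left; split=> //; rewrite /l3 es oppr_gt0.
  - by left; left; split=> //; rewrite /l1 es.
  have [t0|t0|t0] := ltgtP t 0.
  - by right; right; split=> //; rewrite /l4 et oppr_gt0.
  - by left; right; split=> //; rewrite /l2 et.
  by move: z0; rewrite e s0 t0 qabs_cpoint// expr0n/= addr0 sqrtr0 ltxx.
apply: connectedU.
- have [h1 h2 h3 h4] := pt _ _ n4 nn4; exists (p + cpoint (r / 4) (- (r / 4)) I).
  split; [left|right]; split => //; first by rewrite /l1 h2.
  by rewrite /l4 h3 opprK.
- apply: connectedU => //; have [h1 h2 h3 h4] := pt _ _ n4 n4.
  exists (p + cpoint (r / 4) (r / 4) I).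
  by split; split=> //; [rewrite /l1 h2|rewrite /l2 h3].
- apply: connectedU => //; have [h1 h2 h3 h4] := pt _ _ nn4 nn4.
  exists (p + cpoint (- (r / 4)) (- (r / 4)) I).
  by split; split=> //; [rewrite /l3 h2 opprK|rewrite /l4 h3 opprK].
Qed.

(* A relatively clopen subset of W extends to one of Omega, because punctured discs
   of a line are connected. *)
Lemma slice_codiscrete_connected Omega W I : SS I -> connected (slice Omega I) ->
  W `<=` Omega -> open Omega ->
  (forall z, W z -> cline I z -> exists2 r, 0 < r & forall w, cline I w -> qabs (w - z) < r -> W w) ->
  (forall p, slice Omega I p -> exists2 r, 0 < r & forall z, cline I z -> pdisc p r z -> W z) ->
  connected (slice W I).
Proof.
move=> SI cO WO oO oW sW; apply/connected_qabsP => P [z0 [Wz0 Pz0]] hP hnP.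
pose Q p := exists2 r, 0 < r & forall z, cline I z -> pdisc p r z -> W z /\ P z.
have dich p : slice Omega I p -> Q p \/ exists2 r, 0 < r & forall z, cline I z -> pdisc p r z -> W z /\ ~ P z.
  move=> [Op Ip]; have [r r0 hr] := sW p (conj Op Ip).
  pose A := [set z | cline I z /\ pdisc p r z].
  have /connected_qabsP cA : connected A by exact: pdisc_connected.
  have [[z [Az Pz]]|nP] := pselect (exists z, A z /\ P z).
    left; exists r => // w Iw dw; split; first exact: hr.
    apply: (cA P) => //; first by exists z.
      move=> v [Iv dv] Pv; have [e e0 he] := hP v (conj (hr _ Iv dv) Iv) Pv.
      by exists e => // u [Iu du]; apply: he; split=> //; exact: hr.
    move=> v [Iv dv] Pv; have [e e0 he] := hnP v (conj (hr _ Iv dv) Iv) Pv.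
    by exists e => // u [Iu du]; apply: he; split=> //; exact: hr.
  right; exists r => // w Iw dw; split; first exact: hr.
  by move=> Pw; apply: nP; exists w.
have loc (T : H -> Prop) p r w : cline I w -> pdisc p r w ->
    (forall z, cline I z -> pdisc p r z -> T z) ->
    exists2 s, 0 < s & forall z, cline I z -> pdisc w s z -> T z.
  move=> Iw dw h; have [s s0 hs] := pdisc_sub (@open_pdisc R p r) dw.
  by exists s => // z Iz /hs; exact: h.
have QO : forall p, slice Omega I p -> Q p.
  apply: ((connected_qabsP _).1 cO Q).
  - exists z0; split; first by case: Wz0 => /WO.
    have [e e0 he] := hP z0 Wz0 Pz0; have [r r0 hr] := oW z0 Wz0.1 Wz0.2.
    exists (Num.min e r); first by rewrite lt_min e0.
    move=> z Iz /andP[_]; rewrite lt_min => /andP[ze zr].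
    by split; [exact: hr|apply: he => //; split=> //; exact: hr].
  - move=> p [Op Ip] [r r0 hr]; exists r => // w [Ow Iw] wr.
    have [->|wp] := eqVneq w p; first by exists r.
    by apply: loc hr => //; rewrite /pdisc/= wr qabs_gt0 subr_eq0 wp.
  - move=> p Op nQ; have [//|[r r0 hr]] := dich p Op.
    exists r => // w [Ow Iw] wr [s s0 hs].
    have [t t0 ht] : exists2 t, 0 < t & forall z, cline I z -> pdisc w t z -> W z /\ ~ P z.
      have [->|wp] := eqVneq w p; first by exists r.
      by apply: loc hr => //; rewrite /pdisc/= wr qabs_gt0 subr_eq0 wp.
    have st0 : 0 < Num.min s t by rewrite lt_min s0.
    have [z [Iz dz]] := cline_near SI Iw st0.
    have [_] : W z /\ ~ P z by apply: ht => //; apply: pdiscW dz; rewrite ge_min lexx orbT.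
    by apply; apply: (hs z Iz _).2; apply: pdiscW dz; rewrite ge_min lexx.
move=> z Wz; apply: contrapT => nPz.
have [e e0 he] := hnP z Wz nPz; have [r r0 hr] := QO z (conj (WO _ Wz.1) Wz.2).
have re0 : 0 < Num.min r e by rewrite lt_min r0.
have [w [Iw dw]] := cline_near SI Wz.2 re0.
have [Ww Pw] : W w /\ P w by apply: hr => //; apply: pdiscW dw; rewrite ge_min lexx.
apply: (he w (conj Ww Iw) _ Pw).
by case/andP: dw => _; rewrite lt_min => /andP[].
Qed.

(** Makes domain conditions checkable on lines: openness in H comes from openness on one line and
    symmetry, connectedness from that of the slices. *)
Lemma ssd_codiscrete Omega W : symmetric_slice_domain Omega -> W `<=` Omega ->
  symmetric_set W -> (forall p, Omega p -> singularity W p) -> symmetric_slice_domain W.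
Proof.
move=> [sO [oO cO [x0 Ox0] cOI]] WO sW hW.
have sing I p : SS I -> slice Omega I p ->
    exists2 r, 0 < r & forall z, cline I z -> pdisc p r z -> W z.
  by move=> SI [Op Ip]; apply/(singularity_line sW SI Ip); exact: hW.
have disc I z : SS I -> W z -> cline I z ->
    exists2 r, 0 < r & forall w, cline I w -> qabs (w - z) < r -> W w.
  move=> SI Wz Iz; have [r r0 hr] := sing I z SI (conj (WO _ Wz) Iz).
  exists r => // w Iw wr; have [->//|wz] := eqVneq w z.
  by apply: hr => //; rewrite /pdisc/= wr qabs_gt0 subr_eq0 wz.
have oW : open W.
  apply/open_qabsP => q Wq; have [I SI [x [y [y0 qE]]]] := cline_ex q.
  have Iq : cline I q by rewrite qE; exact: cline_cpoint.
  have [r r0 hr] := disc I q SI Wq Iq.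
  (* [w] is moved to the line of [q] with the same coordinates. Both coordinates differ from those
     of [q] by at most |w - q|, so the new distance is below r. *)
  exists (r / 2); first exact: divr_gt0.
  move=> w; have [J SJ [a [b [b0 wE]]]] := cline_ex w => wq; rewrite wE.
  apply: (sym_cpoint sW SI SJ); apply: hr; first exact: cline_cpoint.
  rewrite qE cpointB (le_lt_trans (qabsD _ _))// !qabsZ qabs1 (SSabs SI) !mulr1.
  have h1 : `|a - x| <= qabs (w - q).
    by rewrite (le_trans _ (qabs_re _))// wE qE qreD qreN !qre_cpoint.
  have h2 : `|b - y| <= qabs (w - q).
    rewrite (le_trans _ (qabs_qim _))// qimB (le_trans _ (qabs_dist _ _))//.
    by rewrite wE qE !qim_cpoint// !qabsZ (SSabs SI) (SSabs SJ) !mulr1 (ger0_norm b0) (ger0_norm y0).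
  by move: wq h1 h2; lra.
have cW I : SS I -> connected (slice W I).
  move=> SI; apply: (slice_codiscrete_connected SI (cOI I SI) WO oO) => z.
    exact: disc.
  exact: sing.
have [x1 Wx1] : exists x : R, W (x *: 1).
  have [r r0 hr] := sing _ _ (SSi R) (conj Ox0 (cline_real (SSi R) x0)).
  exists (x0 + r / 2); apply: hr; first exact: cline_real (SSi R) _.
  rewrite /pdisc/= -scalerBl addrAC subrr add0r qabsZ qabs1 mulr1 gtr0_norm ?divr_gt0//.
  by rewrite /= ltr_pdivrMr// ltr_pMr// ltr1n.
split=> //; split=> //; last by exists x1.
(* The slices are connected and share the real point [x1]. *)
have -> : W = \bigcup_(I in SS) slice W I.
  apply/seteqP; split=> q; last by move=> [I _ []].
  move=> Wq; have [I SI [x [y [_ qE]]]] := cline_ex q.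
  by exists I => //; split=> //; rewrite qE; exact: cline_cpoint.
apply: bigcup_connected => //; exists (x1 *: 1) => I SI; split=> //; exact: cline_real.
Qed.

End Singularities.

(** * Poles and moderate growth *)

Section Poles.
Variable R : realType.
Local Notation H := (quat R).
Local Notation SS := (@imag_units R).
Implicit Types (p q z w I J K : H) (f g phi : H -> H) (W A Omega : set H) (x y r : R).

Lemma moderate_congr f g I p r : 0 < r ->
  (forall z, cline I z -> pdisc p r z -> f z = g z) -> moderate f I p -> moderate g I p.
Proof.
move=> r0 fg [m [C [s [s0 h]]]]; exists m, C, (Num.min r s); split.
  by rewrite lt_min r0.
move=> z Iz dz; rewrite -fg//; last by apply: pdiscW dz; rewrite ge_min lexx.
by apply: h => //; apply: pdiscW dz; rewrite ge_min lexx orbT.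
Qed.

Lemma removable_moderate W f I p : SS I -> cline I p -> removable W f p -> moderate f I p.
Proof.
move=> SI Ip [[r r0 hr] [U [g [oU Up /(regularP _ oU) rg gf]]]].
have [s s0 hs] := pdisc_sub oU Up.
apply: (@moderate_congr g _ _ _ (Num.min r s)); last exact: (moderate_at Ip oU Up (rg I SI)).
  by rewrite lt_min r0.
move=> z Iz dz; apply: gf; rewrite inE; split.
  by apply/hs/(pdiscW _ dz); rewrite ge_min lexx orbT.
apply: hr; apply/(annulus_line r SI Ip Iz).
by apply: pdiscW dz; rewrite ge_min lexx.
Qed.

Lemma cvg_series_bounded (u : nat -> H) (s : H) : series u @ \oo --> s ->
  exists2 M, 0 <= M & forall n, qabs (u n) <= M.
Proof.
move=> h; have : u @ \oo --> (0 : H).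
  by apply: cvg_series_cvg_0; apply/cvg_ex; exists s.
move=> /cvg_qabsP/(_ 1 ltr01)[N _ hN].
have S0 n : 0 <= \sum_(k < n) qabs (u k) by apply: sumr_ge0 => k _; exact: qabs_ge0.
exists (1 + \sum_(k < N) qabs (u k)) => [|n]; first by rewrite addr_ge0.
have [nN|Nn] := ltnP n N.
  rewrite (bigD1 (Ordinal nN))//= addrCA lerDl addr_ge0//.
  by apply: sumr_ge0 => k _; exact: qabs_ge0.
have := hN n Nn; rewrite /= subr0 => /ltW/le_trans; apply.
by rewrite lerDl; exact: S0.
Qed.

(** Convergence at a single point [z0] bounds the terms of nonnegative index there, so on half the
    distance that part is dominated by a geometric series. The negative part is a finite sum. *)
Lemma pole_moderate W f I p : SS I -> cline I p -> pole W f p -> moderate f I p.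
Proof.
move=> SI Ip [r [a [r0 _ [P [hP hs]] [m am]]]].
have [z0 [Iz0 dz0]] := cline_near SI Ip r0.
have PE n z : cline I z -> P n z = (z - p) ^ n by move=> Iz; apply: (hP n).2 Iz.
have line z : cline I z -> pdisc p r z -> is_bilateral_sum (fun n => (z - p) ^ n * a n) (f z).
  move=> Iz dz; have := hs z ((annulus_line r SI Ip Iz).2 dz).
  by under [X in is_bilateral_sum X]eq_fun do rewrite PE//.
have [s0 [_ [hs0 _ _]]] := line z0 Iz0 dz0.
have [M M0 hM] := cvg_series_bounded hs0.
pose rho := qabs (z0 - p); have rho0 : 0 < rho by case/andP: dz0.
pose B := \sum_(k < m) qabs (a (- k.+1%:Z)).
have B0 : 0 <= B by apply: sumr_ge0 => k _; exact: qabs_ge0.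
(* Below rho / 2 the geometric ratio is at most 1/2 and its sum at most 2; below 1 the factor |z -
   p|^m absorbs each of the first m negative powers. *)
exists m, (2 * M + B), (Num.min (rho / 2) 1); split; first by rewrite lt_min divr_gt0//=.
move=> z Iz /andP[zp]; rewrite lt_min => /andP[z2 z1].
have zr : qabs (z - p) < r.
  by rewrite (lt_trans z2)// (@lt_trans _ _ rho)//; [rewrite ltr_pdivrMr// ltr_pMr// ltr1n|case/andP: dz0].
have [s [t [hs1 ht ->]]] := line z Iz (introT andP (conj zp zr)).
set x := qabs (z - p) in zp z2 z1 zr *.
have hS : qabs s <= 2 * M.
  apply: (qabs_le_lim _ hs1); apply: nearW => n; rewrite seriesEord.
  rewrite /= (le_trans (qabs_sum _ (fun k : nat => (z - p) ^ k * a k)))//.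
  apply: (@le_trans _ _ (\sum_(k < n) M * (1 / 2) ^+ k)).
    apply: ler_sum => k _; rewrite qabsM qabsX -/x.
    have h2 : x ^+ k <= rho ^+ k * (1 / 2) ^+ k.
      by rewrite -exprMn mul1r lerXn2r ?nnegrE ?divr_ge0 ?(ltW z2)// ltW.
    have h3 := hM k; rewrite qabsM qabsX -/rho in h3.
    apply: (@le_trans _ _ (rho ^+ k * (1 / 2) ^+ k * qabs (a k))).
      by rewrite ler_wpM2r ?qabs_ge0.
    by rewrite mulrAC ler_wpM2r// exprn_ge0.
  rewrite -mulr_sumr mulrC ler_wpM2r//.
  have := @subrX1 R (1 / 2) n; set S := \sum_(_ < _) _ => hSn.
  have : 0 <= (1 / 2 : R) ^+ n by rewrite exprn_ge0.
  lra.
have hT : t = \sum_(k < m) (z - p) ^ (- k.+1%:Z) * a (- k.+1%:Z).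
  apply: (cvg_unique _ ht) => //.
  have : (fun=> \sum_(k < m) (z - p) ^ (- k.+1%:Z) * a (- k.+1%:Z)) @ \oo --> \sum_(k < m) (z - p) ^ (- k.+1%:Z) * a (- k.+1%:Z) by exact: cvg_cst.
  apply: cvg_trans; apply: near_eq_cvg; exists m => // n /= mn.
  rewrite seriesEord/= -(subnKC mn) big_split_ord/= [X in _ = _ + X]big1 ?addr0// => k _.
  by rewrite am ?mulr0// ltnS leq_addr.
have hT2 : x ^+ m * qabs t <= B.
  rewrite hT; apply: (@le_trans _ _ (x ^+ m * \sum_(k < m) qabs ((z - p) ^ (- k.+1%:Z) * a (- k.+1%:Z)))).
    by rewrite ler_wpM2l ?exprn_ge0 ?(ltW zp)// (qabs_sum m (fun k => (z - p) ^ (- k.+1%:Z) * a (- k.+1%:Z))).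
  rewrite mulr_sumr; apply: ler_sum => k _.
  rewrite qabsM -exprnN qabsV qabsX -/x mulrA ler_piMl ?qabs_ge0//.
  rewrite ler_pdivrMr ?exprn_gt0// mul1r ler_wiXn2l// ltW//.
rewrite (le_trans (ler_wpM2l _ (qabsD _ _))) ?exprn_ge0 ?(ltW zp)// mulrDr lerD//.
by rewrite (le_trans _ hS)// ler_piMl ?qabs_ge0// exprn_ile1 ?ltW.
Qed.

Lemma bilateral_sumD (u v : int -> H) s t : is_bilateral_sum u s -> is_bilateral_sum v t ->
  is_bilateral_sum (fun n => u n + v n) (s + t).
Proof.
have key (u' v' : nat -> H) (a b : H) : series u' @ \oo --> a -> series v' @ \oo --> b ->
    series (fun n => u' n + v' n) @ \oo --> a + b.
  move=> h1 h2; have : series u' n + series v' n @[n --> \oo] --> a + b by exact: cvgD.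
  apply: cvg_trans; apply: near_eq_cvg; apply: nearW => n /=.
  by rewrite !seriesEord/= -big_split.
move=> [s1 [s2 [h1 h2 ->]]] [t1 [t2 [k1 k2 ->]]]; exists (s1 + t1), (s2 + t2).
split; [exact: key h1 k1|exact: key h2 k2|by rewrite addrACA].
Qed.

Lemma bilateral_sumMl c (u : int -> H) s : is_bilateral_sum u s ->
  is_bilateral_sum (fun n => c * u n) (c * s).
Proof.
have key (v : nat -> H) (t : H) : series v @ \oo --> t -> series (fun n => c * v n) @ \oo --> c * t.
  move=> h; have : c * series v n @[n --> \oo] --> c * t.
    by apply: cvgqM => //; exact: cvg_cst.
  apply: cvg_trans; apply: near_eq_cvg; apply: nearW => n /=.
  by rewrite !seriesEord/= mulr_sumr.
move=> [s1 [s2 [h1 h2 ->]]]; exists (c * s1), (c * s2); split; last by rewrite mulrDr.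
  exact: key h1.
exact: key h2.
Qed.

Lemma holo_line I W V f : (forall z, V z -> cline I z -> W z) -> holo I W f -> holo I V f.
Proof. by move=> VW [d h]; exists d => z /VW Wz Iz; apply: h => //; exact: Wz. Qed.

(** The Laurent series is the power series of (z - p)^m f divided by (z - p)^m, that is, with
    indices shifted by m. *)
Lemma moderate_line_sum I W f p : SS I -> cline I p -> holo I W f ->
  (exists2 r, 0 < r & forall z, cline I z -> pdisc p r z -> W z) -> moderate f I p ->
  exists (A : int -> H) (m : nat) (r : R), [/\ 0 < r,
    forall k : nat, (m < k)%N -> A (- k%:Z) = 0 &
    forall z, cline I z -> pdisc p r z -> is_bilateral_sum (fun n => (z - p) ^ n * A n) (f z)].
Proof.
move=> SI Ip hf [r1 r10 hr1] hm.
have hf' : holo I (pdisc p r1) f by apply: holo_line hf => z dz Iz; exact: hr1.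
have [m [a [r [K [r0 K0 h]]]]] := moderate_series SI Ip r10 hf' hm.
(* [Negz k] is - (k + 1), whence the index m - (k + 1) and the cutoff k < m. *)
pose A (n : int) := match n with Posz k => a (m + k)%N
  | Negz k => if (k < m)%N then a (m - k.+1)%N else 0 end.
exists A, m, r; split=> //.
  by case=> // k mk; rewrite -NegzE /A ltnNge -ltnS mk.
move=> z Iz /andP[z0 zr]; set zeta := z - p in h *.
have zn0 : zeta != 0 by rewrite -qabs_gt0.
have zm0 : zeta ^+ m != 0 by rewrite -qabs_gt0 qabsX exprn_gt0.
pose t := (zeta ^+ m)^-1 * \sum_(k < m) zeta ^+ k * a k.
have q0 : 0 <= qabs zeta / (2 * r) by rewrite divr_ge0 ?qabs_ge0// mulr_ge0// ltW.
have q1 : qabs zeta / (2 * r) < 1.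
  by rewrite ltr_pdivrMr ?mulr_gt0// mul1r (lt_trans zr)// ltr_pMl// ltr1n.
exists (f z - t), t; split; last by rewrite subrK.
- apply: (@cvg_qabs_squeeze _ _ \oo _ _ _ (fun n => (qabs (zeta ^+ m))^-1 * K * (qabs zeta / (2 * r)) ^+ n)).
    (* The empty partial sum is skipped because the estimate of [moderate_series] concerns n + 1
       terms. *)
    exists 1%N => // -[//|n] _ /=; rewrite seriesEord/=.
    have -> : \sum_(k < n.+1) zeta ^ k * a (m + k)%N - (f z - t) =
       - ((zeta ^+ m)^-1 * (zeta ^+ m * f z - \sum_(k < (m + n).+1) zeta ^+ k * a k)).
      rewrite -addnS big_split_ord/= mulrBr mulrA mulVq// mul1r mulrDr -/t opprB.
      rewrite opprB addrA; congr (_ - _); rewrite addrC; congr (_ + _).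
      rewrite mulr_sumr; apply: eq_bigr => k _.
      by rewrite exprD !mulrA mulVq// mul1r.
    rewrite qabsN qabsM qabsV -mulrA ler_wpM2l ?invr_ge0 ?qabs_ge0//.
    have := h z (m + n)%N Iz; rewrite z0 (ltW zr) => /(_ isT)/le_trans; apply.
    by rewrite ler_wpM2l// ler_wiXn2l ?ltnS ?leq_addl// ltW.
  rewrite -[X in _ --> X](mulr0 ((qabs (zeta ^+ m))^-1 * K)).
  apply: cvgM; first exact: cvg_cst.
  by apply: cvg_expr; rewrite ger0_norm.
- have : (fun=> t) @ \oo --> t by exact: cvg_cst.
  apply: cvg_trans; apply: near_eq_cvg; exists m => // n /= mn.
  rewrite seriesEord/= -(subnKC mn) big_split_ord/= [X in _ = _ + X]big1 ?addr0; last first.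
    by move=> k _; rewrite -NegzE /A ltnNge leq_addr mulr0.
  rewrite /t mulr_sumr (reindex_inj rev_ord_inj)/=; apply: eq_bigr => k _.
  rewrite -NegzE /A ltn_ord mulrA; congr (_ * _).
  have -> : zeta ^ Negz k = (zeta ^+ k.+1)^-1 by [].
  have e : zeta ^+ m = zeta ^+ (m - k.+1) * zeta ^+ k.+1 by rewrite -exprD subnK.
  apply: (mulqI zm0); rewrite mulrA mulqV// mul1r [X in _ = X / _]e -mulrA mulqV ?mulr1//.
  by rewrite -qabs_gt0 qabsX exprn_gt0.
Qed.

(** The expansion is known on one line through [p]. For a nonreal [p] a small annulus lies in it;
    for a real [p] the representation formula, being linear in the values, carries the series to the
    other lines. *)
Lemma moderate_pole W f p : symmetric_slice_domain W -> regular W f -> singularity W p ->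
  (forall I, SS I -> cline I p -> moderate f I p) -> pole W f p.
Proof.
move=> ssdW rf sWp hm; have [sW [oW _ _ _]] := ssdW.
have [I SI [x0 [y0 [_ pE]]]] := cline_ex p.
have Ip : cline I p by rewrite pE; exact: cline_cpoint.
have hf : holo I W f by apply: (regularP f oW).1.
have [A [m [r [r0 Am hA]]]] := moderate_line_sum SI Ip hf ((singularity_line sW SI Ip).1 sWp) (hm I SI Ip).
(* For a nonreal [p] the radius must not exceed |Im p|, so that [annulus_small] applies. *)
pose r1 := if y0 == 0 then r else Num.min r `|y0|.
have r10 : 0 < r1 by rewrite /r1; case: eqVneq => // y0n; rewrite lt_min r0 normr_gt0.
have r1r : r1 <= r by rewrite /r1; case: ifP => // _; rewrite ge_min lexx.
have [s [s0 sr hs]] := singularity_sub sWp r10.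
exists s, A; split=> //; last by exists m.
exists (fun n => qext I (fun z => (z - p) ^ n)); split=> [n|q aq].
  exact: star_power_qext.
have Wq := hs q aq; rewrite (regular_rep ssdW rf SI Wq).
have [Iq|nIq] := pselect (cline I q).
  rewrite qext_id//; have -> : (fun n => qext I (fun z => (z - p) ^ n) q * A n) = (fun n => (q - p) ^ n * A n).
    by apply/funext => n; rewrite qext_id.
  apply: hA => //; apply: (pdiscW (le_trans sr r1r)).
  exact/(annulus_line s SI Ip Iq).
have y00 : y0 = 0.
  apply/eqP; apply: contrapT => /negP y0n; apply: nIq.
  rewrite pE in aq; apply: annulus_small aq => //.
  by rewrite (le_trans sr)// /r1 (negbTE y0n) ge_min lexx orbT.
have pr : p = x0 *: 1 by rewrite pE y00 /cpoint scale0r addr0.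
have [J SJ [x [y [_ qE]]]] := cline_ex q.
have dq : pdisc p s q by move: aq; rewrite pr => /annulus_real.
have cB K (v : R) : cpoint x v K - p = cpoint (x - x0) v K.
  by rewrite pr /cpoint addrAC scalerBl.
have dI (v : R) : v ^+ 2 = y ^+ 2 -> pdisc p r (cpoint x v I).
  move=> e; apply: (pdiscW (le_trans sr r1r)); move: dq.
  by rewrite /pdisc/= qE !cB !qabs_cpoint// e.
have h1 := hA _ (cline_cpoint I x y) (dI y erefl).
have h2 := hA _ (cline_cpoint I x (- y)) (dI (- y) (sqrrN y)).
rewrite qE qextE// /rep.
have -> : (fun n => qext I (fun z => (z - p) ^ n) (cpoint x y J) * A n) =
   (fun n => (2^-1 *: 1) * ((1 - J * I) * ((cpoint x y I - p) ^ n * A n) +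
      (1 + J * I) * ((cpoint x (- y) I - p) ^ n * A n))).
  by apply/funext => n; rewrite qextE// /rep -!scalerAl mul1r mulrDl !mulrA.
set S := (1 - J * I) * f _ + (1 + J * I) * f _.
have -> : 2^-1 *: S = (2^-1 *: 1) * S by rewrite -scalerAl mul1r.
by apply: bilateral_sumMl; apply: bilateral_sumD; exact: bilateral_sumMl.
Qed.

End Poles.

(** * The star product *)

Section StarAlgebra.
Variable R : realType.
Local Notation H := (quat R).
Local Notation SS := (@imag_units R).
Implicit Types (p q z w I J K a b c : H) (f g h : H -> H) (W A Omega : set H) (x y r : R).

(* An imaginary unit whose line contains [q], arbitrary for real [q]; the formulas
   below do not depend on the choice since conj q = q there. *)
Definition iunit q : H :=
  if qim q == 0 then mkq 0 1 0 0 else (qabs (qim q))^-1 *: qim q.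

Lemma qproj_oppI I a : qproj (- I) a = qproj I a.
Proof. by rewrite /qproj mulNr mulrN mulNr opprK. Qed.
Lemma qproj'_oppI I a : qproj' (- I) a = qproj' I a.
Proof. by rewrite /qproj' mulNr mulrN mulNr opprK. Qed.

Lemma iunit_cpoint I x y : SS I -> y != 0 -> iunit (cpoint x y I) = I \/ iunit (cpoint x y I) = - I.
Proof.
move=> SI y0; rewrite /iunit qim_cpoint// scaler_eq0 (negbTE y0) (negbTE (SS_neq0 SI))/=.
rewrite qabsZ (SSabs SI) mulr1 scalerA.
have [yp|yn] := ltP 0 y; first by left; rewrite gtr0_norm// mulVf// scale1r.
by right; rewrite ler0_norm// invrN mulNr mulVf// scaleN1r.
Qed.

Lemma iunit_SS q : SS (iunit q).
Proof.
have [I SI [x [y [_ ->]]]] := cline_ex q.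
have [->|y0] := eqVneq y 0.
  by rewrite /iunit qim_cpoint// scale0r eqxx; exact: SSi.
by have [->|->] := iunit_cpoint x SI y0 => //; exact: SSN.
Qed.

Lemma iunit_cline q : cline (iunit q) q.
Proof.
have [I SI [x [y [_ ->]]]] := cline_ex q.
have [->|y0] := eqVneq y 0.
  rewrite {2}/cpoint scale0r addr0; apply: cline_real; exact: iunit_SS.
by have [->|->] := iunit_cpoint x SI y0; [|apply/clineN_unit]; exact: cline_cpoint.
Qed.

Lemma qproj_iunit I z : SS I -> cline I z -> qconj z = z \/
  (forall a, qproj (iunit z) a = qproj I a) /\ (forall a, qproj' (iunit z) a = qproj' I a).
Proof.
move=> SI [x [y ->]]; have [->|y0] := eqVneq y 0; first by left; rewrite cpoint_conj// oppr0.
right; have [->|->] := iunit_cpoint x SI y0 => //.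
by split=> a; [exact: qproj_oppI|exact: qproj'_oppI].
Qed.

Lemma qproj'_conj I a : SS I -> qproj' I (qconj a) = - qproj' I a.
Proof.
move=> SI; rewrite qconjE qproj'B cline_proj' ?sub0r//; exact: cline_real.
Qed.
Lemma conj_qproj' I a : SS I -> qconj (qproj' I a) = - qproj' I a.
Proof.
move=> SI; rewrite -qproj'_conj// /qproj' qconjZ qconjD !qconjM !(SSconj SI).
by rewrite mulrN mulNr mulrN opprK mulrA.
Qed.

Lemma qconj_split I a : SS I -> qconj (qproj I a) - qproj' I a = qconj a.
Proof. by move=> SI; rewrite -(conj_qproj' a SI) -qconjD -qproj_decomp. Qed.

Definition sprod f g z : H :=
  qproj (iunit z) (f z) * g z + qproj' (iunit z) (f z) * g (qconj z).
(* The regular conjugate f^c. *)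
Definition scj f z : H := qconj (qproj (iunit z) (f (qconj z))) - qproj' (iunit z) (f z).

Lemma sprodE I f g z : SS I -> cline I z ->
  sprod f g z = qproj I (f z) * g z + qproj' I (f z) * g (qconj z).
Proof.
move=> SI Iz; rewrite /sprod; have [e|[e1 e2]] := qproj_iunit SI Iz; last by rewrite e1 e2.
by rewrite !e -!mulrDl -!qproj_decomp.
Qed.

Lemma scjE I f z : SS I -> cline I z ->
  scj f z = qconj (qproj I (f (qconj z))) - qproj' I (f z).
Proof.
move=> SI Iz; rewrite /scj; have [e|[e1 e2]] := qproj_iunit SI Iz; last by rewrite e1 e2.
by rewrite !e !qconj_split//; exact: iunit_SS.
Qed.

Lemma qprojD I a b : qproj I (a + b) = qproj I a + qproj I b.
Proof. by rewrite -{1}[b]opprK qprojB; congr (_ + _); rewrite -[- b]sub0r qprojB /qproj !(mulr0, mul0r, subr0, scaler0) sub0r opprK. Qed.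
Lemma qproj'D I a b : qproj' I (a + b) = qproj' I a + qproj' I b.
Proof. by rewrite -{1}[b]opprK qproj'B; congr (_ + _); rewrite -[- b]sub0r qproj'B /qproj' !(mulr0, mul0r, addr0, scaler0) sub0r opprK. Qed.

Lemma anti_proj I a : SS I -> I * a = - (a * I) -> qproj I a = 0.
Proof. by move=> SI e; rewrite /qproj e mulNr SSKr// opprK subrr scaler0. Qed.
Lemma anti_proj' I a : SS I -> I * a = - (a * I) -> qproj' I a = a.
Proof. by move=> SI e; rewrite /qproj' e mulNr SSKr// opprK qhalf. Qed.

Section Line.
Variables (I : H).
Hypothesis SI : SS I.
Local Notation P := (qproj I).
Local Notation Q := (qproj' I).

Lemma P_line a : cline I (P a). Proof. exact: qproj_cline. Qed.
Lemma Q_anti a : I * Q a = - (Q a * I). Proof. exact: qproj'_anti. Qed.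
Lemma anti_mul_line a b : I * a = - (a * I) -> I * b = - (b * I) -> cline I (a * b).
Proof.
move=> ha hb; apply/clineP => //.
by rewrite mulrA ha mulNr -[a * I * b]mulrA hb mulrN opprK mulrA.
Qed.
Lemma line_mul_anti a b : cline I a -> I * b = - (b * I) -> I * (a * b) = - (a * b * I).
Proof. by move=> /(clineP SI) ha hb; rewrite mulrA ha -[a * I * b]mulrA hb mulrN mulrA. Qed.
Lemma anti_mul_line2 a b : I * a = - (a * I) -> cline I b -> I * (a * b) = - (a * b * I).
Proof. by move=> ha /(clineP SI) hb; rewrite mulrA ha mulNr -[a * I * b]mulrA hb mulrA. Qed.

(* The grading of the quaternions by commutation or anticommutation with [I]. *)
Lemma P_mul a b : P (a * b) = P a * P b + Q a * Q b.
Proof.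
rewrite {1}(qproj_decomp I a) {1}(qproj_decomp I b) mulrDl !mulrDr !qprojD.
rewrite (cline_proj SI (clineM SI (P_line a) (P_line b))).
rewrite (anti_proj SI (line_mul_anti (P_line a) (Q_anti b))).
rewrite (anti_proj SI (anti_mul_line2 (Q_anti a) (P_line b))).
by rewrite (cline_proj SI (anti_mul_line (Q_anti a) (Q_anti b))) addr0 add0r.
Qed.
Lemma Q_mul a b : Q (a * b) = P a * Q b + Q a * P b.
Proof.
rewrite {1}(qproj_decomp I a) {1}(qproj_decomp I b) mulrDl !mulrDr !qproj'D.
rewrite (cline_proj' SI (clineM SI (P_line a) (P_line b))).
rewrite (anti_proj' SI (line_mul_anti (P_line a) (Q_anti b))).
rewrite (anti_proj' SI (anti_mul_line2 (Q_anti a) (P_line b))).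
by rewrite (cline_proj' SI (anti_mul_line (Q_anti a) (Q_anti b))) addr0 add0r.
Qed.
Lemma PP a : P (P a) = P a. Proof. exact/cline_proj/P_line. Qed.
Lemma QP a : Q (P a) = 0. Proof. exact/cline_proj'/P_line. Qed.
Lemma PQ a : P (Q a) = 0. Proof. exact/anti_proj/Q_anti. Qed.
Lemma QQ a : Q (Q a) = Q a. Proof. exact/anti_proj'/Q_anti. Qed.
Definition gradeE := (qprojD, qproj'D, P_mul, Q_mul, PP, QP, PQ, QQ, mul0r, mulr0, add0r, addr0).
End Line.

(** An odd factor moves the evaluation of what stands to its right to the conjugate point; as
    degrees add, both bracketings give the same four terms. *)
Lemma sprodA f g h z : sprod f (sprod g h) z = sprod (sprod f g) h z.
Proof.
have SI := iunit_SS z; have Iz := iunit_cline z; move: (iunit z) SI Iz => I SI Iz.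
have Ic := cline_conj SI Iz.
rewrite !(sprodE _ _ SI Iz) !(sprodE _ _ SI Ic) qconjK !(gradeE SI).
by rewrite !mulrDr !mulrDl !mulrA [X in _ + X = _]addrC addrACA.
Qed.

Lemma sprodDl f g h z : sprod (fun q => f q + g q) h z = sprod f h z + sprod g h z.
Proof.
rewrite /sprod qprojD qproj'D !mulrDl.
by rewrite addrACA.
Qed.
Lemma sprodDr f g h z : sprod h (fun q => f q + g q) z = sprod h f z + sprod h g z.
Proof. by rewrite /sprod !mulrDr addrACA. Qed.
Lemma sprod1l g z : sprod (fun=> 1) g z = g z.
Proof.
have SI := iunit_SS z.
by rewrite /sprod cline_proj ?cline_proj' ?mul1r ?mul0r ?addr0//; exact: cline1.
Qed.
Lemma sprod1r f z : sprod f (fun=> 1) z = f z.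
Proof. by rewrite /sprod !mulr1 -qproj_decomp. Qed.

(* The symmetrization f^s. *)
Definition snorm f := sprod f (scj f).

Lemma snormE I f z : SS I -> cline I z -> snorm f z =
  qproj I (f z) * qconj (qproj I (f (qconj z))) - qproj' I (f z) * qproj' I (f (qconj z)).
Proof.
move=> SI Iz; have Ic := cline_conj SI Iz.
rewrite /snorm (sprodE _ _ SI Iz) (scjE _ SI Iz) (scjE _ SI Ic) qconjK !mulrBr.
rewrite (cline_anti SI (cline_conj SI (P_line SI _)) (Q_anti SI _)) qconjK.
by rewrite addrA subrK.
Qed.

Lemma snorm_line I f z : SS I -> cline I z -> cline I (snorm f z).
Proof.
move=> SI Iz; rewrite (snormE _ SI Iz); apply: clineB => //.
  by apply: clineM => //; [exact: P_line|apply: cline_conj => //; exact: P_line].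
by apply: anti_mul_line => //; exact: Q_anti.
Qed.

Lemma snorm_conj f z : snorm f (qconj z) = qconj (snorm f z).
Proof.
have SI := iunit_SS z; have Iz := iunit_cline z; move: (iunit z) SI Iz => I SI Iz.
have Ic := cline_conj SI Iz.
rewrite (snormE _ SI Iz) (snormE _ SI Ic) qconjK qconjB !qconjM !qconjK.
by rewrite !conj_qproj'// mulrN mulNr opprK.
Qed.

(** At real points the symmetrization is |f|^2; this is what prevents it from vanishing when f is
    not 0. *)
Lemma snorm_selfconj f z : qconj z = z -> snorm f z = qdot (f z) (f z) *: 1.
Proof.
move=> e; have SI := iunit_SS z; have Iz := iunit_cline z; move: (iunit z) SI Iz => I SI Iz.
rewrite (snormE _ SI Iz) e -qmul_conj [in RHS](qproj_decomp I (f z)) qconjD conj_qproj'//.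
rewrite mulrDl !mulrBr (cline_anti SI (cline_conj SI (P_line SI _)) (Q_anti SI _)) qconjK.
by rewrite addrA subrK.
Qed.

Lemma sprod_scj_l f z : sprod (scj f) f z = snorm f z.
Proof.
have SI := iunit_SS z; have Iz := iunit_cline z; move: (iunit z) SI Iz => I SI Iz.
have Ic := cline_conj SI Iz.
rewrite (snormE _ SI Iz) (sprodE _ _ SI Iz) (scjE _ SI Iz) qprojB qproj'B.
have Pc := cline_conj SI (P_line SI (f (qconj z))).
rewrite (cline_proj SI Pc) (cline_proj' SI Pc) (PQ SI) (QQ SI) subr0 sub0r.
move: (f z) (f (qconj z)) Pc => a b Pc.
rewrite {1}(qproj_decomp I a) {2}(qproj_decomp I b) mulrDr mulNr mulrDr opprD.
rewrite (cline_anti SI (P_line SI b) (Q_anti SI a)) (cline_comm SI Pc (P_line SI a)).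
by rewrite addrA addrK.
Qed.

(** The inverse of f^s can be pulled out on the left: it commutes with P f, while crossing Q f
    conjugates it, which cancels the conjugation due to its evaluation at conj z. *)
Lemma sprod_inv_r f z : snorm f z != 0 ->
  sprod f (fun q => (snorm f q)^-1 * scj f q) z = 1.
Proof.
have SI := iunit_SS z; have Iz := iunit_cline z; move: (iunit z) SI Iz => I SI Iz n0.
have Ic := cline_conj SI Iz.
have nl := snorm_line f SI Iz.
rewrite (sprodE _ _ SI Iz) !mulrA snorm_conj.
rewrite (cline_comm SI (P_line SI _) (clineV SI nl)).
have e : (qconj (snorm f z))^-1 = qconj (snorm f z)^-1.
  have c0 : qconj (snorm f z) != 0 by rewrite -qabs_eq0 qabs_conj qabs_eq0.
  apply: (mulqI c0); rewrite mulqV// -qconjM mulVq// qconj1.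
  by [].
rewrite e (cline_anti SI (cline_conj SI (clineV SI nl)) (Q_anti SI _)) qconjK.
by rewrite -!mulrA -mulrDr -(sprodE _ _ SI Iz) mulVq.
Qed.

Lemma sprod_inv_l f z : snorm f z != 0 ->
  sprod (fun q => (snorm f q)^-1 * scj f q) f z = 1.
Proof.
have SI := iunit_SS z; have Iz := iunit_cline z; move: (iunit z) SI Iz => I SI Iz n0.
have nl := clineV SI (snorm_line f SI Iz).
rewrite (sprodE _ _ SI Iz) qprojM// qproj'M// -!mulrA -mulrDr -(sprodE _ _ SI Iz).
by rewrite sprod_scj_l mulVq.
Qed.

Lemma qabs_qproj I a : SS I -> qabs (qproj I a) <= qabs a.
Proof.
move=> SI; rewrite /qproj qabsZ ger0_norm ?invr_ge0//.
have h := qabsB a (I * a * I); rewrite !qabsM (SSabs SI) mul1r mulr1 in h.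
by rewrite mulrC ler_pdivrMr// mulr_natr mulr2n.
Qed.
Lemma qabs_qproj' I a : SS I -> qabs (qproj' I a) <= qabs a.
Proof.
move=> SI; rewrite /qproj' qabsZ ger0_norm ?invr_ge0//.
have h := qabsD a (I * a * I); rewrite !qabsM (SSabs SI) mul1r mulr1 in h.
by rewrite mulrC ler_pdivrMr// mulr_natr mulr2n.
Qed.

Lemma holo_sprod I W f g : SS I -> symmetric_set W -> open W -> holo I W f -> holo I W g ->
  holo I W (sprod f g).
Proof.
move=> SI sW oW hf hg.
have Wc z : W z -> W (qconj z) by exact: sym_conj.
apply: (@holo_congr _ _ _ (fun z => qproj I (f z) * g z + qproj' I (f z) * g (qconj z))) => //.
  by move=> z _ Iz; rewrite (sprodE _ _ SI Iz).
apply: holoD.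
  by apply: holoM => //; [move=> z _ _; exact: P_line|exact: holo_proj].
by apply: holoM_twist => //; [move=> z _ _; exact: Q_anti|exact: holo_proj'].
Qed.

Lemma holo_scj I W f : SS I -> symmetric_set W -> open W -> holo I W f -> holo I W (scj f).
Proof.
move=> SI sW oW hf.
have Wc z : W z -> W (qconj z) by exact: sym_conj.
apply: (@holo_congr _ _ _ (fun z => qconj (qproj I (f (qconj z))) - qproj' I (f z))) => //.
  by move=> z _ Iz; rewrite (scjE _ SI Iz).
by apply: holoB => //; [exact: holo_conj_proj|exact: holo_proj'].
Qed.

Lemma moderate_le f g I p : (forall z, cline I z -> qabs (g z) <= qabs (f z)) ->
  moderate f I p -> moderate g I p.
Proof.
move=> h [m [C [r [r0 hC]]]]; exists m, C, r; split=> // z Iz dz.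
by apply: le_trans (hC z Iz dz); rewrite ler_wpM2l ?exprn_ge0 ?qabs_ge0 ?h.
Qed.

Lemma moderateM f g I p : moderate f I p -> moderate g I p -> moderate (fun z => f z * g z) I p.
Proof.
move=> [m [C [r [r0 hC]]]] [n [B [s [s0 hB]]]]; exists (m + n)%N, (C * B), (Num.min r s).
split; first by rewrite lt_min r0.
move=> z Iz dz; rewrite exprD qabsM mulrACA; apply: ler_pM; rewrite ?mulr_ge0 ?exprn_ge0 ?qabs_ge0//.
  by apply: hC => //; apply: pdiscW dz; rewrite ge_min lexx.
by apply: hB => //; apply: pdiscW dz; rewrite ge_min lexx orbT.
Qed.

(** Below radius 1 the exponent may be raised, so that two functions can share one. *)
Lemma moderate_exp f I p : moderate f I p -> exists (m : nat) (C r : R),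
  0 < r /\ forall n z, (m <= n)%N -> cline I z -> pdisc p r z -> qabs (z - p) ^+ n * qabs (f z) <= C.
Proof.
move=> [m [C [r [r0 hC]]]]; exists m, C, (Num.min r 1); split; first by rewrite lt_min r0/=.
move=> n z mn Iz dz; have /andP[z0] := dz; rewrite lt_min => /andP[zr z1].
apply: le_trans (hC z Iz _); last by apply: pdiscW dz; rewrite ge_min lexx.
by rewrite ler_wpM2r ?qabs_ge0// ler_wiXn2l// ltW.
Qed.

Lemma moderateD f g I p : moderate f I p -> moderate g I p -> moderate (fun z => f z + g z) I p.
Proof.
move=> /moderate_exp[m [C [r [r0 hC]]]] /moderate_exp[n [B [s [s0 hB]]]].
exists (maxn m n), (C + B), (Num.min r s).
split; first by rewrite lt_min r0.
move=> z Iz dz; apply: (@le_trans _ _ (qabs (z - p) ^+ maxn m n * (qabs (f z) + qabs (g z)))).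
  by rewrite ler_wpM2l ?exprn_ge0 ?qabs_ge0 ?qabsD.
rewrite mulrDr lerD//.
  by apply: hC => //; [exact: leq_maxl|apply: pdiscW dz; rewrite ge_min lexx].
by apply: hB => //; [exact: leq_maxr|apply: pdiscW dz; rewrite ge_min lexx orbT].
Qed.

Lemma moderate_conj f I p : SS I -> moderate f I (qconj p) -> moderate (fun z => f (qconj z)) I p.
Proof.
move=> SI [m [C [r [r0 hC]]]]; exists m, C, r; split=> // z Iz dz.
have e : qabs (qconj z - qconj p) = qabs (z - p) by rewrite -qconjB qabs_conj.
by rewrite -e; apply: hC; [exact: cline_conj|rewrite /pdisc/= e].
Qed.

(** The growth of [g] at conj p enters through the term g (conj z). *)
Lemma moderate_sprod f g I p : SS I -> moderate f I p -> moderate g I p ->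
  moderate g I (qconj p) -> moderate (sprod f g) I p.
Proof.
move=> SI hf hg hgc.
apply: (@moderate_congr _ (fun z => qproj I (f z) * g z + qproj' I (f z) * g (qconj z)) _ _ _ 1) => //.
  by move=> z Iz _; rewrite (sprodE _ _ SI Iz).
apply: moderateD; apply: moderateM => //; last exact: moderate_conj.
  by apply: moderate_le hf => z _; exact: qabs_qproj.
by apply: moderate_le hf => z _; exact: qabs_qproj'.
Qed.

Lemma moderate_scj f I p : SS I -> moderate f I p -> moderate f I (qconj p) ->
  moderate (scj f) I p.
Proof.
move=> SI hf hfc.
apply: (@moderate_congr _ (fun z => qconj (qproj I (f (qconj z))) + - qproj' I (f z)) _ _ _ 1) => //.
  by move=> z Iz _; rewrite (scjE _ SI Iz).
apply: moderateD.
  apply: moderate_le (moderate_conj SI hfc) => z _.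
  by rewrite qabs_conj; exact: qabs_qproj.
by apply: moderate_le hf => z _; rewrite qabsN; exact: qabs_qproj'.
Qed.

End StarAlgebra.

Section ZeroSet.
Variable R : realType.
Local Notation H := (quat R).
Local Notation SS := (@imag_units R).
Implicit Types (I J : H) (f : H -> H) (W : set H) (x y : R).

(** The value at x + y I is a combination of those at x + y J and x - y J, and the symmetry under
    conjugation makes both vanish. *)
Lemma regular_zero_sym W f I J x y : symmetric_slice_domain W -> regular W f ->
  SS I -> SS J -> W (cpoint x y I) -> (forall z, f (qconj z) = qconj (f z)) ->
  f (cpoint x y J) = 0 -> f (cpoint x y I) = 0.
Proof.
move=> ssd rf SI SJ WI fc fJ.
rewrite (regular_rep ssd rf SJ WI) qextE// /rep -(cpoint_conj SJ) fc fJ.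
by rewrite qconj0 !mulr0 addr0 scaler0.
Qed.

End ZeroSet.

(** * Agreement with the star product defined by splittings *)

Section StarProduct.
Variable R : realType.
Local Notation H := (quat R).
Local Notation SS := (@imag_units R).
Implicit Types (p q z w I J K a b c : H) (f g h : H -> H) (W A Omega : set H) (x y r : R).

Lemma orthogonal_anti I J : SS I -> SS J -> qdot I J = 0 -> I * J = - (J * I).
Proof.
move=> SI SJ IJ; rewrite (qproj_decomp I J) (qproj_cpoint SI) (SSre SJ) qdotC IJ.
by rewrite /cpoint !scale0r !add0r; exact: qproj'_anti.
Qed.

Lemma orthogonal_ex I : SS I -> exists2 J, SS J & qdot I J = 0.
Proof.
move=> SI.
have key v : qre v = 0 -> v != 0 -> qdot I v = 0 -> exists2 J, SS J & qdot I J = 0.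
  move=> v0 vn Iv; exists ((qabs v)^-1 *: v).
    apply/imag_unitsP; rewrite qreZ v0 mulr0; split=> //.
    rewrite -qabs_sqr qabsZ ger0_norm ?invr_ge0 ?qabs_ge0// mulVf ?expr1n//.
    by rewrite qabs_eq0.
  rewrite -(mulr0 (qabs v)^-1) -Iv /qdot !qcoordZ; ring.
(* This vector is orthogonal to [I]; if it is 0, then [I] has no i component and [J] = i is
   orthogonal to it. *)
have [e|e] := eqVneq (mkq 0 (- qcj I) (qci I) 0) 0; last first.
  by apply: (key _ _ e); rewrite ?mkqE// /qdot !mkqE; ring.
exists (mkq 0 1 0 0); first exact: SSi.
have := congr1 (@qcj R) e; rewrite mkqE qcj0 => b0.
by rewrite /qdot !mkqE b0; ring.
Qed.

(** As [J] anticommutes with [I], the even part of f is F and the odd part is G J; moving [J] to the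
    right of the values at conj z conjugates them. *)
Lemma sprod_split I J f g z F G K L K' L' : SS I -> SS J -> qdot I J = 0 -> cline I z ->
  cline I F -> cline I G -> cline I K' -> cline I L' ->
  f z = F + G * J -> g z = K + L * J -> g (qconj z) = K' + L' * J ->
  sprod f g z = (F * K - G * qconj L') + (F * L + G * qconj K') * J.
Proof.
move=> SI SJ IJ Iz IF IG IK IL fE gE gE'.
have JA := orthogonal_anti SI SJ IJ.
have GJ := line_mul_anti SI IG JA.
rewrite (sprodE _ _ SI Iz) fE gE gE' qprojD qproj'D.
rewrite (cline_proj SI IF) (cline_proj' SI IF) (anti_proj SI GJ) (anti_proj' SI GJ) addr0 add0r.
rewrite !mulrDr !mulrA -[G * J * K']mulrA -[G * J * L']mulrA.
rewrite (cline_anti SI IK JA) (cline_anti SI IL JA) !mulrA SSKr//.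
by rewrite mulrDl [X in _ + X = _]addrC addrACA.
Qed.

Lemma star_product_sprod W f g : symmetric_set W -> open W -> regular W f -> regular W g ->
  is_star_product W f g (sprod f g).
Proof.
move=> sW oW /(regularP _ oW) rf /(regularP _ oW) rg I J SI SJ IJ.
have JA := orthogonal_anti SI SJ IJ.
(* From G J = Q h and J^2 = -1 one gets G = - Q h J. *)
have split h : holo I W h -> splitting W I J h (fun z => qproj I (h z)) (fun z => - qproj' I (h z) * J).
  move=> hh; split.
  - by apply: holo_holomorphic => //; exact: holo_proj.
  - by apply: holo_holomorphic => //; apply: holoMr => //; apply: holoN => //; exact: holo_proj'.
  move=> z [Wz Iz]; split; [exact: P_line| |by rewrite mulNr mulNr SSKr// opprK -qproj_decomp].
  by rewrite mulNr; apply: clineN => //; apply: anti_mul_line => //; exact: Q_anti.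
have sf := split f (rf I SI); have sg := split g (rg I SI).
do 4 eexists; split; [exact: sf|exact: sg|split].
  by apply/regularP => // K SK; apply: holo_sprod => //; [exact: rf|exact: rg].
move=> z; rewrite inE => Wz; have Wc : slice W I (qconj z).
  by case: Wz => Wz Iz; split; [exact: sym_conj|exact: cline_conj].
have [_ _ /(_ z Wz)[F1 G1 fE]] := sf; have [_ _ sg'] := sg.
have [K1 L1 gE] := sg' z Wz; have [K2 L2 gE'] := sg' _ Wc.
exact: (sprod_split SI SJ IJ Wz.2 F1 G1 K2 L2 fE gE gE').
Qed.

(** The definition fixes the values of k on every line, in particular on the one through [z]. *)
Lemma star_product_uniq W f g k : symmetric_set W -> is_star_product W f g k ->
  forall z, W z -> k z = sprod f g z.
Proof.
move=> sW hk z Wz; have SI := iunit_SS z; have Iz := iunit_cline z.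
move: (iunit z) SI Iz => I SI Iz; have [J SJ IJ] := orthogonal_ex SI.
have [F [G [K [L [sf sg [_ hE]]]]]] := hk I J SI SJ IJ.
have Wz' : slice W I z by [].
have Wc : slice W I (qconj z) by split; [exact: sym_conj|exact: cline_conj].
rewrite hE ?inE//.
have [_ _ /(_ z Wz')[F1 G1 fE]] := sf; have [_ _ sg'] := sg.
have [K1 L1 gE] := sg' z Wz'; have [K2 L2 gE'] := sg' _ Wc.
by rewrite (sprod_split SI SJ IJ Iz F1 G1 K2 L2 fE gE gE').
Qed.

End StarProduct.

(** * The ring of semiregular functions *)

Section SemiregularOps.
Variables (R : realType) (Omega : set (quat R)).
Hypothesis hOmega : symmetric_slice_domain Omega.
Local Notation H := (quat R).
Local Notation SS := (@imag_units R).
Local Notation sreg := (semiregular Omega).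
Implicit Types (p q z I : H) (f g : H -> H) (W V : set H) (u v w : sreg).

Lemma srdom_open u : open (srdom u). Proof. by have [_ []] := srdom_ssd u. Qed.
Lemma srdom_sym u : symmetric_set (srdom u). Proof. by have [] := srdom_ssd u. Qed.
Arguments srdom_open : clear implicits.
Arguments srdom_sym : clear implicits.
Lemma sr_holo u I : SS I -> holo I (srdom u) u.
Proof. by move: I; apply/regularP; [exact: srdom_open|exact: srfun_regular]. Qed.

Lemma sr_sing u p : Omega p -> singularity (srdom u) p.
Proof.
move=> Op; have [du|ndu] := pselect (srdom u p).
  by apply: open_singularity => //; [exact: srdom_sym|exact: srdom_open].
have [[r [a [r0 h _ _]]]|[]//] := srfun_sing (conj Op ndu).
by exists r.
Qed.

Lemma sr_moderate u p I : Omega p -> SS I -> cline I p -> moderate u I p.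
Proof.
move=> Op SI Ip; have [du|ndu] := pselect (srdom u p).
  exact: (moderate_at Ip (srdom_open u) du (sr_holo u SI)).
have [h|h] := srfun_sing (conj Op ndu); first exact: pole_moderate h.
exact: removable_moderate h.
Qed.

(* Everything needed to make [f] a semiregular function with domain [W]. *)
Definition admissible W f := [/\ symmetric_set W, W `<=` Omega,
  (forall p, Omega p -> singularity W p), (forall I, SS I -> holo I W f)
  & forall p I, Omega p -> SS I -> cline I p -> moderate f I p].

Lemma admissible_ssd W f : admissible W f -> symmetric_slice_domain W.
Proof. by case=> sW WO sing _ _; exact: (ssd_codiscrete hOmega). Qed.
Lemma admissible_sub W f : admissible W f -> W `<=` Omega. Proof. by case. Qed.
Lemma admissible_regular W f : admissible W f -> regular W f.
Proof.
move=> h; have [_ [oW _ _ _]] := admissible_ssd h.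
by apply/(regularP _ oW); case: h.
Qed.
Lemma admissible_sing W f : admissible W f -> forall p, (Omega `\` W) p ->
  pole W f p \/ removable W f p.
Proof.
(* In the definition of a pole m = 0 is allowed, so removable singularities are covered by the first
   alternative. *)
move=> h p [Op _]; left; have [_ _ sing _ mod] := h.
apply: moderate_pole; [exact: admissible_ssd h|exact: admissible_regular|exact: sing|].
by move=> I; exact: mod.
Qed.

Definition mksr W f (h : admissible W f) : sreg := Semiregular (admissible_ssd h)
  (@admissible_sub W f h) (admissible_regular h) (admissible_sing h).

Lemma Omega_sing p : Omega p -> singularity Omega p.
Proof. by case: hOmega => sO [oO _ _ _]; exact: open_singularity. Qed.

Lemma Omega_conj p : Omega p -> Omega (qconj p).
Proof. by case: hOmega => sO _; exact: sym_conj. Qed.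

Lemma moderate_cst (c : H) I p : moderate (fun=> c) I p.
Proof.
by exists 0%N, (qabs c), 1; split=> // z _ _; rewrite expr0 mul1r.
Qed.

Lemma cst_admissible (c : H) : admissible Omega (fun=> c).
Proof.
split=> //; first by case: hOmega.
- by move=> p; exact: Omega_sing.
- by move=> I _; exact: holo_cst.
- by move=> p I _ _ _; exact: moderate_cst.
Qed.

Lemma srI_facts u v : [/\ symmetric_set (srdom u `&` srdom v), srdom u `&` srdom v `<=` Omega &
  forall p, Omega p -> singularity (srdom u `&` srdom v) p].
Proof.
split; first by apply: symI; exact: srdom_sym.
  by move=> q [/srdom_sub].
by move=> p Op; apply: singularityI; exact: sr_sing.
Qed.

Lemma srI_holo u v I : SS I ->
  holo I (srdom u `&` srdom v) u /\ holo I (srdom u `&` srdom v) v.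
Proof.
by move=> SI; split; [apply: holoW (sr_holo u SI)|apply: holoW (sr_holo v SI)] => q [].
Qed.

Lemma add_admissible u v : admissible (srdom u `&` srdom v) (fun q => u q + v q).
Proof.
have [h1 h2 h3] := srI_facts u v; split=> //.
  by move=> I SI; have [hu hv] := srI_holo u v SI; exact: holoD.
by move=> p I Op SI Ip; apply: moderateD; exact: sr_moderate.
Qed.

Lemma opp_admissible u : admissible (srdom u) (fun q => - u q).
Proof.
split; [exact: srdom_sym|exact: srdom_sub|by move=> p; exact: sr_sing| |].
  by move=> I SI; apply: holoN => //; exact: sr_holo.
move=> p I Op SI Ip; apply: moderate_le (sr_moderate u Op SI Ip) => z _.
by rewrite qabsN.
Qed.

Lemma mul_admissible u v : admissible (srdom u `&` srdom v) (sprod u v).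
Proof.
have [h1 h2 h3] := srI_facts u v; split=> //.
  move=> I SI; have [hu hv] := srI_holo u v SI; apply: holo_sprod => //.
  by apply: openI; exact: srdom_open.
move=> p I Op SI Ip; apply: moderate_sprod => //; apply: sr_moderate => //.
  exact: Omega_conj.
exact: cline_conj.
Qed.

Definition sconst c : sreg := mksr (cst_admissible c).
Definition sadd u v : sreg := mksr (add_admissible u v).
Definition sopp u : sreg := mksr (opp_admissible u).
Definition smul u v : sreg := mksr (mul_admissible u v).

(** On each line the points missing from [V] are isolated, so the equality reaches them by
    continuity of u - v. *)
Lemma coincide_on u v V : (forall p, Omega p -> singularity V p) ->
  (forall q, V q -> srdom u q -> srdom v q -> u q = v q) -> coincide u v.
Proof.
move=> sV h q; rewrite inE => -[du dv].
have [I SI [x [y [_ qE]]]] := cline_ex q.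
have Iq : cline I q by rewrite qE; exact: cline_cpoint.
have [r r0 hr] := sV q (srdom_sub du).
have oW : open (srdom u `&` srdom v) by apply: openI; exact: srdom_open.
have [s s0 hs] := pdisc_sub oW (conj du dv).
have [hu hv] := srI_holo u v SI.
apply/subr0_eq/eqP; apply: contrapT => /negP d0.
have /cvg_qabsP/(_ (qabs (u q - v q))) := holo_cvg (holoB SI hu hv) (conj du dv) Iq.
rewrite qabs_gt0 => /(_ d0)/sln_nearP[e e0 he].
have m0 : 0 < Num.min (Num.min r s) e by rewrite !lt_min r0 s0.
have [w [Iw dw]] := cline_near SI Iq m0.
have [wu wv] : (srdom u `&` srdom v) w.
  by apply/hs/(pdiscW _ dw); rewrite !ge_min lexx orbT.
have Vw : V w.
  by apply/hr/(annulus_line r SI Iq Iw)/(pdiscW _ dw); rewrite !ge_min lexx.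
have := he w Iw; rewrite (h w Vw wu wv) subrr sub0r qabsN ltxx => hw.
suff : false by [].
by apply: hw; case/andP: dw => _; rewrite lt_min => /andP[].
Qed.

Lemma coincide_refl u : coincide u u. Proof. by move=> q. Qed.
Lemma coincide_sym u v : coincide u v -> coincide v u.
Proof. by move=> h q; rewrite inE => -[dv du]; rewrite h// inE. Qed.
(** Where [v] is undefined, u = w is recovered by [coincide_on] from the points where [v] is
    defined. *)
Lemma coincide_trans v u w : coincide u v -> coincide v w -> coincide u w.
Proof.
move=> uv vw; apply: (@coincide_on u w (srdom v)); first by move=> p; exact: sr_sing.
by move=> q dv du dw; rewrite uv ?inE// vw ?inE.
Qed.

Lemma sadd_coincide u u' v v' : coincide u u' -> coincide v v' ->
  coincide (sadd u v) (sadd u' v').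
Proof.
by move=> uu vv q; rewrite inE/= => -[[du dv] [du' dv']]; rewrite uu ?vv ?inE.
Qed.
Lemma sopp_coincide u u' : coincide u u' -> coincide (sopp u) (sopp u').
Proof. by move=> uu q; rewrite inE/= => -[du du']; rewrite uu ?inE. Qed.
Lemma smul_coincide u u' v v' : coincide u u' -> coincide v v' ->
  coincide (smul u v) (smul u' v').
Proof.
move=> uu vv q; rewrite inE/= => -[[du dv] [du' dv']].
have cd w : srdom w q -> srdom w (qconj q) by apply: sym_conj; exact: srdom_sym.
by rewrite /sprod uu ?vv ?inE//; split; exact: cd.
Qed.

(** If f^s vanished on one slice, then |u|^2 would vanish at the real points, and u on every line by
    the identity theorem. *)
Lemma snorm_neq0_slice u I : ~ coincide u (sconst 0) -> SS I ->
  ~ forall z, slice (srdom u) I z -> snorm u z = 0.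
Proof.
move=> nu SI h; apply: nu => q; rewrite inE => -[du _] /=.
have [J SJ [x [y [_ qE]]]] := cline_ex q.
have [sW [oW _ [x0 Wx0] cW]] := srdom_ssd u.
apply: (identity_theorem SJ oW (cW J SJ) (sr_holo u SJ) (holo_cst _ _ _) Wx0).
  move=> x1 Wx1; have := h _ (conj Wx1 (cline_real SI x1)).
  rewrite snorm_selfconj ?qconjZ ?qconj1// => /eqP.
  rewrite scaler_eq0 oner_eq0 orbF => e.
  by apply/eqP; apply: contraTT e => /qdot_neq0.
by split=> //; rewrite qE; exact: cline_cpoint.
Qed.

Lemma snorm_holo u I : SS I -> holo I (srdom u) (snorm u).
Proof.
move=> SI; have sW := srdom_sym u; have oW := srdom_open u.
apply: holo_sprod => //; first exact: sr_holo.
by apply: holo_scj => //; exact: sr_holo.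
Qed.

Lemma scj_moderate u p I : Omega p -> SS I -> cline I p -> moderate (scj u) I p.
Proof.
move=> Op SI Ip; apply: moderate_scj => //; apply: sr_moderate => //.
  exact: Omega_conj.
exact: cline_conj.
Qed.

(** [p] may lie outside the domain of [u], so the local dichotomy is used at [p]. Its first
    alternative gives a disc of zeros near [p], which the dichotomy on the slice excludes at a point
    of the domain. *)
Lemma snorm_lower_bound u p I : ~ coincide u (sconst 0) -> Omega p -> SS I -> cline I p ->
  exists (k : nat) (c r : R), [/\ 0 < c, 0 < r & forall z, cline I z -> pdisc p r z ->
     srdom u z /\ c * qabs (z - p) ^+ k <= qabs (snorm u z)].
Proof.
move=> nu Op SI Ip; have sW := srdom_sym u.
have [r r0 hr] := (singularity_line sW SI Ip).1 (sr_sing u Op).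
have hn := snorm_holo u SI.
have hn' : holo I (pdisc p r) (snorm u) by apply: holo_line hn => z dz Iz; exact: hr.
have mn : moderate (snorm u) I p.
  apply: moderate_sprod => //; [exact: sr_moderate|exact: scj_moderate|].
  by apply: scj_moderate => //; [exact: Omega_conj|exact: cline_conj].
have [[s s0 hs]|[k [c [s [c0 s0 hs]]]]] := moderate_dichotomy SI Ip r0 hn' mn; last first.
  exists k, c, (Num.min r s); split=> //; first by rewrite lt_min r0.
  move=> z Iz dz; split; first by apply: hr => //; apply: pdiscW dz; rewrite ge_min lexx.
  by apply: hs => //; apply: pdiscW dz; rewrite ge_min lexx orbT.
exfalso; have m0 : 0 < Num.min r s by rewrite lt_min r0.
have [z [Iz dz]] := cline_near SI Ip m0.
have Wz : srdom u z by apply: hr => //; apply: pdiscW dz; rewrite ge_min lexx.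
have [_ [oW _ _ cW]] := srdom_ssd u.
have [h|h] := slice_dichotomy SI oW (cW I SI) hn; first exact: (snorm_neq0_slice nu SI).
have [t t0 ht] := h z (conj Wz Iz).
have [t' t'0 ht'] := pdisc_sub (@open_pdisc R p (Num.min r s)) dz.
have tt0 : 0 < Num.min t t' by rewrite lt_min t0.
have [w [Iw dw]] := cline_near SI Iz tt0.
have dw' : pdisc p (Num.min r s) w by apply/ht'/(pdiscW _ dw); rewrite ge_min lexx orbT.
have := ht w Iw (pdiscW _ dw); rewrite ge_min lexx => /(_ isT).
by rewrite hs ?eqxx//; apply: pdiscW dw'; rewrite ge_min lexx orbT.
Qed.

(** The lower bound on |f^s| serves twice: it shows that near each point of Omega the new domain
    misses at most the point itself on a line, and it bounds the growth of the inverse. *)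
Lemma inv_admissible u : ~ coincide u (sconst 0) ->
  admissible (srdom u `&` [set q | snorm u q != 0]) (fun q => (snorm u q)^-1 * scj u q).
Proof.
move=> nu; set W := _ `&` _; have sW := srdom_sym u; have oW := srdom_open u.
have sWW : symmetric_set W.
  move=> x y I SI [Wq nq] q [J SJ <-]; have WJ := sym_cpoint sW SI SJ Wq.
  split; first exact: WJ.
  have rn : regular (srdom u) (snorm u) by apply/regularP => // K; exact: snorm_holo.
  apply/negP => /eqP nJ; move/negP: nq; apply; apply/eqP.
  exact: (regular_zero_sym (srdom_ssd u) rn SI SJ Wq (snorm_conj u) nJ).
have sing p : Omega p -> singularity W p.
  move=> Op; have [I SI [x [y [_ pE]]]] := cline_ex p.
  have Ip : cline I p by rewrite pE; exact: cline_cpoint.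
  apply/(singularity_line sWW SI Ip).
  have [k [c [r [c0 r0 hr]]]] := snorm_lower_bound nu Op SI Ip.
  exists r => // z Iz dz; have [Wz hz] := hr z Iz dz; split; first exact: Wz.
  have n0 : 0 < qabs (snorm u z).
    by rewrite (lt_le_trans _ hz)// mulr_gt0// exprn_gt0//; case/andP: dz.
  by rewrite qabs_gt0 in n0; exact: n0.
have WO : W `<=` Omega by move=> q [/srdom_sub].
have [_ [oWW _ _ _]] := ssd_codiscrete hOmega WO sWW sing.
split=> //.
  move=> I SI; apply: holoM => //.
  - by move=> z _ Iz; apply: clineV => //; exact: snorm_line.
  - apply: holoV => //; [by move=> z _; exact: snorm_line|by move=> z []|].
    by apply: holoW (snorm_holo u SI) => z [].
  - by apply: holoW (holo_scj SI sW oW (sr_holo u SI)) => z [].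
move=> p I Op SI Ip; apply: moderateM; last exact: scj_moderate.
have [k [c [r [c0 r0 hr]]]] := snorm_lower_bound nu Op SI Ip.
(* c |z - p|^k <= |f^s| is the growth bound for the inverse, with the same exponent. *)
exists k, c^-1, r; split=> // z Iz dz; have [_ hz] := hr z Iz dz.
have zp : 0 < qabs (z - p) by case/andP: dz.
have n0 : 0 < qabs (snorm u z) by rewrite (lt_le_trans _ hz)// mulr_gt0// exprn_gt0.
by rewrite qabsV ler_pdivrMr// -ler_pdivrMl ?invr_gt0// invrK.
Qed.

Lemma smul_inverse u : ~ coincide u (sconst 0) -> exists v,
  coincide (smul v u) (sconst 1) /\ coincide (smul u v) (sconst 1).
Proof.
move=> nu; exists (mksr (inv_admissible nu)); split=> q; rewrite inE/=.
  by move=> [[[_ nq] _] _]; exact: sprod_inv_l.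
by move=> [[_ [_ nq]] _]; exact: sprod_inv_r.
Qed.

End SemiregularOps.

(** Classical decidable equality and choice, which the quotient type is built on. *)
HB.instance Definition _ (R : realType) (Omega : set (quat R)) :=
  gen_eqMixin (semiregular Omega).
HB.instance Definition _ (R : realType) (Omega : set (quat R)) :=
  gen_choiceMixin (semiregular Omega).

(** * The quotient by coincidence *)

Section SemiregularRing.
Variables (R : realType) (Omega : set (quat R)).
Hypothesis hOmega : symmetric_slice_domain Omega.
Local Notation H := (quat R).
Local Notation sreg := (semiregular Omega).
Local Notation sadd := (sadd hOmega).
Local Notation smul := (smul hOmega).
Local Notation sopp := (sopp hOmega).
Local Notation sconst := (sconst hOmega).
Implicit Types u v w : sreg.

Definition coincideb u v : bool := `[< coincide u v >].

Lemma coincideb_refl : reflexive coincideb.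
Proof. by move=> u; apply/asboolP; exact: coincide_refl. Qed.
Lemma coincideb_sym : symmetric coincideb.
Proof. by move=> u v; apply/asboolP/asboolP; exact: coincide_sym. Qed.
Lemma coincideb_trans : transitive coincideb.
Proof. by move=> v u w /asboolP uv /asboolP vw; apply/asboolP/(coincide_trans uv vw). Qed.

Canonical coincide_equiv := EquivRel coincideb coincideb_refl coincideb_sym coincideb_trans.

(* The idle [let] makes the type mention [hOmega], on which its ring structure
   depends, so that canonical structure inference can recover it. *)
Definition srquot := let _ := hOmega in {eq_quot coincide_equiv}%qT.
HB.instance Definition _ := Choice.on srquot.
HB.instance Definition _ := EqQuotient.on srquot.

Definition srcls u : srquot := (\pi_srquot u)%qT.

Lemma srclsP u v : srcls u = srcls v <-> coincide u v.
Proof.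
split=> [/eqquotP|uv]; first by rewrite /= => /asboolP.
by apply/eqquotP/asboolP.
Qed.

Lemma srcls_surj (x : srquot) : exists u, srcls u = x.
Proof. by exists (repr x); exact: reprK. Qed.

Lemma srcls_repr u : coincide (repr (srcls u)) u.
Proof. by apply/srclsP; exact: reprK. Qed.

Definition qadd (x y : srquot) := srcls (sadd (repr x) (repr y)).
Definition qopp (x : srquot) := srcls (sopp (repr x)).
Definition qmult (x y : srquot) := srcls (smul (repr x) (repr y)).

Lemma qaddE u v : qadd (srcls u) (srcls v) = srcls (sadd u v).
Proof. by apply/srclsP/sadd_coincide; exact: srcls_repr. Qed.
Lemma qoppE u : qopp (srcls u) = srcls (sopp u).
Proof. by apply/srclsP/sopp_coincide; exact: srcls_repr. Qed.
Lemma qmultE u v : qmult (srcls u) (srcls v) = srcls (smul u v).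
Proof. by apply/srclsP/smul_coincide; exact: srcls_repr. Qed.

Lemma srcls_eq u v : (forall q, u q = v q) -> srcls u = srcls v.
Proof. by move=> uv; apply/srclsP => q _; exact: uv. Qed.

Fact qaddA : associative qadd.
Proof.
move=> x y z; have [u <-] := srcls_surj x; have [v <-] := srcls_surj y.
by have [w <-] := srcls_surj z; rewrite !qaddE; apply: srcls_eq => q /=; rewrite addrA.
Qed.
Fact qaddC : commutative qadd.
Proof.
move=> x y; have [u <-] := srcls_surj x; have [v <-] := srcls_surj y.
by rewrite !qaddE; apply: srcls_eq => q /=; rewrite addrC.
Qed.
Fact qadd0 : left_id (srcls (sconst 0)) qadd.
Proof.
move=> x; have [u <-] := srcls_surj x.
by rewrite qaddE; apply: srcls_eq => q /=; rewrite add0r.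
Qed.
Fact qaddN : left_inverse (srcls (sconst 0)) qopp qadd.
Proof.
move=> x; have [u <-] := srcls_surj x.
by rewrite qoppE qaddE; apply: srcls_eq => q /=; rewrite addNr.
Qed.
HB.instance Definition _ := GRing.isZmodule.Build srquot qaddA qaddC qadd0 qaddN.

Fact qmultA : associative qmult.
Proof.
move=> x y z; have [u <-] := srcls_surj x; have [v <-] := srcls_surj y.
by have [w <-] := srcls_surj z; rewrite !qmultE; apply: srcls_eq => q; exact: sprodA.
Qed.
Fact qmult1l : left_id (srcls (sconst 1)) qmult.
Proof.
move=> x; have [u <-] := srcls_surj x.
by rewrite qmultE; apply: srcls_eq => q; exact: sprod1l.
Qed.
Fact qmult1r : right_id (srcls (sconst 1)) qmult.
Proof.
move=> x; have [u <-] := srcls_surj x.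
by rewrite qmultE; apply: srcls_eq => q; exact: sprod1r.
Qed.
Fact qmultDl : left_distributive qmult +%R.
Proof.
move=> x y z; have [u <-] := srcls_surj x; have [v <-] := srcls_surj y.
have [w <-] := srcls_surj z; rewrite -![_ + _]/(qadd _ _) !(qmultE, qaddE).
by apply: srcls_eq => q; exact: sprodDl.
Qed.
Fact qmultDr : right_distributive qmult +%R.
Proof.
move=> x y z; have [u <-] := srcls_surj x; have [v <-] := srcls_surj y.
have [w <-] := srcls_surj z; rewrite -![_ + _]/(qadd _ _) !(qmultE, qaddE).
by apply: srcls_eq => q; exact: sprodDr.
Qed.
Fact qone_neq0 : srcls (sconst 1) != 0.
Proof.
apply/eqP => /srclsP; have [_ [_ _ [x0 Ox0] _]] := hOmega.
move=> /(_ (x0 *: 1)); rewrite inE/= => /(_ (conj Ox0 Ox0))/eqP.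
by rewrite oner_eq0.
Qed.
HB.instance Definition _ := GRing.Zmodule_isNzRing.Build srquot
  qmultA qmult1l qmult1r qmultDl qmultDr qone_neq0.

Lemma srquot_inverse (x : srquot) : x != 0 -> exists y, y * x = 1 /\ x * y = 1.
Proof.
have [u <-] := srcls_surj x => /eqP u0.
have [|v [vu uv]] := @smul_inverse R Omega hOmega u; first by move=> h; apply/u0/srclsP.
by exists (srcls v); split; [rewrite -[LHS]/(qmult _ _)|rewrite -[LHS]/(qmult _ _)];
  rewrite qmultE; apply/srclsP.
Qed.

(** The default value is [x] itself, as the unit ring structure requires of elements without
    inverse. *)
Definition srquot_inv (x : srquot) : srquot := xget x [set y | y * x = 1 /\ x * y = 1].

Fact srquot_invP x : x != 0 -> srquot_inv x * x = 1 /\ x * srquot_inv x = 1.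
Proof.
by move=> /srquot_inverse[y hy]; rewrite /srquot_inv; case: xgetP => [z -> //|/(_ y)].
Qed.
Fact srquot_mulV : {in [pred x : srquot | x != 0], left_inverse 1 srquot_inv *%R}.
Proof. by move=> x /srquot_invP[]. Qed.
Fact srquot_mulrV : {in [pred x : srquot | x != 0], right_inverse 1 srquot_inv *%R}.
Proof. by move=> x /srquot_invP[]. Qed.
Fact srquot_unitP (x y : srquot) : y * x = 1 /\ x * y = 1 -> x != 0.
Proof.
by move=> [h _]; apply: contra_eqN h => /eqP ->; rewrite mulr0 eq_sym oner_eq0.
Qed.
Fact srquot_inv_out : {in [predC [pred x : srquot | x != 0]], srquot_inv =1 id}.
Proof.
move=> x nx; rewrite /srquot_inv; case: xgetP => // y -> /srquot_unitP x0.
by exfalso; move: nx; rewrite inE/= => /negP; apply.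
Qed.
HB.instance Definition _ := GRing.NzRing_hasMulInverse.Build srquot
  srquot_mulV srquot_mulrV srquot_unitP srquot_inv_out.

Lemma srcls_add u v w : srcls w = srcls u + srcls v <-> is_semiregular_sum u v w.
Proof.
rewrite -[_ + _]/(qadd _ _) qaddE; split=> [/srclsP h q|h].
  by rewrite inE => -[duv dw]; apply: h; rewrite inE.
by apply/srclsP => q; rewrite inE/= => -[dw duv]; apply: h; rewrite inE.
Qed.

(** [star_product_sprod] supplies the product k, and [star_product_uniq] shows that any other k has
    the same values. *)
Lemma srcls_mul u v w : srcls w = srcls u * srcls v <-> is_semiregular_product u v w.
Proof.
rewrite -[_ * _]/(qmult _ _) qmultE.
have [sW _ _ ] := srI_facts u v.
have oW : open (srdom u `&` srdom v) by apply: openI; exact: srdom_open.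
split=> [/srclsP h|[k hk h]].
  exists (sprod u v); last by move=> q; rewrite inE => -[duv dw]; apply: h; rewrite inE.
  by apply: star_product_sprod => //; apply/regularP => // I SI; have [] := srI_holo u v SI.
apply/srclsP => q; rewrite inE/= => -[dw duv].
by rewrite h ?inE//; exact: (star_product_uniq sW hk).
Qed.

End SemiregularRing.

Theorem proposition7p4 (R : realType) (Omega : set (quat R))
    (hOmega : symmetric_slice_domain Omega) :
  exists (D : unitRingType) (cls : semiregular Omega -> D),
    [/\ forall x : D, exists f, cls f = x,
        forall f g, cls f = cls g <-> coincide f g,
        forall f g h, cls h = cls f + cls g <-> is_semiregular_sum f g h,
        forall f g h, cls h = cls f * cls g <-> is_semiregular_product f g h
      & GRing.field_axiom D].
Proof.
exists (srquot hOmega : unitRingType), (srcls hOmega); split.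
- exact: srcls_surj.
- exact: srclsP.
- exact: srcls_add.
- exact: srcls_mul.
(* The units of the quotient ring were declared to be its nonzero elements, so the axiom holds by
   unfolding. *)
- by move=> x x0; rewrite unfold_in.
Qed.
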